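(* Suppose $\mathscr H_{r,n}$ is semisimple. Let $\boldsymbol\lambda\in\mathscr P_{r,n}$ and $\mathfrak t\in\mathrm{Std}(\boldsymbol\lambda)$, and let $k,l$ be integers with $0\le k,l\le p_{\boldsymbol\lambda}$. Then $$r_{\mathfrak t,\,lo_{\boldsymbol\lambda}}\; r_{\mathfrak t\langle lo_{\boldsymbol\lambda}\rangle,\,ko_{\boldsymbol\lambda}}\;=\;r_{\mathfrak t,\,ko_{\boldsymbol\lambda}}\; r_{\mathfrak t\langle ko_{\boldsymbol\lambda}\rangle,\,lo_{\boldsymbol\lambda}} .$$
   Context: Setting. $r,p,d\ge1$ and $n\ge2$ are integers with $r=pd$; $K$ is a field containing a primitive $p$-th root of unity $\varepsilon$; $q\in K^\times$, $q\ne1$; $Q_1,\dots,Q_d\in K^\times$. $\mathscr H_{r,n}$ is the unital associative $K$-algebra with generators $T_0,\dots,T_{n-1}$ and relations $(T_0^p-Q_1^p)\cdots(T_0^p-Q_d^p)=0$; $T_0T_1T_0T_1=T_1T_0T_1T_0$; $(T_i-q)(T_i+1)=0$ for $1\le i\le n-1$; $T_iT_j=T_jT_i$ for $0\le i<j-1<n-1$; $T_iT_{i+1}T_i=T_{i+1}T_iT_{i+1}$ for $1\le i<n-1$. Its cyclotomic parameters, in order, are $\mathsf Q_{c+(t-1)d}=\varepsilon^tQ_c$ ($1\le c\le d$, $1\le t\le p$). It is (split) semisimple iff $\prod_{i=1}^n(1+q+\cdots+q^{i-1})\prod_{-n<k<n}\bigl(\prod_{1\le i<j\le d}\prod_{0\le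 t<p}(Q_i-\varepsilon^tq^kQ_j)\bigr)\bigl(\prod_{1\le i\le d}\prod_{1\le t<p}Q_i(1-\varepsilon^tq^k)\bigr)\ne0$. Combinatorics. $\mathscr P_{r,n}$ is the set of $r$-multipartitions $\boldsymbol\lambda=(\lambda^{(1)},\dots,\lambda^{(r)})$ of $n$. $\mathrm{Std}(\boldsymbol\lambda)$ is the set of standard $\boldsymbol\lambda$-tableaux $\mathfrak t=(\mathfrak t^{(1)},\dots,\mathfrak t^{(r)})$ (bijective fillings by $1,\dots,n$, increasing along rows and columns of each component). $\mathfrak S_n$ acts on tableaux from the right by permuting entries. $\mathfrak t^{\boldsymbol\lambda}$ is the tableau with $1,\dots,n$ entered in order along successive rows of $\lambda^{(1)}$, then $\lambda^{(2)}$, etc.; $d(\mathfrak t)\in\mathfrak S_n$ is defined by $\mathfrak t=\mathfrak t^{\boldsymbol\lambda}d(\mathfrak t)$. Put $\boldsymbol\lambda^{[t]}=(\lambda^{(dt-d+1)},\dots,\lambda^{(dt)})$, $\mathfrak t^{[t]}=(\mathfrak t^{(dt-d+1)},\dots,\mathfrak t^{(dt)})$ for $1\le t\le p$, with superscripts $[t]$ read modulo $p$. For $z\in\mathbb Z$: $\boldsymbol\lambda\langle z\rangle=(\boldsymbol\lambda^{[z+1]},\dots,\boldsymbol\lambda^{[z+p]})$ and $\mathfrak t\langle z\rangle=(\mathfrak t^{[z+1]},\dots,\mathfrak t^{[z+p]})\in\mathrm{Std}(\boldsymbol\lambda\langle z\rangle)$. $o_{\boldsymbol\lambda}=\min\{k\ge1:\boldsymbol\lambda^{[k+t]}=\boldsymbol\lambda^{[t]}\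 \forall t\in\mathbb Z\}$ (it divides $p$), $p_{\boldsymbol\lambda}=p/o_{\boldsymbol\lambda}$. The residue is $\mathrm{res}_{\mathfrak t}(k)=\varepsilon^tq^{b-a}Q_c$ if $k$ lies in row $a$, column $b$ of $\mathfrak t^{(c+(t-1)d)}$, $1\le c\le d$, $1\le t\le p$. Seminormal basis. $L_1=T_0$, $L_{k+1}=q^{-1}T_kL_kT_k$; $*$ is the anti-automorphism fixing all $T_i$; $m_{\boldsymbol\lambda}=\bigl(\prod_{s=2}^r\prod_{k=1}^{|\lambda^{(1)}|+\cdots+|\lambda^{(s-1)}|}(L_k-\mathsf Q_s)\bigr)\sum_{w\in\mathfrak S_{\boldsymbol\lambda}}T_w$ with $\mathfrak S_{\boldsymbol\lambda}$ the row stabilizer of $\mathfrak t^{\boldsymbol\lambda}$; $R(k)=\{\mathrm{res}_{\mathfrak s}(k):\mathfrak s\in\mathrm{Std}(\boldsymbol\mu),\boldsymbol\mu\in\mathscr P_{r,n}\}$; $F_{\mathfrak t}=\prod_{k=1}^n\prod_{c\in R(k),c\ne\mathrm{res}_{\mathfrak t}(k)}\frac{L_k-c}{\mathrm{res}_{\mathfrak t}(k)-c}$; $f_{\mathfrak s\mathfrak t}=F_{\mathfrak s}T_{d(\mathfrak s)}^*m_{\boldsymbol\lambda}T_{d(\mathfrak t)}F_{\mathfrak t}$. In the semisimple case $\{f_{\mathfrak s\mathfrak t}\}$ is a $K$-basis of $\mathscr H_{r,n}$ and there are unique $\gamma_{\mathfrak t}\in K^\times$ with $f_{\mathfrak u\mathfrak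 v}f_{\mathfrak s\mathfrak t}=\delta_{\mathfrak v\mathfrak s}\gamma_{\mathfrak s}f_{\mathfrak u\mathfrak t}$. Equivalently: $\gamma_{\mathfrak t^{\boldsymbol\lambda}}=\prod_{c,i}[\lambda^{(c)}_i]_q^!\prod_{1\le b<c\le r}\prod_{(i,j)\in\lambda^{(b)}}(q^{j-i}\mathsf Q_b-\mathsf Q_c)$, where $[m]_q^!=\prod_{i=1}^m\frac{q^i-1}{q-1}$, and if $\mathfrak s$ and $\mathfrak t=\mathfrak s(i,i+1)$ are standard with $\ell(d(\mathfrak t))=\ell(d(\mathfrak s))+1$ then $\gamma_{\mathfrak t}=\frac{(qx-y)(x-qy)}{(x-y)^2}\gamma_{\mathfrak s}$ with $x=\mathrm{res}_{\mathfrak s}(i)$, $y=\mathrm{res}_{\mathfrak s}(i+1)$. The tableaux $\mathrm{mid}_k(\mathfrak t)$. For $\mathfrak t\in\mathrm{Std}(\boldsymbol\lambda)$ and $1\le k\le p$ let $a_k=\sum_{i=1}^k|\boldsymbol\lambda^{[i]}|$ and write uniquely $d(\mathfrak t)=x_kd_k$ with $x_k\in\mathfrak S_{(a_k,n-a_k)}=\mathfrak S_{\{1,\dots,a_k\}}\times\mathfrak S_{\{a_k+1,\dots,n\}}$ and $d_k$ a minimal length right coset representative of $\mathfrak S_{(a_k,n-a_k)}$ in $\mathfrak S_n$. Put $\mathrm{mid}_k(\mathfrak t)=\mathfrak t^{\boldsymbol\lambda}x_k$, $\mathrm{mid}_0(\mathfrak t)=\mathfrak t=\mathrm{mid}_p(\mathfrak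 t)$, and extend to $k\in\mathbb Z$ periodically modulo $p$. Finally $r_{\mathfrak t,k}=\gamma_{\mathfrak t}/\gamma_{\mathrm{mid}_k(\mathfrak t)}$. *)

(* Defs.v *)
From HB Require Import structures.
From mathcomp Require Import all_boot all_order all_algebra all_fingroup.

Set Implicit Arguments.
Unset Strict Implicit.
Unset Printing Implicit Defensive.

Import GRing.Theory.
Local Open Scope ring_scope.

(** Indices are 0-based: the entry [k : 'I_n] of a tableau stands for k+1, the
    component [s : 'I_(p * d)] for the (s+1)-st component, and rows and columns
    are likewise numbered from 0. *)

Section SymmetricGroup.
Variable n : nat.

(** [sref i], for 0 < i < n, exchanges the entries that are called i and i+1
    when counting from 1; [sref 0 = 1]. *)
Definition sref (i : 'I_n) : 'S_n := tperm (insubd i i.-1) i.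

Definition len (w : 'S_n) : nat :=
  #|[set ij : 'I_n * 'I_n | (ij.1 < ij.2)%N && (w ij.2 < w ij.1)%N]|.

Definition young (a : nat) : {set 'S_n} :=
  [set w : 'S_n | [forall i : 'I_n, (w i < a)%N == (i < a)%N]].

(** The factor x in w = x d, where x lies in [young a] and d has minimal length
    in the right coset [young a * d]. *)
Definition young_part (a : nat) (w : 'S_n) : 'S_n :=
  odflt 1%g [pick x in young a |
    [forall y in young a, (len (x^-1 * w)%g <= len (y * (x^-1 * w))%g)%N]].

End SymmetricGroup.

Section Combinatorics.
Variables p d n : nat.

(** A partition of at most n is its weakly decreasing sequence of parts, the
    first n of which are recorded (the others are 0). *)
Definition mpart := {ffun 'I_(p * d) -> {ffun 'I_n -> 'I_n.+1}}.

Definition is_mpart (lam : mpart) : bool :=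
  [forall s : 'I_(p * d), forall a : 'I_n, forall b : 'I_n,
     (a <= b)%N ==> (lam s b <= lam s a)%N]
  && ((\sum_(s < p * d) \sum_(a < n) lam s a)%N == n).

(** ((component, row), column) *)
Definition node := ('I_(p * d) * 'I_n * 'I_n)%type.

Definition diagram (lam : mpart) : {set node} :=
  [set x : node | (x.2 < lam x.1.1 x.1.2)%N].

(** Number of boxes in the first s components. *)
Definition presize (lam : mpart) (s : nat) : nat :=
  (\sum_(j < p * d | (j < s)%N) \sum_(a < n) lam j a)%N.

(** A filling of nodes; [None] marks the nodes outside the shape. *)
Definition tableau := {ffun node -> option 'I_n}.

Definition Std (lam : mpart) : {set tableau} :=
  [set t : tableau |
    [&& [forall x : node, (t x != None) == (x \in diagram lam)],
        [forall k : 'I_n, #|[set x : node | t x == Some k]| == 1%N] &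
        [forall x : node, forall y : node, forall k : 'I_n, forall l : 'I_n,
           [&& t x == Some k, t y == Some l, x.1.1 == y.1.1 &
               ((x.1.2 == y.1.2) && (x.2 < y.2)%N)
               || ((x.2 == y.2) && (x.1.2 < y.1.2)%N)]
           ==> (k < l)%N]]].

Definition tact (t : tableau) (w : 'S_n) : tableau :=
  [ffun x => omap w (t x)].

(** Reading order: by component, then by row, then by column. *)
Definition before (x y : node) : bool :=
  [|| (x.1.1 < y.1.1)%N,
      (x.1.1 == y.1.1) && (x.1.2 < y.1.2)%N |
      [&& x.1.1 == y.1.1, x.1.2 == y.1.2 & (x.2 < y.2)%N]].

Definition tinit (lam : mpart) : tableau :=
  [ffun x => if x \in diagram lam
             then insub #|[set y in diagram lam | before y x]| else None].

(** The permutation written d(t) for a tableau t of shape [lam]. *)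
Definition dperm (lam : mpart) (t : tableau) : 'S_n :=
  odflt 1%g [pick w : 'S_n | tact (tinit lam) w == t].

Definition row_stab (lam : mpart) : {set 'S_n} :=
  [set w : 'S_n | [forall x in diagram lam, forall y in diagram lam,
     (omap w (tinit lam x) == tinit lam y) ==> (x.1 == y.1)]].

Definition shift_comp (z : nat) (s : 'I_(p * d)) : 'I_(p * d) :=
  Ordinal (ltn_pmod (s + z * d) (leq_ltn_trans (leq0n s) (ltn_ord s))).

(** The operations written with angle brackets, for z >= 0. *)
Definition mshift (z : nat) (lam : mpart) : mpart :=
  [ffun s => lam (shift_comp z s)].

Definition tshift (z : nat) (t : tableau) : tableau :=
  [ffun x : node => t (shift_comp z x.1.1, x.1.2, x.2)].

(** The minimum is attained at some k <= p because [mshift p lam = lam]. *)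
Definition operiod (lam : mpart) : nat :=
  [arg min_(k < (ord_max : 'I_p.+1) | (0 < k)%N && (mshift k lam == lam)) (k : nat)].

Definition pquot (lam : mpart) : nat := (p %/ operiod lam)%N.

Definition mid (lam : mpart) (t : tableau) (k : nat) : tableau :=
  if (k %% p)%N == 0%N then t
  else tact (tinit lam)
            (young_part (presize lam (k %% p * d)) (dperm lam t)).

End Combinatorics.

Section Hecke.
Variables (p d n : nat) (K : fieldType) (eps q : K) (Q : d.-tuple K).

Local Notation mpart := (mpart p d n).
Local Notation node := (node p d n).
Local Notation tableau := (tableau p d n).

Definition cyc_param (s : nat) : K := eps ^+ (s %/ d).+1 * Q`_(s %% d).

Definition node_res (x : node) : K :=
  cyc_param x.1.1 * q ^ (x.2%:Z - x.1.2%:Z).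

Definition res (t : tableau) (k : 'I_n) : K :=
  if [pick x | t x == Some k] is Some x then node_res x else 0.

Definition res_set (k : 'I_n) : seq K :=
  undup [seq res s k | s in
    [pred s : tableau | [exists mu : mpart, is_mpart mu && (s \in Std mu)]]].

(** Only T 0, ..., T n.-1 are relevant in a family T : nat -> A. *)
Definition hecke_relations (A : algType K) (T : nat -> A) : Prop :=
  [/\ \prod_(c < d) (T 0%N ^+ p - (Q`_c ^+ p)%:A) = 0,
      T 0%N * T 1%N * T 0%N * T 1%N = T 1%N * T 0%N * T 1%N * T 0%N,
      forall i, (0 < i < n)%N -> (T i - q%:A) * (T i + 1) = 0,
      forall i j, (i.+1 < j < n)%N -> T i * T j = T j * T i &
      forall i, (0 < i)%N -> (i.+1 < n)%N ->
        T i * T i.+1 * T i = T i.+1 * T i * T i.+1].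

(** A, with generators T 0, ..., T n.-1, is the algebra presented by
    [hecke_relations]; this determines (A, T) up to unique isomorphism. *)
Definition is_hecke_algebra (A : algType K) (T : nat -> A) : Prop :=
  hecke_relations T /\
  forall (B : algType K) (T' : nat -> B), hecke_relations T' ->
    exists phi : {lrmorphism A -> B},
      (forall i, (i < n)%N -> phi (T i) = T' i) /\
      (forall psi : {lrmorphism A -> B},
         (forall i, (i < n)%N -> psi (T i) = T' i) -> psi =1 phi).

Definition is_star (A : algType K) (T : nat -> A) (star : A -> A) : Prop :=
  [/\ bijective star,
      forall (a : K) x y, star (a *: x + y) = a *: star x + star y,
      star 1 = 1,
      forall x y, star (x * y) = star y * star x &
      forall i, (i < n)%N -> star (T i) = T i].

Section Seminormal.
Variables (A : algType K) (T : nat -> A) (star : A -> A).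

(** [JM k] is the element written L_(k+1). *)
Fixpoint JM (k : nat) : A :=
  if k is k'.+1 then q^-1 *: (T k * JM k' * T k) else T 0%N.

(** The product along a reduced expression of w; it does not depend on the
    choice. The index 0 does not occur in a reduced expression, as
    [sref 0 = 1]. *)
Definition Tperm (w : 'S_n) : A :=
  if [pick s : (len w).-tuple 'I_n | (\prod_(i <- s) sref i)%g == w]
  is Some s then \prod_(i <- s) T i else 1.

Definition melt (lam : mpart) : A :=
  (\prod_(1 <= s < p * d) \prod_(0 <= k < presize lam s)
      (JM k - (cyc_param s)%:A))
  * \sum_(w in row_stab lam) Tperm w.

Definition Felt (t : tableau) : A :=
  \prod_(k < n) \prod_(c <- res_set k | c != res t k)
     ((res t k - c)^-1 *: (JM k - c%:A)).

(** f_(s, t) for s and t standard of shape [lam]. *)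
Definition felt (lam : mpart) (s t : tableau) : A :=
  Felt s * star (Tperm (dperm lam s)) * melt lam
  * Tperm (dperm lam t) * Felt t.

(** [gam] is the family of coefficients gamma_t. In the semisimple case the
    f_(s, t) form a basis and [gam] is unique on standard tableaux. *)
Definition is_gamma (gam : tableau -> K) : Prop :=
  (forall lam : mpart, is_mpart lam ->
     forall t : tableau, t \in Std lam -> gam t != 0) /\
  (forall lam mu : mpart, is_mpart lam -> is_mpart mu ->
     forall u v s t : tableau,
       u \in Std lam -> v \in Std lam -> s \in Std mu -> t \in Std mu ->
       felt lam u v * felt mu s t
       = if v == s then gam s *: felt lam u t else 0).

End Seminormal.

Definition rcoef (gam : tableau -> K) (lam : mpart) (t : tableau) (k : nat) : K :=
  gam t / gam (mid lam t k).

End Hecke.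

Definition left_ideal (A : nzRingType) (I : A -> Prop) : Prop :=
  [/\ I 0, forall x y, I x -> I y -> I (x + y) & forall a x, I x -> I (a * x)].

(** Every submodule of the regular left module is a direct summand. *)
Definition semisimple (A : nzRingType) : Prop :=
  forall I : A -> Prop, left_ideal I ->
    exists J : A -> Prop,
      [/\ left_ideal J,
          forall x, I x -> J x -> x = 0 &
          forall x, exists y z, [/\ I y, J z & x = y + z]].

(* Main.v *)
Require Import Defs.
From HB Require Import structures.
From mathcomp Require Import all_boot all_order all_algebra all_fingroup.
From mathcomp Require Import ring zify.
From Stdlib Require Import Classical.

(** Put g(x, y) = (q x - y)(x - q y) / (x - y)^2, a symmetric function that is
    invariant under a common scaling of x and y ([swap_weight]). The
    coefficients gamma have a closed form up to a factor depending on the shape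
    only ([gamma_formula]): gamma_t is this factor times the product of
    g(res A, res B) over the inverted pairs of t, that is, the pairs of boxes
    A, B such that A comes first in reading order but contains the larger entry.

    Granting this, the theorem is a count. Passing from t to mid_z(t) sorts the
    first z blocks before the others and keeps the order of the entries inside
    either part, so that r_(t, z) is the product of g over the pairs of boxes
    (A, B) with A in the first z blocks, B in a later one, and t(B) < t(A)
    ([rcoef_crossing]). Write c(X) for this product with an arbitrary set X of
    blocks in place of the first z blocks. Since g is invariant under
    scaling, rotating the blocks of t rotates X. If L and M are shifts fixing the
    shape and L + M <= p, the left-hand side is c([0, L)) c([L, L + M)). Sorting
    the pairs by the positions of their members, this is c([0, L + M)) times the
    product of g over all the pairs between [0, L) and [L, L + M), inverted or
    not; the other side is the same with L and M exchanged. The product of g over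
    all pairs between two adjacent intervals depends on their lengths only, not
    on their order, because it is the quotient of the full weight of the union
    by the full weights of the parts, and full weights are invariant under the
    shifts that fix the shape ([cross_interval_swap]). If L + M > p the same
    argument applies to complements ([block_crossing_commute]).

    The closed form is read off from the seminormal representation of shape
    lambda. It is defined by Young's formulas on functions over the standard
    tableaux, and it exists because these formulas satisfy the defining
    relations ([seminormal_rep]). There F_t is the projection to t, and the
    initial tableau tau is a left and right eigenvector of m_lambda, so that the
    entry at (tau, tau) of f_(tau, v) f_(v, tau) = gamma_v f_(tau, tau)
    expresses gamma_v by matrix entries of T_d(v) and of its reverse
    ([matrix_unit_relation]). A reduced word reaches v along one path only, which
    creates one inverted pair at each step ([up_down_reduced]).

    Young's formulas have denominators. They are nonzero by semisimplicity, which
    is used in the form that every one-dimensional constituent of a module splits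
    off: an eigenvector v for a character has a dual eigenform f with f(v) != 0
    ([dual_eigenvector]). In two explicit modules f(v) can be computed: up to a
    factor, it is the Poincare polynomial of the symmetric group in one of them
    ([poincare_neq0]), and the product of the A q^k - B for 0 <= k < n in the
    other, where A and B are two of the cyclotomic parameters
    ([parameters_separated]). *)

Set Implicit Arguments.
Unset Strict Implicit.
Unset Printing Implicit Defensive.

Import GRing.Theory.
Local Open Scope ring_scope.

(** * Intertwiners and one-dimensional constituents *)

Lemma eq_block_mx (R : Type) m1 m2 n1 n2
    (B B' : 'M[R]_(m1, n1)) (C C' : 'M_(m1, n2))
    (D D' : 'M_(m2, n1)) (E E' : 'M_(m2, n2)) :
  B = B' -> C = C' -> D = D' -> E = E' ->
  block_mx B C D E = block_mx B' C' D' E'.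
Proof. by move=> -> -> -> ->. Qed.

Section Intertwiner.
Variables (K : fieldType) (A : algType K) (a b : nat).
Variables (phi : {lrmorphism A -> 'M[K]_a.+1}) (chi : {lrmorphism A -> 'M[K]_b.+1}).
Variable P : 'M[K]_(a.+1, b.+1).

(** The direct sum of [phi] and [chi], conjugated by the unipotent block matrix
    with corner [P]. Its corner vanishes at [h] exactly when [P] intertwines the
    actions of [h], which turns an intertwining relation into an equality of two
    algebra morphisms, to be tested on generators. *)
Definition sheared_sum (h : A) : 'M[K]_((a + b.+1).+1) :=
  (block_mx (phi h) (phi h *m P - P *m chi h) 0 (chi h) : 'M_(a.+1 + b.+1)).

Fact sheared_sum_linear : linear sheared_sum.
Proof.
move=> c x y; rewrite /sheared_sum.
rewrite (scale_block_mx c (phi x)) (add_block_mx (c *: phi x)).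
apply: (@eq_block_mx K a.+1 b.+1 a.+1 b.+1).
- exact: linearP.
- rewrite (linearP phi) (linearP chi) mulmxDl mulmxDr -scalemxAl -scalemxAr.
  by rewrite scalerBr opprD addrACA.
- by rewrite scaler0 addr0.
- exact: linearP.
Qed.

HB.instance Definition _ :=
  GRing.isLinear.Build K A _ _ sheared_sum sheared_sum_linear.

Fact sheared_sum_monoid : monoid_morphism sheared_sum.
Proof.
split=> [|x y]; rewrite /sheared_sum.
  by rewrite !rmorph1 mul1mx mulmx1 subrr -scalar_mx_block.
rewrite !rmorphM /=.
refine (etrans _ (esym (@mulmx_block K a.+1 b.+1 a.+1 b.+1 a.+1 b.+1
  _ _ _ _ _ _ _ _))).
rewrite !mul0mx !mulmx0 !addr0 !add0r; apply: (@eq_block_mx K a.+1 b.+1 a.+1 b.+1) => //.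
rewrite -[phi x * phi y]/(phi x *m phi y) -[chi x * chi y]/(chi x *m chi y).
by rewrite mulmxBr mulmxBl !mulmxA addrA subrK.
Qed.

HB.instance Definition _ :=
  GRing.isMonoidMorphism.Build A _ sheared_sum sheared_sum_monoid.

End Intertwiner.

Section HeckeAlgebra.
Variables (p d n : nat) (K : fieldType) (q : K) (Q : d.-tuple K).
Variables (H : algType K) (T : nat -> H).
Hypothesis hH : is_hecke_algebra p n q Q T.

Lemma hecke_relations_morph (B : algType K) (f : {lrmorphism H -> B}) :
  hecke_relations p n q Q (f \o T).
Proof.
have [[R0 R1 R2 R3 R4] _] := hH.
have fA c : f c%:A = c%:A by rewrite -[RHS](rmorph_alg f).
split=> [| |i ni|i j ij|i i0 ni] /=.
- rewrite -(rmorph0 f) -R0 rmorph_prod; apply: eq_bigr => c _.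
  rewrite rmorphB (rmorphXn f); congr (_ - _); exact/esym/fA.
- by rewrite -!rmorphM R1.
- rewrite -(rmorph0 f) -(R2 i ni) rmorphM rmorphB rmorphD rmorph1.
  by congr ((_ - _) * _); apply/esym/fA.
- by rewrite -!rmorphM R3.
- by rewrite -!rmorphM R4.
Qed.

Lemma hecke_morph_ext (B : algType K) (f g : {lrmorphism H -> B}) :
  (forall i, (i < n)%N -> f (T i) = g (T i)) -> f =1 g.
Proof.
move=> fg; have [_ /(_ B _ (hecke_relations_morph g))] := hH.
case=> phi [_ phiP] h; rewrite (phiP f) ?(phiP g) //.
Qed.

Lemma intertwiner_ext a b (phi : {lrmorphism H -> 'M[K]_a.+1})
    (chi : {lrmorphism H -> 'M[K]_b.+1}) (P : 'M[K]_(a.+1, b.+1)) :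
  (forall i, (i < n)%N -> phi (T i) *m P = P *m chi (T i)) ->
  forall h : H, phi h *m P = P *m chi h.
Proof.
move=> com h.
have eq0 : sheared_sum phi chi P =1 sheared_sum phi chi 0.
  apply: hecke_morph_ext => i ni; rewrite /= /sheared_sum.
  by rewrite com // subrr mulmx0 mul0mx subrr.
have /(congr1 (@ursubmx K a.+1 b.+1 a.+1 b.+1)) := eq0 h.
rewrite /sheared_sum !block_mxKur mulmx0 mul0mx subrr => /eqP.
by rewrite subr_eq0 => /eqP.
Qed.

Hypothesis hss : semisimple H.

(** If 1 = h u + z with z in a complement of H u, then u z = u - u h u lies both
    in H u and in the complement. *)
Lemma semisimple_regular (u : H) : exists h, u = u * h * u.
Proof.
have [|J [[J0 JD JM] IJ0 IJ]] := hss (I := fun x => exists h, x = h * u).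
  split=> [|x y [h ->] [h' ->]|c x [h ->]].
  - by exists 0; rewrite mul0r.
  - by exists (h + h'); rewrite mulrDl.
  - by exists (c * h); rewrite mulrA.
have [y [z [[h ->] Jz def1]]] := IJ 1; exists h.
apply/eqP; rewrite -subr_eq0; apply/eqP/IJ0.
  by exists (1 - u * h); rewrite mulrBl mul1r.
have -> : u - u * h * u = u * z.
  by rewrite -mulrA -[X in X - _]mulr1 def1 mulrDr addrC addKr.
exact: JM.
Qed.

(** z is the component of 1 in a left ideal complementing the kernel of [chi]:
    this ideal meets the kernel in 0, so H acts on it by [chi]. On the right, the
    defect u = z x - chi(x) z satisfies u z = 0, hence u u = 0, and
    h u = chi(h) u; by regularity u = u h u for some h, which is chi(h) u u = 0. *)
Lemma character_idempotent (chi : {lrmorphism H -> 'M[K]_1}) :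
  exists z : H, [/\ chi z = 1, forall x : H, x * z = chi x 0 0 *: z
              & forall x : H, z * x = chi x 0 0 *: z].
Proof.
have chiE x : chi x = (chi x 0 0)%:A.
  by apply/matrixP=> i j; rewrite !ord1 !mxE eqxx mulr1.
have chi_s c z : chi (c *: z) = c *: chi z by rewrite linearZ.
have [|J [[J0 JD JM] IJ0 IJ]] := hss (I := fun x : H => chi x = 0).
  split=> [|x y cx cy|c x cx]; first exact: rmorph0.
    by rewrite rmorphD /= cx cy addr0.
  by rewrite rmorphM /= cx mulr0.
have [y [z [chiy Jz def1]]] := IJ 1.
have chiz : chi z = 1 by rewrite -(rmorph1 chi) def1 rmorphD /= chiy add0r.
have lz x : x * z = chi x 0 0 *: z.
  apply/eqP; rewrite -subr_eq0; apply/eqP/IJ0.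
    by rewrite rmorphB rmorphM /= chi_s chiz mulr1 {1}chiE subrr.
  by rewrite -[_ *: z]mulr_algl -mulrBl; apply: JM.
exists z; split=> // x; apply/eqP; rewrite -subr_eq0; apply/eqP.
set u := _ - _; have uE : u = z * (x - (chi x 0 0)%:A).
  by rewrite /u mulrBr -[z * _%:A]scalerAr mulr1.
have [h uhu] := semisimple_regular u.
have uz : u * z = 0.
  by rewrite uE -mulrA mulrBl lz -[_%:A * z]scalerAl mul1r subrr mulr0.
have hu : h * u = chi h 0 0 *: u by rewrite {1}uE mulrA lz -scalerAl -uE.
by rewrite uhu -mulrA hu -scalerAr {2}uE mulrA uz mul0r scaler0.
Qed.

(** The rows of the projection [phi z] onto the isotypic part of [chi] are
    eigenforms. When v and f can be computed, f v != 0 is a condition on the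
    parameters of the algebra. *)
Lemma dual_eigenvector a (phi : {lrmorphism H -> 'M[K]_a.+1})
    (chi : {lrmorphism H -> 'M[K]_1}) (v : 'cV[K]_a.+1) :
  (forall i, (i < n)%N -> phi (T i) *m v = v *m chi (T i)) -> v != 0 ->
  exists f : 'rV[K]_a.+1, f *m v != 0 /\
    forall h : H, f *m phi h = chi h 0 0 *: f.
Proof.
move=> eigv v0; have [z [chiz _ zl]] := character_idempotent chi.
have zv : phi z *m v = v.
  by rewrite (intertwiner_ext eigv) chiz mulmx1.
have /cV0Pn[i vi0] := v0.
exists (row i (phi z)); split=> [|h].
  rewrite -row_mul zv; apply: contra_neq vi0 => /rowP/(_ 0).
  by rewrite !mxE.
rewrite -row_mul -[phi z *m _]/(phi z * _) -rmorphM /= zl.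
have -> : phi (chi h 0 0 *: z) = chi h 0 0 *: phi z by rewrite linearZ.
by apply/rowP=> j; rewrite !mxE.
Qed.

End HeckeAlgebra.

(** * Operators exchanging adjacent labels *)

Section FunctionMatrices.
Variables (K : fieldType) (X : finType) (x0 : X).

Local Notation N := #|X|.-1.

Definition elt_of (i : 'I_N.+1) : X := nth x0 (enum X) i.
Definition idx_of (x : X) : 'I_N.+1 := inord (index x (enum X)).

Lemma elt_ofK : cancel idx_of elt_of.
Proof.
move=> x; rewrite /elt_of /idx_of inordK ?nth_index ?mem_enum //.
have X0 : (0 < #|X|)%N by apply/card_gt0P; exists x0.
by rewrite prednK // cardE index_mem mem_enum.
Qed.

Lemma idx_ofK : cancel elt_of idx_of.
Proof.
move=> i; apply/val_inj; rewrite /elt_of /idx_of /=.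
have X0 : (0 < #|X|)%N by apply/card_gt0P; exists x0.
have lti : (i < size (enum X))%N by rewrite -cardE -[X in (_ < X)%N](prednK X0).
by rewrite index_uniq ?enum_uniq // inordK.
Qed.

(** Modules below have a basis indexed by words, permutations or tableaux.
    Letting matrices act on functions over the index type keeps the enumeration
    of that type out of the calculations. *)
Definition mxfun (M : 'M[K]_N.+1) (g : X -> K) (x : X) : K :=
  \sum_y M (idx_of x) (idx_of y) * g y.

Lemma big_idx_of (F : 'I_N.+1 -> K) : \sum_i F i = \sum_x F (idx_of x).
Proof. by rewrite (reindex idx_of) //; exists elt_of => i _; rewrite ?elt_ofK ?idx_ofK. Qed.

Lemma mxfun_ext M g h : g =1 h -> mxfun M g =1 mxfun M h.
Proof. by move=> gh x; apply: eq_bigr => y _; rewrite gh. Qed.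

Lemma mxfunM (M M' : 'M[K]_N.+1) g x : mxfun (M * M') g x = mxfun M (mxfun M' g) x.
Proof.
rewrite /mxfun; under eq_bigr do rewrite mxE big_distrl /=.
rewrite exchange_big big_idx_of; apply: eq_bigr => z _.
by rewrite big_distrr; apply: eq_bigr => y _; rewrite /= mulrA.
Qed.

Lemma mxfunD M M' g x : mxfun (M + M') g x = mxfun M g x + mxfun M' g x.
Proof.
by rewrite /mxfun -big_split; apply: eq_bigr => y _; rewrite mxE mulrDl.
Qed.

Lemma mxfunZ c M g x : mxfun (c *: M) g x = c * mxfun M g x.
Proof.
by rewrite /mxfun big_distrr; apply: eq_bigr => y _; rewrite /= mxE mulrA.
Qed.

Lemma mxfunB M M' g x : mxfun (M - M') g x = mxfun M g x - mxfun M' g x.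
Proof. by rewrite mxfunD -scaleN1r mxfunZ mulN1r. Qed.

Lemma mxfun1 g x : mxfun 1 g x = g x.
Proof.
rewrite /mxfun (bigD1 x) //= mxE eqxx mul1r big1 ?addr0 // => y yx.
rewrite mxE -(inj_eq (can_inj idx_ofK)) !elt_ofK eq_sym (negPf yx) mul0r //.
Qed.

Lemma mxfun0 g x : mxfun 0 g x = 0.
Proof. by rewrite /mxfun big1 // => y _; rewrite mxE mul0r. Qed.

Lemma mxfunA c g x : mxfun c%:A g x = c * g x.
Proof. by rewrite mxfunZ mxfun1. Qed.

Lemma mxfun_sum I (r : seq I) (P : pred I) (F : I -> 'M[K]_N.+1) g x :
  mxfun (\sum_(i <- r | P i) F i) g x = \sum_(i <- r | P i) mxfun (F i) g x.
Proof.
elim/big_rec2: _ => [|i u v _ <-]; first exact: mxfun0.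
exact: mxfunD.
Qed.

Lemma mxfun_scaler M c g x : mxfun M (fun y => c * g y) x = c * mxfun M g x.
Proof. by rewrite /mxfun big_distrr; apply: eq_bigr => y _ /=; ring. Qed.

Lemma mxfun_inj M M' :
  (forall g x, mxfun M g x = mxfun M' g x) -> M = M'.
Proof.
move=> E; apply/matrixP=> i j.
have F M1 : mxfun M1 (fun y => (y == elt_of j)%:R) (elt_of i) = M1 i j.
  rewrite /mxfun (bigD1 (elt_of j)) //= eqxx mulr1 big1 ?addr0 ?idx_ofK //.
  by move=> y /negPf->; rewrite mulr0.
by rewrite -!F E.
Qed.

Definition two_term (al be : X -> K) (s : X -> X) : 'M[K]_N.+1 :=
  \matrix_(i, j) (al (elt_of i) * (i == j)%:R +
    be (elt_of i) * (s (elt_of i) == elt_of j)%:R).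

Lemma mxfun_two_term al be s g x :
  mxfun (two_term al be s) g x = al x * g x + be x * g (s x).
Proof.
rewrite /mxfun; under eq_bigr do rewrite mxE !elt_ofK mulrDl.
rewrite big_split /= (bigD1 x) //= eqxx mulr1 big1 ?addr0; last first.
  move=> y yx; rewrite -(inj_eq (can_inj idx_ofK)) !elt_ofK eq_sym (negPf yx).
  by rewrite mulr0 mul0r.
rewrite (bigD1 (s x)) //= eqxx mulr1 big1 ?addr0 // => y yx.
by rewrite eq_sym (negPf yx) mulr0 mul0r.
Qed.

End FunctionMatrices.

Definition swapn (i j : nat) : nat :=
  if j == i.-1 then i else if j == i then i.-1 else j.

Lemma swapn_pred i : swapn i i.-1 = i.
Proof. by rewrite /swapn eqxx. Qed.

Lemma swapn_same i : (0 < i)%N -> swapn i i = i.-1.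
Proof. by rewrite /swapn eqxx; case: eqP; lia. Qed.

Lemma swapn_far i j : (j.+1 < i)%N || (i < j)%N -> swapn i j = j.
Proof. by rewrite /swapn; repeat (case: eqP => ?); lia. Qed.

Lemma swapnK i : (0 < i)%N -> involutive (swapn i).
Proof.
move=> i0 j; rewrite {2}/swapn.
case: (j =P i.-1) => [->|n1]; first by rewrite swapn_same.
case: (j =P i) => [->|n2]; first exact: swapn_pred.
by rewrite /swapn; repeat (case: eqP => ?); lia.
Qed.

Lemma swapnC i j k : (0 < i)%N -> (i.+1 < j)%N ->
  swapn i (swapn j k) = swapn j (swapn i k).
Proof.
move=> i0 ij; have j0 : (0 < j)%N by lia.
case: (k =P i.-1) => [->|n1].
  by rewrite swapn_pred !(swapn_far (i := j)) ?swapn_pred //; lia.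
case: (k =P i) => [->|n2].
  by rewrite swapn_same // !(swapn_far (i := j)) ?swapn_same //; lia.
have -> : swapn i k = k by rewrite /swapn; repeat (case: eqP => ?); lia.
case: (k =P j.-1) => [->|n3]; first by rewrite swapn_pred swapn_far //; lia.
case: (k =P j) => [->|n4]; first by rewrite swapn_same // swapn_far //; lia.
have -> : swapn j k = k by rewrite /swapn; repeat (case: eqP => ?); lia.
by rewrite /swapn; repeat (case: eqP => ?); lia.
Qed.

Lemma swapn_mono i a b : (0 < i)%N -> (a < b)%N ->
  ~~ ((a == i.-1) && (b == i)) -> (swapn i a < swapn i b)%N.
Proof. by rewrite /swapn; repeat (case: eqP => ?); lia. Qed.

Section TwoTermModule.
Variables (K : fieldType) (q : K) (n : nat).
Variables (X : finType) (x0 : X) (L : Type).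
Variables (lab : X -> nat -> L) (s : nat -> X -> X) (a b : L -> L -> K).

Hypothesis lab_inj : forall x y, (forall j, (j < n)%N -> lab x j = lab y j) -> x = y.

Let aa i x := a (lab x i.-1) (lab x i).
Let bb i x := b (lab x i.-1) (lab x i).

Hypothesis lab_s : forall i x, (0 < i < n)%N -> bb i x != 0 ->
  forall j, (j < n)%N -> lab (s i x) j = lab x (swapn i j).

(** A point of [X] is a sequence of labels. The coefficients of the operator depend
    on the two labels in positions i - 1 and i only, so that the relations of
    type A amount to identities in two or three labels. The map [s i] has to
    exchange these labels only where the coefficient [b] does not vanish:
    exchanging adjacent entries of a row does not give a standard tableau. *)
Definition swap_op (i : nat) := two_term x0 (aa i) (bb i) (s i).

Lemma swap_opE i g x : mxfun (swap_op i) g x = aa i x * g x + bb i x * g (s i x).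
Proof. exact: mxfun_two_term. Qed.

Lemma swapn_lt i j : (0 < i < n)%N -> (j < n)%N -> (swapn i j < n)%N.
Proof. by rewrite /swapn; repeat (case: eqP => ?); lia. Qed.

(** The labels of [s i x] are known only where [bb i x] is nonzero; keeping this
    factor in front covers both cases. *)
Lemma swap_step i j x g (F : K) : (0 < i < n)%N -> (0 < j < n)%N ->
  F * bb i x * mxfun (swap_op j) g (s i x) =
  F * bb i x * (a (lab x (swapn i j.-1)) (lab x (swapn i j)) * g (s i x)
     + b (lab x (swapn i j.-1)) (lab x (swapn i j)) * g (s j (s i x))).
Proof.
move=> hi hj; case: (eqVneq (bb i x) 0) => [->|nz]; first by rewrite mulr0 !mul0r.
by rewrite swap_opE /aa /bb !(lab_s hi nz) //; lia.
Qed.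

Lemma swap_step2 i j k x g (F : K) :
    (0 < i < n)%N -> (0 < j < n)%N -> (0 < k < n)%N ->
  F * bb i x * b (lab x (swapn i j.-1)) (lab x (swapn i j))
    * mxfun (swap_op k) g (s j (s i x)) =
  F * bb i x * b (lab x (swapn i j.-1)) (lab x (swapn i j))
    * (a (lab x (swapn i (swapn j k.-1))) (lab x (swapn i (swapn j k)))
          * g (s j (s i x))
     + b (lab x (swapn i (swapn j k.-1))) (lab x (swapn i (swapn j k)))
          * g (s k (s j (s i x)))).
Proof.
move=> hi hj hk; case: (eqVneq (bb i x) 0) => [->|nz]; first by rewrite mulr0 !mul0r.
have jl : (j.-1 < n)%N by lia. have jl' : (j < n)%N by lia.
have kl : (k.-1 < n)%N by lia. have kl' : (k < n)%N by lia.
rewrite -(lab_s hi nz jl) -(lab_s hi nz jl') -[b _ _]/(bb j (s i x)).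
rewrite (swap_step _ _ (F * bb i x) hj hk).
by rewrite !(lab_s hi nz) ?swapn_lt.
Qed.

Lemma swap_back i x g (F : K) : (0 < i < n)%N ->
  F * bb i x * (b (lab x i) (lab x i.-1) * g (s i (s i x))) =
  F * bb i x * (b (lab x i) (lab x i.-1) * g x).
Proof.
move=> hi; case: (eqVneq (bb i x) 0) => [->|nz]; first by rewrite mulr0 !mul0r.
case: (eqVneq (b (lab x i) (lab x i.-1)) 0) => [->|nz']; first by rewrite !mul0r.
congr (_ * (_ * g _)); apply: lab_inj => j hj.
have lsi k : (k < n)%N -> lab (s i x) k = lab x (swapn i k).
  by move=> hk; rewrite (lab_s hi nz).
have nz2 : bb i (s i x) != 0.
  rewrite /bb !lsi /swapn; try lia.
  by rewrite eqxx (_ : (i == i.-1) = false) ?eqxx //; lia.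
rewrite (lab_s hi nz2) // lsi ?swapn_lt //; by rewrite swapnK; case/andP: hi.
Qed.

Hypothesis quad : forall i x, (0 < i < n)%N ->
  let A := lab x i.-1 in let B := lab x i in
  a A B ^+ 2 + b A B * b B A = (q - 1) * a A B + q /\
  b A B * (a A B + a B A - (q - 1)) = 0.

Lemma swap_op_quadratic i : (0 < i < n)%N ->
  (swap_op i - q%:A) * (swap_op i + 1) = 0.
Proof.
move=> hi; apply: (@mxfun_inj _ _ x0) => g x.
rewrite mxfun0 (mxfunM x0) mxfunB (mxfunA x0) swap_opE !mxfunD !(mxfun1 x0).
have := swap_step x g 1 hi hi; rewrite !mul1r => st.
rewrite (mulrDr (bb i x)) st !swap_opE.
have -> : swapn i i.-1 = i by rewrite /swapn eqxx.
have -> : swapn i i = i.-1.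
  by rewrite /swapn eqxx (_ : (i == i.-1) = false) //; lia.
have := swap_back x g 1 hi; rewrite !mul1r => bk.
rewrite (mulrDr (bb i x) (_ * _) (_ * _)) bk /aa /bb.
have [/= Q1 Q2] := quad x hi.
move: (a (lab x i.-1) (lab x i)) (a (lab x i) (lab x i.-1))
  (b (lab x i.-1) (lab x i)) (b (lab x i) (lab x i.-1)) (g x) (g (s i x)) Q1 Q2.
move=> u u' v v' y z Q1 Q2.
transitivity ((u ^+ 2 + v * v' - ((q - 1) * u + q)) * y
   + v * (u + u' - (q - 1)) * z); first by ring.
by rewrite Q1 Q2 subrr !mul0r addr0.
Qed.

Lemma swap_op_comm i j : (0 < i)%N -> (i.+1 < j < n)%N ->
  swap_op i * swap_op j = swap_op j * swap_op i.
Proof.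
move=> i0 ij; apply: (@mxfun_inj _ _ x0) => g x; rewrite !(mxfunM x0).
have hi : (0 < i < n)%N by lia. have hj : (0 < j < n)%N by lia.
rewrite (swap_opE i (mxfun _ _)) (swap_opE j (mxfun _ _)).
have := swap_step x g 1 hi hj; rewrite mul1r => ->.
have := swap_step x g 1 hj hi; rewrite mul1r => ->.
rewrite !swap_opE.
have [-> -> -> ->] : [/\ swapn i j.-1 = j.-1, swapn i j = j, swapn j i.-1 = i.-1
    & swapn j i = i] by split; apply: swapn_far; lia.
rewrite -/(aa j x) -/(bb j x) -/(aa i x) -/(bb i x).
suff E : bb i x * (bb j x * g (s j (s i x))) = bb j x * (bb i x * g (s i (s j x))).
  by rewrite !mulrDr E; ring.
case: (eqVneq (bb i x) 0) => [->|nz]; first by ring.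
case: (eqVneq (bb j x) 0) => [->|nz']; first by ring.
suff -> : s j (s i x) = s i (s j x) by ring.
apply: lab_inj => k hk.
have nz2 : bb j (s i x) != 0.
  by rewrite /bb !(lab_s hi nz) ?swapn_far //; lia.
have nz3 : bb i (s j x) != 0.
  by rewrite /bb !(lab_s hj nz') ?swapn_far //; lia.
rewrite (lab_s hj nz2) // (lab_s hi nz) ?swapn_lt //.
rewrite (lab_s hi nz3) // (lab_s hj nz') ?swapn_lt //; congr lab.
by rewrite swapnC; lia.
Qed.

(* The three identities compare the coefficients of g (s i x), g (s i.+1 x) and
   g x in the two braid words. Those of the longer products of swaps agree
   without any condition. *)
Hypothesis braid : forall i x, (0 < i)%N -> (i.+1 < n)%N ->
  let A := lab x i.-1 in let B := lab x i in let C := lab x i.+1 in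
  [/\ b A B * (a A B * a B C + a A C * a B A - a B C * a A C) = 0,
      b B C * (a A B * a B C + a A C * a C B - a A B * a A C) = 0 &
      a A B ^+ 2 * a B C + b A B * b B A * a A C
      = a B C ^+ 2 * a A B + b B C * b C B * a A C].

(** Both braid words are instances, with u and v exchanged. *)
Lemma swap_op_word3 u v g x : (0 < u < n)%N -> (0 < v < n)%N ->
  mxfun (swap_op u) (mxfun (swap_op v) (mxfun (swap_op u) g)) x =
  aa u x * (aa v x * (aa u x * g x + bb u x * g (s u x)))
  + aa u x * bb v x *
    (a (lab x (swapn v u.-1)) (lab x (swapn v u)) * g (s v x)
     + b (lab x (swapn v u.-1)) (lab x (swapn v u)) * g (s u (s v x)))
  + a (lab x (swapn u v.-1)) (lab x (swapn u v)) * bb u x *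
    (a (lab x (swapn u u.-1)) (lab x (swapn u u)) * g (s u x)
     + b (lab x (swapn u u.-1)) (lab x (swapn u u)) * g (s u (s u x)))
  + bb u x * b (lab x (swapn u v.-1)) (lab x (swapn u v)) *
    (a (lab x (swapn u (swapn v u.-1))) (lab x (swapn u (swapn v u)))
       * g (s v (s u x))
     + b (lab x (swapn u (swapn v u.-1))) (lab x (swapn u (swapn v u)))
       * g (s u (s v (s u x)))).
Proof.
move=> hu hv; rewrite (swap_opE u (mxfun _ _)).
have := swap_step x (mxfun (swap_op u) g) 1 hu hv; rewrite !mul1r => ->.
rewrite (swap_opE v (mxfun _ _)) (swap_opE u g x).
have st2 := swap_step x g (aa u x) hv hu.
have st1 := swap_step x g (a (lab x (swapn u v.-1)) (lab x (swapn u v))) hu hu.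
have := swap_step2 x g 1 hu hv hu; rewrite !mul1r => st3.
by rewrite -st1 -st2 -st3; ring.
Qed.

Lemma swap_op_braid i : (0 < i)%N -> (i.+1 < n)%N ->
  swap_op i * swap_op i.+1 * swap_op i = swap_op i.+1 * swap_op i * swap_op i.+1.
Proof.
move=> i0 hi1; apply: (@mxfun_inj _ _ x0) => g x; rewrite !(mxfunM x0).
have hi : (0 < i < n)%N by lia. have hj : (0 < i.+1 < n)%N by lia.
set j := i.+1 in hi1 hj *; have jE : j = i.+1 by [].
have sip : swapn i i.-1 = i := swapn_pred i.
have sii : swapn i i = i.-1 := swapn_same i0.
have sij : swapn i j = j by apply: swapn_far; lia.
have sjp : swapn j i.-1 = i.-1 by apply: swapn_far; lia.
have sji : swapn j i = j := swapn_pred j.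
have sjj : swapn j j = i := @swapn_same j isT.
rewrite !swap_op_word3 // !(sip, sii, sij, sji, sjj, sjp).

pose A := lab x i.-1; pose B := lab x i; pose C := lab x j.
rewrite -/A -/B -/C /aa /bb -/A -/B -/C.
have bki : a A C * b A B * (b B A * g (s i (s i x))) = a A C * b A B * (b B A * g x).
  exact: (swap_back x g (a A C) hi).
have bkj : a A C * b B C * (b C B * g (s j (s j x))) = a A C * b B C * (b C B * g x).
  exact: (swap_back x g (a A C) hj).
have tri : b A B * b A C * (b B C * g (s i (s j (s i x))))
    = b B C * b A C * (b A B * g (s j (s i (s j x)))).
  case: (eqVneq (b A B) 0) => [->|nAB]; first by ring.
  case: (eqVneq (b A C) 0) => [->|nAC]; first by ring.
  case: (eqVneq (b B C) 0) => [->|nBC]; first by ring.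
  suff -> : s i (s j (s i x)) = s j (s i (s j x)) by ring.
  have L1 := lab_s hi nAB; have L2 := lab_s (i := j) hj nBC.
  have in1 : (i.-1 < n)%N by lia. have in2 : (i < n)%N by lia.
  have nij : bb j (s i x) != 0 by rewrite /bb !L1 // sii sij.
  have nji : bb i (s j x) != 0 by rewrite /bb !L2 // sjp sji.
  have L12 := lab_s hj nij; have L21 := lab_s hi nji.
  have niji : bb i (s j (s i x)) != 0.
    by rewrite /bb !L12 // sjp sji !L1 // sip sij.
  have njij : bb j (s i (s j x)) != 0.
    by rewrite /bb !L21 // sii sij !L2 // sjp sjj.
  apply: lab_inj => k hk.
  rewrite (lab_s hi niji) // L12 ?swapn_lt // L1 ?swapn_lt //.
  rewrite (lab_s hj njij) // L21 ?swapn_lt // L2 ?swapn_lt //.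
  congr lab; case: (k =P i.-1) => [->|n1]; first by rewrite sip sji sij sjp sip.
  case: (k =P i) => [->|n2]; first by rewrite sii sjp sip sji sij sjj.
  case: (k =P j) => [->|n3]; first by rewrite sij sjj sii sjp.
  have [e1 e2] : swapn i k = k /\ swapn j k = k.
    move/eqP/negPf: n1; move/eqP/negPf: n2; move/eqP/negPf: n3.
    by rewrite /swapn -[j.-1]/i => -> -> ->.
  by rewrite !(e1, e2).
have [] := braid x i0 hi1; rewrite -/A -/B -[i.+1]/j -/C => B1 B2 B3.
rewrite !(mulrDr (a A C * _)) bki bkj !(mulrDr (_ * b A C)) tri.
apply/eqP; rewrite -subr_eq0; apply/eqP.
transitivity (g (s i x) * (b A B * (a A B * a B C + a A C * a B A - a B C * a A C))
  - g (s j x) * (b B C * (a A B * a B C + a A C * a C B - a A B * a A C))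
  + g x * ((a A B ^+ 2 * a B C + b A B * b B A * a A C)
     - (a B C ^+ 2 * a A B + b B C * b C B * a A C))); first by ring.
by rewrite B1 B2 B3 subrr !mulr0 subr0 addr0.
Qed.

End TwoTermModule.

(** * Lengths and reduced words *)

Lemma card_ord_lt n m : (m <= n)%N -> #|[set j : 'I_n | (j < m)%N]| = m.
Proof. by move=> mn; rewrite -sum1dep_card (big_ord_narrow mn) sum1_card card_ord. Qed.

Section Length.
Variable n : nat.
Implicit Types (w x y : 'S_n) (i : 'I_n).

Lemma val_sref i (k : 'I_n) : (0 < i)%N -> sref i k = swapn i k :> nat.
Proof.
move=> i0; rewrite /sref /swapn.
have vp : insubd i i.-1 = i.-1 :> nat.
  by rewrite val_insubd (leq_ltn_trans (leq_pred i)).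
case: tpermP => [->|->|n1 n2]; first by rewrite vp eqxx.
  by rewrite eqxx vp; case: eqP => //; lia.
move/eqP/negPf: n1; move/eqP/negPf: n2; rewrite -!val_eqE /= vp => -> ->.
by [].
Qed.

Lemma sref0 i : (i : nat) = 0%N -> sref i = 1%g.
Proof.
move=> i0; rewrite /sref (_ : insubd i i.-1 = i) ?tperm1 //.
by apply/val_inj; rewrite val_insubd i0 /= -i0 ltn_ord.
Qed.

Lemma srefK i : (sref i * sref i = 1)%g.
Proof. by rewrite /sref tperm2. Qed.

Lemma sref_inv i : (sref i)^-1%g = sref i.
Proof. by rewrite /sref tpermV. Qed.

(** Composing with [sref i] carries the inversions of [w] to inversions, and adds
    the pair (j, i). *)
Lemma len_srefL i w (j : 'I_n) : i = j.+1 :> nat -> (w j < w i)%N ->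
  len (sref i * w)%g = (len w).+1.
Proof.
move=> ij wji; have i0 : (0 < i)%N by rewrite ij.
pose f (ab : 'I_n * 'I_n) := (sref i ab.1, sref i ab.2).
have f_inj : injective f.
  by move=> [a b] [a' b'] [/perm_inj-> /perm_inj->].
have si : sref i i = j.
  by apply/val_inj; rewrite /= val_sref // swapn_same // ij.
have sj : sref i j = i.
  by apply/val_inj; rewrite /= val_sref // (_ : (j : nat) = i.-1) ?swapn_pred // ij.
rewrite /len -[in RHS](card_preimset _ f_inj).
set A := [set _ | _]; set B := _ @^-1: _.
have -> : A = (j, i) |: B.
  apply/setP=> -[a b]; rewrite !inE /= !permM xpair_eqE.
  have lts : (w (sref i b) < w (sref i a))%N -> ~~ ((a == j) && (b == i)) ->
      (a < b)%N = (sref i a < sref i b)%N.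
    move=> inv; rewrite -!val_eqE => ne.
    have nba : ~~ ((a == i) && (b == j)).
      apply/negP=> /andP[/eqP ai /eqP bj]; move: inv.
      by rewrite ai bj si sj ltnNge ltnW.
    move: ne nba; rewrite -!val_eqE /= !val_sref // /swapn.
    by repeat (case: eqP => ?); lia.
  case: (boolP ((a == j) && (b == i))) => [/andP[/eqP-> /eqP->]|nab] /=.
    by rewrite si sj wji ij ltnSn.
  by case: (boolP (w _ < w _)%N) => inv; rewrite ?andbF ?andbT // lts.
by rewrite cardsU1 !inE /= si sj -ltnS ij ltnNge leqW.
Qed.

Lemma lenV w : len w^-1%g = len w.
Proof.
pose g (ab : 'I_n * 'I_n) := (w ab.2, w ab.1).
have g_inj : injective g.
  by move=> [a b] [a' b'] [/perm_inj-> /perm_inj->].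
rewrite /len -[LHS](card_preimset _ g_inj); apply: eq_card => -[a b].
by rewrite !inE /= !permK andbC.
Qed.

Lemma len_srefR i w (j : 'I_n) : i = j.+1 :> nat ->
  (w^-1%g j < w^-1%g i)%N -> len (w * sref i)%g = (len w).+1.
Proof.
move=> ij lt; rewrite -lenV invMg sref_inv (len_srefL ij lt) lenV //.
Qed.

Lemma len1 : len (1 : 'S_n)%g = 0%N.
Proof.
apply/eqP; rewrite cards_eq0; apply/eqP/setP=> -[a b]; rewrite !inE !perm1 /=.
by case: ltngtP.
Qed.

Lemma pred_ordP i : (0 < i)%N -> {j : 'I_n | i = j.+1 :> nat}.
Proof.
move=> i0; have lt : (i.-1 < n)%N by rewrite (leq_ltn_trans (leq_pred i)).
by exists (Ordinal lt); rewrite /= prednK.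
Qed.

Lemma len_srefR_desc i w (j : 'I_n) : i = j.+1 :> nat ->
  (w^-1%g i < w^-1%g j)%N -> len w = (len (w * sref i)%g).+1.
Proof.
move=> ij lt; rewrite -(len_srefR (w := (w * sref i)%g) ij).
  by rewrite -mulgA srefK mulg1.
have i0 : (0 < i)%N by rewrite ij.
have si : sref i i = j.
  by apply/val_inj; rewrite /= val_sref // swapn_same // ij.
have sj : sref i j = i.
  by apply/val_inj; rewrite /= val_sref // (_ : (j : nat) = i.-1) ?swapn_pred // ij.
by rewrite invMg sref_inv !permM si sj.
Qed.

Lemma len_srefL_desc i w (j : 'I_n) : i = j.+1 :> nat ->
  (w i < w j)%N -> len w = (len (sref i * w)%g).+1.
Proof.
move=> ij lt; rewrite -[LHS]lenV (len_srefR_desc ij) ?invgK //.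
by rewrite -lenV invMg invgK sref_inv.
Qed.

Lemma len_srefR_le i w : (len (w * sref i)%g <= (len w).+1)%N.
Proof.
have [i0|] := posnP i; first by rewrite sref0 // mulg1.
case/pred_ordP=> j ij.
case: (ltngtP (w^-1%g i) (w^-1%g j)) => [lt|lt|eq].
- by rewrite (len_srefR_desc ij lt) leqW.
- by rewrite (len_srefR ij lt).
- have /perm_inj eq' := val_inj eq.
  by move/eqP: ij; rewrite eq' -[X in X == _]addn0 -addn1 eqn_add2l.
Qed.

Lemma perm_mono_id w : (forall i j : 'I_n, (i < j)%N -> (w i < w j)%N) -> w = 1%g.
Proof.
move=> mono; apply/permP=> k; rewrite perm1; apply/val_inj => /=.
rewrite -[LHS](card_ord_lt (ltnW (ltn_ord _))) -(card_preimset _ (@perm_inj _ w)).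
rewrite -[RHS](card_ord_lt (ltnW (ltn_ord _))); apply: eq_card => j.
rewrite !inE; case: (ltngtP j k) => [/mono->|/mono lt|/val_inj->] //.
  by rewrite ltnNge ltnW.
by rewrite ltnn.
Qed.

Lemma perm_step_mono w (a b : nat) : (forall i j : 'I_n, i = j.+1 :> nat ->
    (a <= j)%N -> (i < b)%N -> (w j < w i)%N) ->
  forall i j : 'I_n, (a <= i)%N -> (i < j)%N -> (j < b)%N -> (w i < w j)%N.
Proof.
move=> step i j ai ij jb; have [m jE] : exists m, (j = i + m.+1 :> nat)%N.
  by exists (j - i).-1; lia.
elim: m j jE {ij} jb => [|m IHm] j jE jb.
  by apply: step => //; rewrite jE addn1.
have [k jk] : {k : 'I_n | j = k.+1 :> nat} by apply: pred_ordP; rewrite jE addnS.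
have ki : k = (i + m.+1)%N :> nat by move: jE; rewrite jk addnS => -[].
apply: ltn_trans (IHm k ki _) (step j k jk _ jb).
  by rewrite (leq_trans _ jb) // jk leqW.
by rewrite ki (leq_trans ai) ?leq_addr.
Qed.

Lemma perm_descent w : w != 1%g ->
  exists i j : 'I_n, i = j.+1 :> nat /\ (w i < w j)%N.
Proof.
move=> w1; apply/not_all_not_ex => nex; case/eqP: w1; apply: perm_mono_id => i j ij.
have := @perm_step_mono w 0 n; apply=> // {}i {}j {}ij _ _.
case: (ltngtP (w j) (w i)) => [//|lt|eq]; first by case: (nex i); exists j.
have /perm_inj eq' := val_inj eq.
by move/eqP: ij; rewrite eq' eqn_leq ltnn andbF.
Qed.

Lemma len_prod_le (s : seq 'I_n) : (len (\prod_(i <- s) sref i)%g <= size s)%N.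
Proof.
elim/last_ind: s => [|s i IHs]; first by rewrite big_nil len1.
rewrite -cats1 big_cat big_seq1 size_cat addn1 (leq_trans (len_srefR_le _ _)) //.
Qed.

Lemma reduced_word w : exists s : seq 'I_n,
  size s = len w /\ (\prod_(i <- s) sref i)%g = w.
Proof.
have [m] := ubnP (len w); elim: m w => // m IHm w lt.
case: (eqVneq w 1%g) => [->|w1].
  by exists [::]; rewrite big_nil len1.
have /perm_descent[i [j [ij lt']]] : w^-1%g != 1%g by rewrite invg_eq1.
have ls := len_srefR_desc ij lt'.
have [|s [ss sw]] := IHm (w * sref i)%g; first by lia.
exists (rcons s i); rewrite size_rcons ss -ls -cats1 big_cat big_seq1 sw.
by rewrite /= -mulgA srefK mulg1.
Qed.

End Length.

(** * The cyclotomic relation *)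

Section CyclotomicRelation.
Variables (p d : nat) (K : fieldType) (eps : K) (Q : d.-tuple K).
Hypothesis heps : p.-primitive_root eps.
Hypothesis hQ : forall c : 'I_d, tnth Q c != 0.

Lemma Qnth_neq0 c : (c < d)%N -> Q`_c != 0.
Proof.
by move=> cd; have := hQ (Ordinal cd); rewrite (tnth_nth 0).
Qed.

Lemma eps_neq0 : eps != 0.
Proof.
apply/eqP=> e0; have := prim_expr_order heps.
rewrite e0 expr0n (negPf (lt0n_neq0 (prim_order_gt0 heps))) => /eqP.
by rewrite eq_sym oner_eq0.
Qed.

Lemma cyc_param_neq0 s : (0 < d)%N -> cyc_param eps Q s != 0.
Proof.
by move=> d0; rewrite mulf_neq0 ?expf_neq0 ?eps_neq0 ?Qnth_neq0 ?ltn_mod.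
Qed.

Lemma prodXp_sub c : c != 0 ->
  'X^p - (c ^+ p)%:P = \prod_(0 <= t < p) ('X - (eps ^+ t.+1 * c)%:P) :> {poly K}.
Proof.
move=> c0; have p0 := prim_order_gt0 heps.
pose rs := [seq eps ^+ t.+1 * c | t <- iota 0 p].
have urs : uniq_roots rs.
  rewrite uniq_rootsE map_inj_in_uniq ?iota_uniq // => t t'.
  rewrite !mem_iota !add0n => /= tp tp' /(mulIf c0).
  rewrite !exprS => /(mulfI eps_neq0) /eqP.
  by rewrite (eq_prim_root_expr heps) !modn_small // => /eqP.
have sz : size ('X^p - (c ^+ p)%:P : {poly K}) = (size rs).+1.
  by rewrite size_XnsubC // size_map size_iota.
have rts : all (root ('X^p - (c ^+ p)%:P)) rs.
  apply/allP=> _ /mapP[t _ ->]; rewrite rootE !hornerE exprMn.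
  by rewrite -exprM mulnC exprM (prim_expr_order heps) expr1n mul1r subrr.
rewrite (all_roots_prod_XsubC sz rts urs) (eqP (monicXnsubC _ p0)) scale1r.
by rewrite big_map /index_iota subn0.
Qed.

Lemma prod_nat_mul (R : comNzRingType) (F : nat -> R) k m :
  \prod_(0 <= s < k * m) F s = \prod_(0 <= t < k) \prod_(0 <= c < m) F (c + t * m)%N.
Proof.
elim: k => [|k IHk]; first by rewrite mul0n !big_geq.
rewrite (big_cat_nat (n := (k * m)%N)) //=; last by rewrite mulSn leq_addl.
rewrite [RHS]big_nat_recr //= -IHk mulSn; congr (_ * _).
by rewrite -{1}[(k * m)%N]add0n big_addn addnK.
Qed.

Lemma prod_cyc_param : (0 < d)%N ->
  \prod_(c < d) ('X^p - (Q`_c ^+ p)%:P) =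
  \prod_(s < p * d) ('X - (cyc_param eps Q s)%:P) :> {poly K}.
Proof.
move=> d0; rewrite -(big_mkord xpredT (fun s => 'X - (cyc_param eps Q s)%:P)).
rewrite prod_nat_mul exchange_big big_mkord; apply: eq_bigr => c _.
rewrite prodXp_sub ?Qnth_neq0 //; apply: eq_bigr => t _.
by rewrite /cyc_param [(c + _)%N]addnC divnMDl // modnMDl divn_small // modn_small // addn0.
Qed.

Variable B : algType K.

(** The cyclotomic relation is a polynomial in T_0: although the algebra is not
    commutative, its factors may be regrouped in [{poly K}]. *)
Lemma cyclotomic_horner (x : B) : (0 < d)%N ->
  \prod_(c < d) (x ^+ p - (Q`_c ^+ p)%:A) =
  horner_alg x (\prod_(s < p * d) ('X - (cyc_param eps Q s)%:P)).
Proof.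
move=> d0; rewrite -prod_cyc_param // rmorph_prod; apply: eq_bigr => c _.
rewrite (rmorphB (horner_alg x)) (rmorphXn (horner_alg x)) /=.
by rewrite horner_algX horner_algC.
Qed.

Lemma horner_alg_XsubC (x : B) (c : K) : horner_alg x ('X - c%:P) = x - c%:A.
Proof.
by rewrite (rmorphB (horner_alg x)) /= horner_algX horner_algC.
Qed.

Lemma cyclotomic_prodE (x : B) : (0 < d)%N ->
  \prod_(c < d) (x ^+ p - (Q`_c ^+ p)%:A) =
  \prod_(s < p * d) (x - (cyc_param eps Q s)%:A).
Proof.
move=> d0; rewrite cyclotomic_horner // rmorph_prod.
by apply: eq_bigr => s _; apply: horner_alg_XsubC.
Qed.

Lemma cyclotomic_scalar (s : 'I_(p * d)) (x : B) : (0 < d)%N ->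
  x = (cyc_param eps Q s)%:A ->
  \prod_(c < d) (x ^+ p - (Q`_c ^+ p)%:A) = 0.
Proof.
move=> d0 xE; rewrite cyclotomic_horner // (bigD1 s) //=.
by rewrite (rmorphM (horner_alg x)) /= horner_alg_XsubC xE subrr mul0r.
Qed.

Lemma cyclotomic_pair (s t : 'I_(p * d)) (x : B) : (0 < d)%N -> s != t ->
  (x - (cyc_param eps Q s)%:A) * (x - (cyc_param eps Q t)%:A) = 0 ->
  \prod_(c < d) (x ^+ p - (Q`_c ^+ p)%:A) = 0.
Proof.
move=> d0 st x0; rewrite cyclotomic_horner // (bigD1 s) //= (bigD1 t) 1?eq_sym //=.
rewrite mulrA !(rmorphM (horner_alg x)) /= !horner_alg_XsubC.
by rewrite x0 mul0r.
Qed.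
End CyclotomicRelation.

(** * Modules of words *)

(** The q-analogue of permuting the letters of a word: T_i multiplies by q if the
    letters in positions i - 1 and i agree; otherwise it exchanges them, with the
    correction that makes its eigenvalues q and -1. *)
Definition word_a (K : fieldType) (q : K) (A B : nat) : K :=
  if A == B then q else if (A < B)%N then 0 else q - 1.
Definition word_b (K : fieldType) (q : K) (A B : nat) : K :=
  if A == B then 0 else if (A < B)%N then 1 else q.

Section WordCoefficients.
Variables (K : fieldType) (q : K).
Local Notation a := (word_a q).
Local Notation b := (word_b q).

Lemma word_quad A B : a A B ^+ 2 + b A B * b B A = (q - 1) * a A B + q /\
  b A B * (a A B + a B A - (q - 1)) = 0.
Proof. by rewrite /word_a /word_b; case: (ltngtP A B) => _; split; ring. Qed.

Lemma word_braid A B C :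
  [/\ b A B * (a A B * a B C + a A C * a B A - a B C * a A C) = 0,
      b B C * (a A B * a B C + a A C * a C B - a A B * a A C) = 0 &
      a A B ^+ 2 * a B C + b A B * b B A * a A C
      = a B C ^+ 2 * a A B + b B C * b C B * a A C].
Proof.
rewrite /word_a /word_b.
by case: (ltngtP A B) => AB; case: (ltngtP B C) => BC; case: (ltngtP A C) => AC;
  split; (lia || ring).
Qed.
End WordCoefficients.

Section WordModule.
Variables (K : fieldType) (q : K) (n : nat) (X : finType) (x0 : X).
Variables (lab : X -> nat -> nat) (s : nat -> X -> X).
Hypothesis q0 : q != 0.
Hypothesis lab_inj : forall x y, (forall j, (j < n)%N -> lab x j = lab y j) -> x = y.
Hypothesis lab_s : forall i x, (0 < i < n)%N ->
  forall j, (j < n)%N -> lab (s i x) j = lab x (swapn i j).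

Definition word_op i := swap_op x0 lab s (word_a q) (word_b q) i.

Let lab_s' i x (hi : (0 < i < n)%N)
  (_ : word_b q (lab x i.-1) (lab x i) != 0) := @lab_s i x hi.

Lemma word_op_quadratic i : (0 < i < n)%N ->
  (word_op i - q%:A) * (word_op i + 1) = 0.
Proof.
by move=> hi; apply: (swap_op_quadratic x0 lab_inj lab_s') => // *; apply: word_quad.
Qed.

Lemma word_op_comm i j : (0 < i)%N -> (i.+1 < j < n)%N ->
  word_op i * word_op j = word_op j * word_op i.
Proof. by move=> i0 ij; apply: (@swap_op_comm _ n _ x0 _ lab s _ _ lab_inj lab_s'). Qed.

Lemma word_op_braid i : (0 < i)%N -> (i.+1 < n)%N ->
  word_op i * word_op i.+1 * word_op i = word_op i.+1 * word_op i * word_op i.+1.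
Proof.
by move=> i0 hi; apply: (swap_op_braid x0 lab_inj lab_s') => // *; apply: word_braid.
Qed.

Lemma word_sK i x : (0 < i < n)%N -> s i (s i x) = x.
Proof.
move=> hi; apply: lab_inj => j hj; rewrite lab_s // lab_s ?swapn_lt //.
by rewrite swapnK //; case/andP: hi.
Qed.

Lemma word_lab_s1 i x : (0 < i < n)%N -> lab (s i x) i.-1 = lab x i.
Proof. by move=> hi; rewrite lab_s ?swapn_pred //; lia. Qed.

Lemma word_lab_s2 i x : (0 < i < n)%N -> lab (s i x) i = lab x i.-1.
Proof. by move=> hi; rewrite lab_s ?swapn_same //; lia. Qed.

Lemma word_s_id i x : (0 < i < n)%N -> lab x i.-1 = lab x i -> s i x = x.
Proof.
move=> hi e; apply: lab_inj => j hj; rewrite lab_s // /swapn.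
by case: eqP => [->|_]; [|case: eqP => [->|//]].
Qed.

(** A linear form on which T_i acts by q is symmetric under the i-th exchange.
    This determines the dual eigenforms of the two modules below. *)
Lemma word_functional_sym (f : X -> K) i : (0 < i < n)%N ->
  (forall g, \sum_x f x * mxfun (word_op i) g x = q * \sum_x f x * g x) ->
  forall y, f (s i y) = f y.
Proof.
move=> hi fq y.
have := fq (fun x => (x == y)%:R).
under eq_bigr do rewrite swap_opE mulrDr.
rewrite big_split /= (bigD1 y) //= eqxx mulr1 big1 ?addr0; last first.
  by move=> x /negPf->; rewrite !mulr0.
rewrite (bigD1 (s i y)) //= word_sK // eqxx mulr1 big1 ?addr0; last first.
  move=> x xy; rewrite (_ : (s i x == y) = false) ?mulr0 //.
  by apply/eqP=> e; rewrite -e word_sK ?eqxx in xy.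
rewrite (bigD1 y) //= eqxx mulr1 big1 ?addr0; last first.
  by move=> x /negPf->; rewrite mulr0.
rewrite word_lab_s1 // word_lab_s2 // /word_a /word_b.
case: (ltngtP (lab y i.-1) (lab y i)) => [lt|lt|eq]; last by rewrite word_s_id.
- by rewrite mulr0 add0r mulrC => /(mulfI q0).
- rewrite mulrBr mulr1 => /eqP; rewrite -subr_eq0 => /eqP e.
  by apply/eqP; rewrite -subr_eq0 -e; apply/eqP; ring.
Qed.

End WordModule.

(** * Consequences of semisimplicity for the parameters *)

Section SemisimplicityConditions.
Variables (p d n : nat) (K : fieldType) (eps q : K) (Q : d.-tuple K).
Variables (H : algType K) (T : nat -> H).
Hypothesis hn : (2 <= n)%N.
Hypothesis hd : (1 <= d)%N.
Hypothesis heps : p.-primitive_root eps.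
Hypothesis hQ : forall c : 'I_d, tnth Q c != 0.
Hypothesis q0 : q != 0.
Hypothesis hH : is_hecke_algebra p n q Q T.
Hypothesis hss : semisimple H.

Local Notation par := (cyc_param eps Q).

(** T_0 acts by one of the parameters, and the other generators by q. *)
Lemma index_character (c : 'I_(p * d)) :
  exists chi : {lrmorphism H -> 'M[K]_1}, forall i, (i < n)%N ->
    chi (T i) = (if i == 0%N then par c else q)%:A.
Proof.
have [_ univ] := hH.
have [|chi [chiT _]] := univ 'M[K]_1 (fun i => (if i == 0%N then par c else q)%:A);
  last by exists chi.
have comm (a b : K) : a%:A * b%:A = b%:A * a%:A :> 'M[K]_1.
  by rewrite -!(rmorphM (in_alg 'M[K]_1)) mulrC.
split=> [| |i /andP[i0 _]|i j _|i i0 _].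
- exact: (cyclotomic_scalar heps hQ hd (s := c)).
- by rewrite /= (comm (par c) q) -!mulrA (comm (par c) q).
- by rewrite (negPf (lt0n_neq0 i0)) subrr mul0r.
- exact: comm.
- by rewrite (negPf (lt0n_neq0 i0)).
Qed.

Lemma dual_functional (X : finType) (x0 : X) (c : 'I_(p * d))
    (phi : {lrmorphism H -> 'M[K]_(#|X|.-1.+1)}) (F : X -> K) :
  let ev i := if i == 0%N then par c else q in
  (forall i x, (i < n)%N -> mxfun (phi (T i)) F x = ev i * F x) ->
  (exists x, F x != 0) ->
  exists f : X -> K, \sum_x f x * F x != 0 /\
    forall i g, (i < n)%N ->
      \sum_x f x * mxfun (phi (T i)) g x = ev i * \sum_x f x * g x.
Proof.
move=> ev eigF [x Fx].
have [chi chiT] := index_character c.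
pose colf (g : X -> K) : 'cV[K]_(#|X|.-1.+1) := \col_i g (elt_of x0 i).
have mul_colf M g : M *m colf g = colf (mxfun M g).
  apply/colP=> i; rewrite !mxE /mxfun (idx_ofK x0) (big_idx_of x0).
  by apply: eq_bigr => y _; rewrite mxE elt_ofK.
have row_colf (f : 'rV_(#|X|.-1.+1)) g :
    (f *m colf g) 0 0 = \sum_x f 0 (idx_of x) * g x.
  rewrite mxE (big_idx_of x0).
  by apply: eq_bigr => y _; rewrite mxE elt_ofK.
have [||f [f0 fH]] := dual_eigenvector hH hss (phi := phi) (chi := chi) (v := colf F).
- move=> i ni; rewrite mul_colf chiT // -/(ev i).
  apply/colP=> k; rewrite !mxE big_ord1 !mxE eqxx mulr1n.
  by rewrite eigF // -/(ev i) mulr1 mulrC.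
- apply/cV0Pn; exists (idx_of x); rewrite mxE elt_ofK //.
exists (fun y => f 0 (idx_of y)); split=> [|i g ni].
  apply: contra_neq f0 => f0; apply/matrixP=> i j.
  by rewrite !ord1 row_colf f0 mxE.
rewrite -!row_colf -mul_colf mulmxA fH chiT //.
rewrite -scalemxAl !mxE -/(ev i) eqxx mulr1 //.
Qed.

(** The module consists of the words without repetition, T_0 acting by a scalar.
    The eigenvector w -> q^(len w) pairs with the constant eigenform to the
    Poincare polynomial. *)
Lemma poincare_neq0 : \sum_(w : 'S_n) q ^+ len w != 0.
Proof.
have n0 : (0 < n)%N by apply: ltn_trans hn.
have p0 := prim_order_gt0 heps.
pose o := Ordinal n0.
have pd0 : (0 < p * d)%N by rewrite muln_gt0 p0.
pose c0 := Ordinal pd0.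
pose lab (w : 'S_n) (j : nat) : nat := w (insubd o j).
pose s (i : nat) (w : 'S_n) := (sref (insubd o i) * w)%g.
have vo j : (j < n)%N -> insubd o j = j :> nat.
  by move=> jn; rewrite val_insubd jn.
have lab_inj x y : (forall j, (j < n)%N -> lab x j = lab y j) -> x = y.
  move=> e; apply/permP=> k; apply/val_inj; move: (e k (ltn_ord k)).
  by rewrite /lab valKd.
have lab_s i x : (0 < i < n)%N -> forall j, (j < n)%N ->
    lab (s i x) j = lab x (swapn i j).
  case/andP=> i0 ni j nj; rewrite /lab /s permM; congr (nat_of_ord (x _)).
  by apply/val_inj; rewrite /= val_sref !vo // swapn_lt ?i0.
pose T' i := if i is i'.+1 then word_op q (1%g : 'S_n) lab s i else (par c0)%:A.
have [_ univ] := hH.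
have [|phi [phiT _]] := univ _ T'.
  have comm i : T' 0%N * T' i = T' i * T' 0%N.
    by rewrite /= -scalerAl -scalerAr mul1r mulr1.
  split=> [| |[//|i] hi|[|i] [//|j] ij|[//|i] i0 hi].
  - exact: (cyclotomic_scalar heps hQ hd (s := c0)).
  - by rewrite comm -!mulrA comm.
  - exact: (word_op_quadratic q _ lab_inj lab_s).
  - exact: comm.
  - exact: (word_op_comm q _ lab_inj lab_s).
  - exact: (word_op_braid q _ lab_inj lab_s).
have lenS i w (j : 'I_n) : i = j.+1 :> nat -> (i < n)%N ->
    (lab w j < lab w i)%N -> len (s i w) = (len w).+1.
  move=> ij ni; rewrite /lab /s; rewrite valKd => lt.
  by rewrite (len_srefL (j := j)) ?vo.
have [||f [fF fT]] := @dual_functional _ (1%g : 'S_n) c0 phi (fun w => q ^+ len w).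
- move=> [|i] w ni; rewrite phiT //= ?mxfunA // swap_opE.
  pose j := insubd o i.
  have ji : j = i :> nat by rewrite vo // ltnW.
  have ij : i.+1 = j.+1 by rewrite ji.
  have hi : (0 < i.+1 < n)%N by [].
  rewrite /word_a /word_b; case: ltngtP => [lt|lt|eq].
  + rewrite mul0r add0r mul1r (lenS i.+1 w j) ?exprS // ji //.
  + have := lenS i.+1 (s i.+1 w) j ij ni.
    rewrite (word_sK lab_inj lab_s) // (lab_s _ _ hi) // (lab_s _ _ hi) ?ji; last by lia.
    rewrite swapn_same // (_ : swapn i.+1 i = i.+1) ?(swapn_pred i.+1) // => -> //.
    by rewrite exprS; ring.
  + rewrite mul0r addr0 //.
- by exists 1%g; rewrite len1 oner_neq0.
have fconst w : f w = f 1%g.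
  have [sq [_ <-]] := reduced_word w.
  elim: sq => [|i sq IH]; first by rewrite big_nil.
  rewrite big_cons; have [i0|i0] := posnP i; first by rewrite sref0 // mul1g.
  have hi : (0 < i < n)%N by rewrite i0 ltn_ord.
  have fq g : \sum_x f x * mxfun (word_op q (1%g : 'S_n) lab s i) g x
      = q * \sum_x f x * g x.
    have := fT i g (ltn_ord i); rewrite phiT //.
    by case: (nat_of_ord i) i0.
  have := word_functional_sym q0 lab_inj lab_s hi fq (\prod_(j <- sq) sref j)%g.
  by rewrite /s valKd IH.
apply: contra_neq fF => P0.
under eq_bigr do rewrite fconst.
by rewrite -big_distrr /= P0 mulr0.
Qed.

(** On the words in two letters, let T_0 act on the first letter by a matrix with
    eigenvalues A and B. The eigenvector gives weight A q^k to one of the letters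
    in position k and weight 1 to the other one; the eigenform gives them weights
    1 and - B. Their pairing is the product of the A q^k - B over all
    positions k. *)
Lemma parameters_separated (c c' : 'I_(p * d)) (j : nat) :
  c != c' -> (j < n)%N -> par c * q ^+ j != par c'.
Proof.
move=> cc' jn.
have n0 : (0 < n)%N by apply: ltn_trans hn.
pose o := Ordinal n0; pose X := {ffun 'I_n -> bool}.
pose A := par c; pose B := par c'; rewrite -/A -/B.
have A0 : A != 0 by exact: (cyc_param_neq0 heps hQ).
pose x0 : X := [ffun=> false].
pose lab (x : X) (j : nat) : nat := x (insubd o j).
pose s (i : nat) (x : X) : X := [ffun k => x (sref (insubd o i) k)].
pose flip (k : 'I_n) (x : X) : X := [ffun l => if l == k then ~~ x l else x l].
have vo k : (k < n)%N -> insubd o k = k :> nat.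
  by move=> kn; rewrite val_insubd kn.
have lab_inj x y : (forall k, (k < n)%N -> lab x k = lab y k) -> x = y.
  move=> e; apply/ffunP=> k; move: (e k (ltn_ord k)).
  by rewrite /lab valKd; case: (x k); case: (y k).
have lab_s i x : (0 < i < n)%N -> forall k, (k < n)%N ->
    lab (s i x) k = lab x (swapn i k).
  case/andP=> i0 ni k nk; rewrite /lab /s ffunE; congr (nat_of_bool (x _)).
  by apply/val_inj; rewrite /= val_sref !vo // swapn_lt ?i0.
pose T0 := two_term x0 (fun x => if x o then 0 else A + B)
  (fun x => if x o then 1 else - (A * B)) (flip o).
have T0E g x : mxfun T0 g x =
    if x o then g (flip o x) else (A + B) * g x - A * B * g (flip o x).
  rewrite mxfun_two_term; case: (x o); first by rewrite mul0r mul1r add0r.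
  by rewrite mulNr.
have flipo x : flip o x o = ~~ x o by rewrite ffunE eqxx.
have flipK k : involutive (flip k).
  by move=> x; apply/ffunP=> l; rewrite !ffunE; case: eqP => // _; rewrite negbK.
pose T' i := if i is i'.+1 then word_op q x0 lab s i else T0.
pose o1 := Ordinal hn.
have io0 : insubd o 0%N = o by apply/val_inj; rewrite /= vo.
have io1 : insubd o 1%N = o1 by apply/val_inj; rewrite /= vo.
pose X2 (x : X) (u v : bool) : X :=
  [ffun k => if k == o then u else if k == o1 then v else x k].
have X2E x : X2 x (x o) (x o1) = x.
  apply/ffunP=> k; rewrite ffunE; case: (k =P o) => [->|_] //.
  by case: (k =P o1) => [->|].
have T02 g x u v : mxfun T0 g (X2 x u v) = if u then g (X2 x false v) else
    (A + B) * g (X2 x false v) - A * B * g (X2 x true v).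
  have fl : flip o (X2 x u v) = X2 x (~~ u) v.
    by apply/ffunP=> k; rewrite !ffunE; case: eqP.
  by rewrite T0E fl ffunE eqxx; case: u {fl}.
have T12 g x u v : mxfun (word_op q x0 lab s 1) g (X2 x u v) =
    if u == v then q * g (X2 x u v) else
    if u then (q - 1) * g (X2 x u v) + q * g (X2 x v u) else g (X2 x v u).
  rewrite swap_opE.
  have -> : lab (X2 x u v) 1.-1 = u by rewrite /lab io0 ffunE eqxx.
  have -> : lab (X2 x u v) 1 = v by rewrite /lab io1 ffunE.
  have -> : s 1%N (X2 x u v) = X2 x v u.
    have so : sref o1 o = o1 by apply/val_inj; rewrite /= val_sref.
    have so1 : sref o1 o1 = o by apply/val_inj; rewrite /= val_sref.
    apply/ffunP=> k; rewrite /s io1 !ffunE.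
    case: (k =P o) => [->|ko]; first by rewrite so.
    case: (k =P o1) => [->|ko1]; first by rewrite so1.
    have -> : sref o1 k = k.
      apply/val_inj; rewrite /= val_sref // swapn_far //.
      by move/eqP: ko; move/eqP: ko1; rewrite -!val_eqE /=; lia.
    by move/eqP/negPf: ko => ->; move/eqP/negPf: ko1 => ->.
  by rewrite /word_a /word_b; case: u; case: v => /=; ring.
have [_ univ] := hH.
have [|phi [phiT _]] := univ _ T'.
  split=> [| |[//|i] hi|[|i] [//|k] ij|[//|i] i0 hi].
  - apply: (cyclotomic_pair heps hQ hd cc'); apply: (@mxfun_inj _ _ x0) => g x.
    rewrite (mxfunM x0) !mxfunB !(mxfunA x0) !T0E !mxfunB !(mxfunA x0) !T0E.
    rewrite mxfun0 flipK flipo -/A -/B.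
    by case: (x o) => /=; ring.
  - apply: (@mxfun_inj _ _ x0) => g x; rewrite -(X2E x); move: (x o) (x o1) => u v.
    rewrite !(mxfunM x0) /T'.
    by case: u; case: v; do 4!rewrite ?(T02, T12) /=; ring.
  - exact: (word_op_quadratic q _ lab_inj lab_s).
  - apply: (@mxfun_inj _ _ x0) => g x; rewrite !(mxfunM x0) /T'.
    have hk : (0 < k.+1 < n)%N by case/andP: ij.
    rewrite T0E !swap_opE !T0E.
    have rE : insubd o k.+1 = k.+1 :> nat by rewrite vo //; case/andP: hk.
    have sf : s k.+1 (flip o x) = flip o (s k.+1 x).
      apply/ffunP=> l; rewrite !ffunE; congr (if _ then _ else _).
      rewrite -!val_eqE /= val_sref rE //.
      rewrite /swapn; case: (nat_of_ord l =P k.+1.-1) => [->|nl1]; first by lia.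
      by case: (nat_of_ord l =P k.+1) => [->|nl2] //; lia.
    have so : s k.+1 x o = x o.
      rewrite !ffunE; congr (x _); apply/val_inj; rewrite /= val_sref rE //.
      by case/andP: ij => k1 _; rewrite swapn_far //= k1.
    have lf l : (0 < l < n)%N -> lab (flip o x) l = lab x l.
      by move=> hl; rewrite /lab ffunE -val_eqE /= vo; [case: eqP; lia|lia].
    rewrite !lf; [|lia..]; rewrite sf so.
    by case: (x o); ring.
  - exact: (word_op_comm q _ lab_inj lab_s).
  - exact: (word_op_braid q _ lab_inj lab_s).
(* The letter true has weight 1 in the eigenvector F and - B in the eigenform,
   which will be shown to be a multiple of G. *)
pose F (x : X) : K := \prod_k (if x k then 1 else A * q ^+ k).
pose G (x : X) : K := \prod_k (if x k then - B else 1).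
have Fflip (x : X) k : x k -> F (flip k x) = A * q ^+ k * F x.
  move=> xk; rewrite /F (bigD1 k) //= [in RHS](bigD1 k) //= ffunE eqxx xk /= mul1r.
  by congr (_ * _); apply: eq_bigr => l lk; rewrite ffunE (negPf lk).
have s_flip i (k l : 'I_n) (x : X) : i = l.+1 -> k = i :> nat -> x l != x k ->
    s i x = flip k (flip l x).
  move=> il ki xlk; have kl : k != l by rewrite -val_eqE /= ki il neq_ltn ltnSn orbT.
  have ei : insubd o i = k by apply/val_inj; rewrite /= vo // -ki.
  have k0 : (0 < k)%N by rewrite ki il.
  apply/ffunP=> m; rewrite /s ei !ffunE.
  case: (m =P k) => [->|mk].
    have -> : sref k k = l by apply/val_inj; rewrite /= val_sref // swapn_same // ki il.
    by rewrite (negPf kl); case: (x l) (x k) xlk => [] [].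
  case: (m =P l) => [->|ml].
    have -> : sref k l = k.
      by apply/val_inj; rewrite /= val_sref // (_ : nat_of_ord l = k.-1) ?swapn_pred // ki il.
    by case: (x l) (x k) xlk => [] [].
  have -> // : sref k m = m.
  apply/val_inj; rewrite /= val_sref // /swapn.
  by move/eqP: mk; move/eqP: ml; rewrite -!val_eqE /= ki il => /negPf-> /negPf->.
have Fs i (k l : 'I_n) (x : X) : i = l.+1 -> k = i :> nat -> x l = false -> x k ->
    F (s i x) = q * F x.
  move=> il ki xl xk; rewrite (s_flip i k l) //; last by rewrite xl xk.
  have kl : k != l by rewrite -val_eqE /= ki il neq_ltn ltnSn orbT.
  rewrite Fflip; last by rewrite ffunE (negPf kl).
  have := Fflip (flip l x) l; rewrite ffunE eqxx xl flipK => -> //.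
  by rewrite ki il exprS; ring.
have [||f [fF fT]] := @dual_functional _ x0 c phi F.
- move=> [|i] x ni; rewrite phiT //=.
    rewrite T0E -/A; case: ifP => xo; first by rewrite Fflip // expr0 mulr1.
    have := Fflip (flip o x) o; rewrite flipo xo flipK => -> //.
    by rewrite expr0 mulr1; ring.
  have hi : (0 < i.+1 < n)%N by [].
  have ni' : (i < n)%N by apply: ltnW.
  pose l := Ordinal ni'; pose k := Ordinal ni.
  have il : insubd o i = l by apply/val_inj; rewrite /= vo.
  have ik : insubd o i.+1 = k by apply/val_inj; rewrite /= vo.
  rewrite swap_opE /= /lab il ik /word_a /word_b.
  case xl: (x l); case xk: (x k) => //=; rewrite ?mul0r ?addr0 ?add0r ?mul1r //.
    have sx : s i.+1 x = flip k (flip l x) by apply: s_flip; rewrite ?xl ?xk.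
    have kl : k != l by rewrite -val_eqE /= neq_ltn ltnSn orbT.
    have -> : F x = q * F (s i.+1 x).
      rewrite -[in LHS](word_sK lab_inj lab_s x hi) (Fs _ k l) // sx !ffunE.
        by rewrite eq_sym (negPf kl) eqxx xl.
      by rewrite eqxx (negPf kl) xk.
    by ring.
  by rewrite (Fs _ k l).
- exists [ffun=> true]; apply/prodf_neq0=> k _; rewrite ffunE oner_neq0 //.
have fs i y : (0 < i < n)%N -> f (s i y) = f y.
  move=> hi; apply: (word_functional_sym (x0 := x0) q0 lab_inj lab_s hi) => g.
  case/andP: (hi) => i0 ni.
  by have := fT i g ni; rewrite phiT //; case: (i) i0.
(* Evaluating the form on the indicator function of y, where y starts with the
   letter true, compares f at y and at the word with this letter changed. *)
have f0 (y : X) : y o -> f y = - B * f (flip o y).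
  move=> yo; have := fT 0%N (fun x => (x == y)%:R) n0; rewrite phiT //=.
  under eq_bigr do rewrite T0E.
  rewrite [in RHS](bigD1 y) //= eqxx mulr1 [in RHS]big1 ?addr0; last first.
    by move=> x /negPf->; rewrite mulr0.
  rewrite (bigD1 (flip o y)) //= flipo yo /= flipK eqxx big1 ?addr0; last first.
    move=> x xy; have xy' : (flip o x == y) = false.
      by apply: contraNF xy => /eqP<-; rewrite flipK.
    rewrite xy'; case: ifP => xo; rewrite ?mulr0 //.
    have -> : (x == y) = false by apply: contraFF xo => /eqP->.
    by rewrite !mulr0 subr0 mulr0.
  have -> : (flip o y == y) = false.
    by apply: contraTF yo => /eqP e; have := flipo y; rewrite e; case: (y o).
  rewrite -/A => e; apply: (mulfI A0); rewrite -e ?mulr1n ?mulr0n; ring.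
(* The symmetry of f moves the letter in position k to the front. *)
have fk (k : 'I_n) (y : X) : y k -> f y = - B * f (flip k y).
  case: k => k kn; elim: k kn y => [|k IHk] kn y yk.
    by rewrite (_ : Ordinal kn = o) in yk *; [apply: f0 | apply/val_inj].
  have kn' : (k < n)%N by apply: ltnW.
  have hk : (0 < k.+1 < n)%N by [].
  have ek : insubd o k.+1 = Ordinal kn by apply/val_inj; rewrite /= vo.
  have sl : sref (Ordinal kn) (Ordinal kn') = Ordinal kn.
    by apply/val_inj; rewrite /= val_sref //= (swapn_pred k.+1).
  rewrite -(fs _ y hk) (IHk kn'); last by rewrite /s ffunE ek sl.
  rewrite -[in RHS](fs _ _ hk); congr (_ * f _).
  apply/ffunP=> m; rewrite !ffunE ek.
  have -> // : (sref (Ordinal kn) m == Ordinal kn) = (m == Ordinal kn').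
  by rewrite -[X in _ == X]sl (inj_eq perm_inj).
have fG y : f y = f x0 * G y.
  have [m] := ubnP #|[set k | y k]|; elim: m y => // m IHm y ym.
  case: (pickP (fun k => y k)) => [k yk|y0]; last first.
    have -> : y = x0 by apply/ffunP=> k; rewrite ffunE; apply: y0.
    by rewrite /G big1 ?mulr1 // => k _; rewrite ffunE.
  rewrite (fk k) // IHm; last first.
    rewrite -ltnS (leq_trans _ ym) // ltnS; apply: proper_card; apply/properP; split.
      by apply/subsetP=> l; rewrite !inE ffunE; case: eqP => // -> ; rewrite yk.
    by exists k; rewrite !inE ?ffunE ?eqxx yk.
  rewrite /G (bigD1 k) //= [in RHS](bigD1 k) //= ffunE eqxx yk /= mul1r.
  rewrite mulrCA; congr (_ * (_ * _)); apply: eq_bigr => l lk.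
  by rewrite ffunE (negPf lk).
have FGsum : \sum_x f x * F x = f x0 * \prod_(k < n) (A * q ^+ k - B).
  under eq_bigr do rewrite fG -mulrA -big_split /=.
  rewrite -big_distrr /=; congr (_ * _).
  have -> : \prod_(k < n) (A * q ^+ k - B) =
      \prod_(k < n) \sum_(u : bool) (if u then - B else 1) * (if u then 1 else A * q ^+ k).
    by apply: eq_bigr => k _; rewrite big_bool /=; ring.
  by rewrite bigA_distr_bigA.
move: fF; rewrite FGsum mulf_eq0 negb_or => /andP[_ /prodf_neq0/(_ (Ordinal jn) isT)].
by rewrite subr_eq0.
Qed.

End SemisimplicityConditions.

(** * Poincare polynomials of Young subgroups *)

Section Poincare.
Variables (K : fieldType) (q : K).

Lemma len_sum n (w : 'S_n) :
  len w = (\sum_(a < n) \sum_(b < n) ((a < b) && (w b < w a)))%N.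
Proof.
rewrite pair_big /= /len -sum1dep_card big_mkcond /=.
by apply: eq_bigr => -[a b] _ /=; case: (_ && _).
Qed.

(** The value j at the first place is inverted with the j smaller ones. *)
Lemma len_lift_perm n (j : 'I_n.+1) (w : 'S_n) :
  len (lift_perm ord0 j w) = (j + len w)%N.
Proof.
rewrite !len_sum big_ord_recl; congr (_ + _)%N.
  rewrite big_ord_recl ltnn /= add0n.
  rewrite -[RHS](card_ord_lt (ltn_ord j : (j <= n)%N)).
  rewrite -(card_preimset _ (@perm_inj _ w)) -sum1dep_card [RHS]big_mkcond /=.
  apply: eq_bigr => k _; rewrite lift_perm_id lift_perm_lift inE /= /bump.
  by case: leqP => h; case: ltnP => //; lia.
apply: eq_bigr => k _; rewrite big_ord_recl /= add0n.
apply: eq_bigr => l _; rewrite !lift_perm_lift /= /bump !leq0n !add1n ltnS.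
by congr (nat_of_bool (_ && _)); case: leqP; case: leqP; lia.
Qed.

Lemma poincare_rec n : \sum_(w : 'S_n.+1) q ^+ len w =
  (\sum_(j < n.+1) q ^+ j) * \sum_(w : 'S_n) q ^+ len w.
Proof.
pose h (jw : 'I_n.+1 * 'S_n) := lift_perm ord0 jw.1 jw.2.
have h_inj : injective h.
  move=> [j w] [j' w'] /permP e; have := e ord0; rewrite !lift_perm_id /= => jj.
  rewrite -{}jj in e *; congr (_, _); apply/permP=> k.
  by have := e (lift ord0 k); rewrite !lift_perm_lift => /lift_inj.
have h_bij : bijective h.
  apply: inj_card_bij h_inj _.
  by rewrite card_prod card_ord !card_Sn factS.
rewrite (reindex h) /=; last exact: onW_bij.
rewrite -(pair_bigA _ (fun j w => q ^+ len (h (j, w)))) /= big_distrl /=.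
apply: eq_bigr => j _; rewrite big_distrr /=; apply: eq_bigr => w _.
by rewrite len_lift_perm exprD.
Qed.

Lemma poincare_prod n : \sum_(w : 'S_n) q ^+ len w =
  \prod_(m < n) \sum_(j < m.+1) q ^+ j.
Proof.
elim: n => [|n IHn].
  rewrite big_ord0 (big_pred1 1%g) ?len1 // => w /=.
  by apply/esym/eqP/permP=> -[].
by rewrite poincare_rec IHn [RHS]big_ord_recr /= mulrC.
Qed.

Lemma pow_neq1 n k : q != 1 -> \sum_(w : 'S_n) q ^+ len w != 0 ->
  (0 < k <= n)%N -> q ^+ k != 1.
Proof.
move=> q1; rewrite poincare_prod => /prodf_neq0 P0; case: k => // k /andP[_ kn].
have := P0 (Ordinal kn) isT => /= s0.
rewrite -subr_eq0 subrX1 mulf_neq0 ?subr_eq0 //.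
Qed.

End Poincare.

Section Parabolic.
Variables (n : nat) (be : 'I_n -> nat).
Hypothesis be_mono : forall i j : 'I_n, (i <= j)%N -> (be i <= be j)%N.

(** Young subgroups as stabilizers of a weakly increasing function: this covers
    row stabilizers and products of two symmetric groups. *)
Definition block_stab : {set 'S_n} := [set w : 'S_n | [forall i, be (w i) == be i]].

Lemma block_stabP (w : 'S_n) : reflect (forall i, be (w i) = be i) (w \in block_stab).
Proof. by rewrite inE; apply: (iffP forallP) => wP i; apply/eqP. Qed.

Lemma block_stab_group : group_set block_stab.
Proof.
apply/group_setP; split=> [|x y /block_stabP bx /block_stabP by_].
  by apply/block_stabP=> i; rewrite perm1.
by apply/block_stabP=> i; rewrite permM by_ bx.
Qed.
Canonical block_stab_groupType := Group block_stab_group.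

Lemma sref_block (i j : 'I_n) : i = j.+1 :> nat -> be i = be j ->
  sref i \in block_stab.
Proof.
move=> ij bij; apply/block_stabP=> k; rewrite /sref.
have -> : insubd i i.-1 = j by apply/val_inj; rewrite val_insubd ij /= ltn_ord.
by case: tpermP => [->|->|_ _] //; rewrite bij.
Qed.

Definition block_minimal (d : 'S_n) :=
  forall x, x \in block_stab -> (len d <= len (x * d)%g)%N.

Lemma block_minimal_mono d : block_minimal d ->
  forall i j : 'I_n, be i = be j -> (i < j)%N -> (d i < d j)%N.
Proof.
move=> dmin i j bij ij; apply: (@perm_step_mono _ d i j.+1) => // k l kl il kj.
have bkl : be k = be l.
  have lk : (l <= k)%N by rewrite kl.
  apply/eqP; rewrite eqn_leq (be_mono lk) andbT.
  by rewrite (leq_trans (be_mono (kj : (k <= j)%N))) // -bij be_mono.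
rewrite ltnNge; apply/negP=> dkl.
have lt : (d k < d l)%N.
  rewrite ltn_neqAle dkl andbT; apply/eqP=> /val_inj/perm_inj e.
  by move/eqP: kl; rewrite e eqn_leq ltnn andbF.
have := dmin _ (sref_block kl bkl).
by rewrite (len_srefL_desc kl lt) ltnn.
Qed.

Lemma block_descent (x : 'S_n) (i j : 'I_n) : x \in block_stab ->
  i = j.+1 :> nat -> (x i < x j)%N -> be i = be j.
Proof.
move=> /block_stabP bx ij lt; apply/eqP; rewrite eqn_leq -{1}bx -{1}(bx j).
by rewrite be_mono ?be_mono ?ij // ltnW.
Qed.

(** A descent of x joins two points of one block, where d is increasing, so it is
    a descent of x d as well and can be removed from both. *)
Lemma len_block x d : x \in block_stab -> block_minimal d ->
  len (x * d)%g = (len x + len d)%N.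
Proof.
move=> xG dmin; have [m] := ubnP (len x); elim: m x xG => // m IHm x xG lt.
case: (eqVneq x 1%g) => [->|]; first by rewrite mul1g len1.
case/perm_descent=> i [j [ij xij]].
have bij := block_descent xG ij xij.
have sG := sref_block ij bij.
have lx := len_srefL_desc ij xij.
have i0 : (0 < i)%N by rewrite ij.
have si : sref i i = j.
  by apply/val_inj; rewrite /= val_sref // swapn_same // ij.
have sj : sref i j = i.
  by apply/val_inj; rewrite /= val_sref // (_ : (j : nat) = i.-1) ?swapn_pred // ij.
have x'G : (sref i * x)%g \in block_stab by rewrite groupM.
have -> : (x * d = sref i * ((sref i * x) * d))%g by rewrite !mulgA srefK mul1g.
have IH : len ((sref i * x) * d)%g = (len (sref i * x) + len d)%N.
  by apply: IHm => //; rewrite -ltnS -lx.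
rewrite (len_srefL ij) ?IH; first by rewrite lx addSn.
rewrite !permM si sj; apply: block_minimal_mono => //.
by rewrite !(block_stabP _ xG).
Qed.

(** Lengths add up along a coset and its minimal representative, so that the
    Poincare polynomial of the subgroup divides that of the whole group. *)
Lemma parabolic_poincare (K : fieldType) (q : K) :
  \sum_(w : 'S_n) q ^+ len w != 0 -> \sum_(w in block_stab) q ^+ len w != 0.
Proof.
apply: contra_neq => P0.
have part : partition (rcosets block_stab [set: 'S_n]) [set: 'S_n].
  exact: (rcosets_partition (subsetT [group of block_stab])).
transitivity (\sum_(w in [set: 'S_n]) q ^+ len w).
  by apply: eq_bigl => w; rewrite inE.
rewrite (set_partition_big _ part) big1 // => C /rcosetsP[w _ ->] {C}.
have w_in : w \in (block_stab :* w)%g by rewrite (rcoset_refl [group of block_stab]).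
pose d := [arg min_(x < w in (block_stab :* w)%g) len x].
have [dC dmin] : d \in (block_stab :* w)%g /\ block_minimal d.
  rewrite /d; case: arg_minnP => // e eC emin; split=> // x xG; apply: emin.
  rewrite mem_rcoset -mulgA; rewrite mem_rcoset in eC.
  exact: (groupM (G := [group of block_stab]) xG eC).
have -> : (block_stab :* w)%g = (block_stab :* d)%g.
  by apply/esym/(rcoset_eqP (G := [group of block_stab])).
rewrite (reindex_inj (mulIg d)) /=.
transitivity (\sum_(w in block_stab) q ^+ len w * q ^+ len d).
  apply: eq_big => [x|x]; rewrite mem_rcoset mulgK // => xG.
  by rewrite len_block // exprD.
by rewrite -big_distrl /= P0 mul0r.
Qed.

End Parabolic.

(** * Standard tableaux *)

Section Tableaux.
Variables (p d n : nat).
Local Notation mpart := (mpart p d n).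
Local Notation node := (node p d n).
Local Notation tableau := (tableau p d n).
Hypothesis pd0 : (0 < p * d)%N.
Hypothesis n0 : (0 < n)%N.
Implicit Types (t : tableau) (x y : node) (lam : mpart) (w : 'S_n).

Let o : 'I_n := Ordinal n0.
(** A default value, which [pos] does not take for lack of a box if the tableau is
    standard. *)
Definition node0 : node := (Ordinal pd0, Ordinal n0, Ordinal n0).

Definition pos t (k : 'I_n) : node := odflt node0 [pick x | t x == Some k].
Definition ent t x : 'I_n := odflt (Ordinal n0) (t x).

Lemma posE t k : pos t k = odflt node0 [pick x | t x == Some k].
Proof. by []. Qed.

Section Standard.
Variables (lam : mpart) (t : tableau).
Hypothesis tS : t \in Std lam.

Lemma Std_diagram x : (t x != None) = (x \in diagram lam).
Proof. by have := tS; rewrite inE => /and3P[/forallP/(_ x)/eqP]. Qed.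

Lemma Std_pos k : t (pos t k) = Some k.
Proof.
have := tS; rewrite inE => /and3P[_ /forallP/(_ k)/cards1P[x xk] _].
rewrite /pos; case: pickP => [y /eqP //|nx].
by move/setP: xk => /(_ x); rewrite !inE eqxx nx.
Qed.

Lemma Std_posE x k : t x = Some k -> x = pos t k.
Proof.
move=> tx; have := tS; rewrite inE => /and3P[_ /forallP/(_ k)/cards1P[y yk] _].
have eqy z : t z = Some k -> z = y.
  by move=> tz; apply/set1P; rewrite -yk inE tz.
by rewrite (eqy x) // (eqy (pos t k)) // Std_pos.
Qed.

Lemma pos_diagram k : pos t k \in diagram lam.
Proof. by rewrite -Std_diagram Std_pos. Qed.

Lemma Std_ent x : x \in diagram lam -> t x = Some (ent t x).
Proof. by rewrite -Std_diagram /ent; case: (t x). Qed.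

Lemma ent_pos k : ent t (pos t k) = k.
Proof. by rewrite /ent Std_pos. Qed.

Lemma pos_ent x : x \in diagram lam -> pos t (ent t x) = x.
Proof. by move=> xl; rewrite -(Std_posE (Std_ent xl)). Qed.

Lemma pos_inj : injective (pos t).
Proof. exact: can_inj ent_pos. Qed.

Lemma ent_inj x y : x \in diagram lam -> y \in diagram lam ->
  ent t x = ent t y -> x = y.
Proof. by move=> xl yl e; rewrite -(pos_ent xl) e pos_ent. Qed.

Lemma Std_row x y : x \in diagram lam -> y \in diagram lam ->
  x.1 = y.1 -> (x.2 < y.2)%N -> (ent t x < ent t y)%N.
Proof.
move=> xl yl xy lt; have := tS; rewrite inE => /and3P[_ _].
move=> /forallP/(_ x)/forallP/(_ y)/forallP/(_ (ent t x))/forallP/(_ (ent t y)).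
by move/implyP; apply; rewrite !Std_ent // !eqxx xy !eqxx lt.
Qed.

Lemma Std_col x y : x \in diagram lam -> y \in diagram lam ->
  x.1.1 = y.1.1 -> x.2 = y.2 -> (x.1.2 < y.1.2)%N -> (ent t x < ent t y)%N.
Proof.
move=> xl yl xy c lt; have := tS; rewrite inE => /and3P[_ _].
move=> /forallP/(_ x)/forallP/(_ y)/forallP/(_ (ent t x))/forallP/(_ (ent t y)).
by move/implyP; apply; rewrite !Std_ent // !eqxx xy c !eqxx lt orbT.
Qed.

End Standard.

Lemma StdP lam t :
  (forall x, (t x != None) = (x \in diagram lam)) ->
  (exists f : 'I_n -> node, forall x k, t x = Some k <-> x = f k) ->
  (forall x y, x \in diagram lam -> y \in diagram lam -> x.1 = y.1 ->
     (x.2 < y.2)%N -> (ent t x < ent t y)%N) ->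
  (forall x y, x \in diagram lam -> y \in diagram lam -> x.1.1 = y.1.1 ->
     x.2 = y.2 -> (x.1.2 < y.1.2)%N -> (ent t x < ent t y)%N) ->
  t \in Std lam.
Proof.
move=> td [f tf] trow tcol; rewrite inE; apply/and3P; split.
- by apply/forallP=> x; rewrite td.
- apply/forallP=> k; apply/cards1P; exists (f k); apply/setP=> x.
  by rewrite !inE; apply/eqP/eqP=> /tf.
apply/forallP=> x; apply/forallP=> y; apply/forallP=> k; apply/forallP=> l.
apply/implyP=> /and4P[/eqP tx /eqP ty /eqP s].
have xl : x \in diagram lam by rewrite -td tx.
have yl : y \in diagram lam by rewrite -td ty.
have kx : ent t x = k by rewrite /ent tx.
have ly : ent t y = l by rewrite /ent ty.
rewrite -kx -ly => /orP[/andP[/eqP r c]|/andP[/eqP c r]].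
  by apply: trow => //; case: (x.1) (y.1) s r => [? ?] [? ?] /= -> ->.
exact: tcol.
Qed.

Lemma diagram_closed lam (s : 'I_(p * d)) (a b a' b' : 'I_n) :
  is_mpart lam -> (s, a, b) \in diagram lam -> (a' <= a)%N -> (b' <= b)%N ->
  (s, a', b') \in diagram lam.
Proof.
case/andP=> /forallP/(_ s)/forallP/(_ a')/forallP/(_ a)/implyP mono _.
rewrite !inE /= => bl aa bb; apply: leq_ltn_trans bb (leq_trans bl (mono aa)).
Qed.

(** The first row up to the column of x and the first column down to the row of y
    consist of boxes of the shape, with at most one in common. This keeps the
    exponents of q that occur in comparisons of residues below n. *)
Lemma diagram_corner lam x y : is_mpart lam ->
  x \in diagram lam -> y \in diagram lam ->
  (x.2 + y.1.2 < n)%N /\ (x.1.1 != y.1.1 -> (x.2 + y.1.2).+1 < n)%N.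
Proof.
move=> hl; case: x => -[s a] b; case: y => -[s' a'] b' xl yl /=.
have rowpos (r : 'I_n) : (r <= a')%N -> (0 < lam s' r)%N.
  move=> ra; have := diagram_closed hl yl ra (leqnn b').
  by rewrite inE /=; apply: leq_trans.
have row0 : (b < lam s o)%N.
  by have := diagram_closed (a' := o) hl xl (leq0n a) (leqnn b); rewrite inE.
case/andP: hl => _ /eqP tot.
rewrite pair_big /= (bigD1 (s, o)) //= in tot.
rewrite (bigID (fun z : 'I_(p * d) * 'I_n => (z.1 == s') && (z.2 <= a')%N)) /= in tot.
set S := (\sum_(z | _ && (_ && _)) _)%N in tot.
have Sge : (#|[set z : 'I_(p * d) * 'I_n | (z != (s, o)) && ((z.1 == s') && (z.2 <= a')%N)]| <= S)%N.
  rewrite -sum1dep_card /S; apply: leq_sum => -[u r] /= /andP[_ /andP[/eqP-> ra]].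
  exact: rowpos.
have cardB : #|[set z : 'I_(p * d) * 'I_n | (z.1 == s') && (z.2 <= a')%N]| = a'.+1.
  have -> : [set z : 'I_(p * d) * 'I_n | (z.1 == s') && (z.2 <= a')%N]
      = setX [set s'] [set r : 'I_n | (r < a'.+1)%N].
    by apply/setP=> -[u r]; rewrite !inE.
  by rewrite cardsX cards1 mul1n card_ord_lt.
case: (eqVneq s s') => [ss|ss].
  subst s'.
  have cardC : (a' <= #|[set z : 'I_(p * d) * 'I_n | (z != (s, o)) && ((z.1 == s) && (z.2 <= a')%N)]|)%N.
    have := cardsD1 (s, o) [set z : 'I_(p * d) * 'I_n | (z.1 == s) && (z.2 <= a')%N].
    rewrite cardB inE /= eqxx /= add1n => -[e]; rewrite {1}e.
    by apply: subset_leq_card; apply/subsetP=> z; rewrite !inE.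
  by split=> //; lia.
have cardC : (a'.+1 <= #|[set z : 'I_(p * d) * 'I_n | (z != (s, o)) && ((z.1 == s') && (z.2 <= a')%N)]|)%N.
  rewrite -cardB; apply: subset_leq_card; apply/subsetP=> -[u r]; rewrite !inE /=.
  case/andP=> /eqP-> ->; rewrite eqxx andbT xpair_eqE eq_sym (negPf ss) //.
by split=> [|_]; lia.
Qed.

Lemma card_diagram lam : is_mpart lam -> #|diagram lam| = n.
Proof.
case/andP=> _ /eqP e; apply: etrans e; rewrite -sum1_card pair_big /=.
transitivity (\sum_(z : 'I_(p * d) * 'I_n) \sum_(c < n | (c < lam z.1 z.2)%N) 1)%N.
  rewrite pair_big_dep /=; apply: eq_bigl => -[[s a] c]; rewrite inE //.
by apply: eq_bigr => -[s a] _ /=; rewrite sum1dep_card card_ord_lt // -ltnS.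
Qed.

Lemma before_irr x : before x x = false.
Proof. by rewrite /before !ltnn !eqxx. Qed.

Lemma before_trans : transitive (@before p d n).
Proof.
move=> [[s a] b] [[s' a'] b'] [[s2 a2] b2]; rewrite /before /= -!val_eqE /=; lia.
Qed.

Lemma before_total x y : x != y -> before x y || before y x.
Proof.
case: x y => -[s a] b [[s' a'] b']; rewrite !xpair_eqE /before /= -!val_eqE /=; lia.
Qed.

Lemma before_asym x y : before x y -> ~~ before y x.
Proof.
by move=> xy; apply/negP=> yx; have := before_trans xy yx; rewrite before_irr.
Qed.

Section Initial.
Variable lam : mpart.
Hypothesis hl : is_mpart lam.

(** The 0-based entry of x in the initial tableau. *)
Definition rank x : nat := #|[set y in diagram lam | before y x]|.

Lemma rank_lt x : x \in diagram lam -> (rank x < n)%N.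
Proof.
move=> xl; rewrite -[X in (_ < X)%N](card_diagram hl); apply: proper_card.
apply/properP; split; first by apply/subsetP=> y; rewrite inE => /andP[].
by exists x; rewrite // !inE before_irr andbF.
Qed.

Lemma rank_before x y : x \in diagram lam -> before x y -> (rank x < rank y)%N.
Proof.
move=> xl xy; apply: proper_card; apply/properP; split.
  apply/subsetP=> z; rewrite !inE => /andP[-> zx] /=; exact: before_trans xy.
by exists x; rewrite inE ?before_irr ?andbF // xl.
Qed.

Lemma rank_ltE x y : x \in diagram lam -> y \in diagram lam ->
  (rank x < rank y)%N = before x y.
Proof.
move=> xl yl; apply/idP/idP; last exact: rank_before.
case: (eqVneq x y) => [->|xy]; first by rewrite ltnn.
case/orP: (before_total xy) => // /(rank_before yl) lt.
by rewrite ltnNge ltnW.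
Qed.

Lemma ent_tinit x : x \in diagram lam -> ent (tinit lam) x = rank x :> nat.
Proof.
by move=> xl; rewrite /ent /tinit ffunE xl insubT ?rank_lt.
Qed.

Lemma tinit_Some x : x \in diagram lam -> tinit lam x = Some (ent (tinit lam) x).
Proof.
by move=> xl; rewrite /ent /tinit ffunE xl insubT ?rank_lt.
Qed.

Lemma tinit_diagram x : (tinit lam x != None) = (x \in diagram lam).
Proof.
case xl: (x \in diagram lam); first by rewrite tinit_Some.
by rewrite /tinit ffunE xl.
Qed.

Lemma tinit_Std : tinit lam \in Std lam.
Proof.
have entinj : {in diagram lam &, injective (ent (tinit lam))}.
  move=> x y xl yl /(congr1 val) /=; rewrite !ent_tinit // => e.
  apply/eqP/negPn/negP=> /before_total; rewrite -!rank_ltE // e ltnn //.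
have surj k : exists2 x, x \in diagram lam & ent (tinit lam) x = k.
  have : k \in ent (tinit lam) @: diagram lam.
    have -> : ent (tinit lam) @: diagram lam = setT.
      by apply/eqP; rewrite eqEcard subsetT cardsT card_ord card_in_imset // card_diagram /=.
    by rewrite inE.
  by case/imsetP=> x xl ->; exists x.
apply: StdP.
- exact: tinit_diagram.
- have /fin_all_exists2[f fl fk] := surj.
  exists f => x k; split=> [tx|->]; last by rewrite tinit_Some // fk.
  have xl : x \in diagram lam by rewrite -tinit_diagram tx.
  by apply: entinj => //; rewrite fk /ent tx.
- move=> x y xl yl xy c; rewrite !ent_tinit // rank_before //.
  by rewrite /before xy !eqxx c !orbT.
- move=> x y xl yl s c r; rewrite !ent_tinit // rank_before //.
  by rewrite /before s eqxx r orbT.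
Qed.

End Initial.

Lemma tactE t w x : tact t w x = omap w (t x).
Proof. by rewrite ffunE. Qed.

Lemma tactM t w w' : tact t (w * w')%g = tact (tact t w) w'.
Proof. by apply/ffunP=> x; rewrite !tactE; case: (t x) => //= k; rewrite permM. Qed.

Lemma tact1 t : tact t 1%g = t.
Proof. by apply/ffunP=> x; rewrite tactE; case: (t x) => //= k; rewrite perm1. Qed.

Lemma ent_tact lam t w x : t \in Std lam -> x \in diagram lam ->
  ent (tact t w) x = w (ent t x).
Proof. by move=> tS xl; rewrite /ent tactE (Std_ent tS xl). Qed.

Lemma pos_tact lam t w k : t \in Std lam -> pos (tact t w) (w k) = pos t k.
Proof.
move=> tS; rewrite /pos; congr odflt; apply: eq_pick => x.
rewrite tactE; case: (t x) => //= l.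
by apply/eqP/eqP=> [[/perm_inj->]|[->]].
Qed.

Lemma tact_Std lam t w : t \in Std lam ->
  (forall x y, x \in diagram lam -> y \in diagram lam -> x.1.1 = y.1.1 ->
     (x.1.2 == y.1.2) || (x.2 == y.2) ->
     (ent t x < ent t y)%N -> (w (ent t x) < w (ent t y))%N) ->
  tact t w \in Std lam.
Proof.
move=> tS mono; apply: StdP.
- by move=> x; rewrite -(Std_diagram tS) tactE; case: (t x).
- exists (fun k => pos t ((w^-1)%g k)) => x k; rewrite tactE; split=> [|->].
    case tx: (t x) => [l|//] /= [<-]; rewrite permK.
    exact: (Std_posE tS).
  by rewrite (Std_pos tS) /= permKV.
- move=> x y xl yl xy c; rewrite !(ent_tact w tS) //; apply: mono; rewrite ?xy ?eqxx //.
  exact: (Std_row tS).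
- move=> x y xl yl s c r; rewrite !(ent_tact w tS) //; apply: mono; rewrite ?c ?eqxx ?orbT //.
  exact: (Std_col tS).
Qed.

Lemma tact_inj lam t w w' : t \in Std lam -> tact t w = tact t w' -> w = w'.
Proof.
move=> tS /ffunP e; apply/permP=> k; have := e (pos t k).
by rewrite !tactE (Std_pos tS) => -[].
Qed.

Lemma dpermP lam t : is_mpart lam -> t \in Std lam ->
  tact (tinit lam) (dperm lam t) = t.
Proof.
move=> hl tS; have iS := tinit_Std hl; rewrite /dperm.
case: pickP => [w /eqP //|nw].
have inj : injective (fun k => ent t (pos (tinit lam) k)).
  move=> k l e; apply: (pos_inj iS); apply: (ent_inj tS _ _ e); exact: pos_diagram.
have := nw (perm inj); rewrite -[false]/(~~ true) => /negP[]; apply/eqP/ffunP=> x.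
rewrite tactE; case xl: (x \in diagram lam).
  rewrite (Std_ent iS xl) /= permE (pos_ent iS xl).
  by rewrite -(Std_ent tS xl).
have := Std_diagram tS x; have := Std_diagram iS x; rewrite xl.
by case: (t x); case: (tinit lam x).
Qed.

Lemma dperm_eq lam t w : is_mpart lam -> t \in Std lam ->
  tact (tinit lam) w = t -> dperm lam t = w.
Proof.
move=> hl tS e; apply: (tact_inj (tinit_Std hl)); rewrite dpermP //.
Qed.

End Tableaux.

(** * Adjacent entries, diagonals and rows *)

Section Swaps.
Variables (p d n : nat).
Local Notation mpart := (mpart p d n).
Local Notation node := (node p d n).
Local Notation tableau := (tableau p d n).
Hypothesis pd0 : (0 < p * d)%N.
Hypothesis n0 : (0 < n)%N.
Implicit Types (t u : tableau) (x y : node) (lam : mpart) (w : 'S_n).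
Local Notation pos := (pos pd0 n0).
Local Notation ent := (ent n0).

(** Consecutive entries of a standard tableau can be exchanged exactly when their
    boxes do not share a row or a column. *)
Definition same_line x y : bool :=
  (x.1.1 == y.1.1) && ((x.1.2 == y.1.2) || (x.2 == y.2)).

Definition same_diag x y : bool :=
  (x.1.1 == y.1.1) && ((x.2 + y.1.2)%N == (y.2 + x.1.2)%N).

Section OneTableau.
Variables (lam : mpart) (t : tableau).
Hypothesis hl : is_mpart lam.
Hypothesis tS : t \in Std lam.

Lemma Std_le x y : x \in diagram lam -> y \in diagram lam ->
  x.1.1 = y.1.1 -> (x.1.2 <= y.1.2)%N -> (x.2 <= y.2)%N -> x != y ->
  (ent t x < ent t y)%N.
Proof.
case: x => -[s a] b; case: y => -[s' a'] b' xl yl /= ss ab bb; subst s'.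
move=> xy; have zl : (s, a, b') \in diagram lam := diagram_closed hl yl ab (leqnn b').
case: (ltngtP b b') bb => // [lt _|/val_inj eb _].
  have h1 := Std_row n0 tS xl zl erefl lt.
  case: (ltngtP a a') ab => // [lta _|/val_inj ea _]; last by rewrite -ea.
  exact: ltn_trans h1 (Std_col n0 tS zl yl erefl erefl lta).
subst b'; case: (ltngtP a a') ab => // [lta _|/val_inj ea _].
  exact: (Std_col n0 tS xl yl erefl erefl lta).
by rewrite ea eqxx in xy.
Qed.

(** On the way from a box to a later one of its diagonal, both neighbours of the
    first box, to the right and below, carry an intermediate entry. *)
Lemma diag_gap x y : x \in diagram lam -> y \in diagram lam ->
  same_diag x y -> x != y -> (ent t x < ent t y)%N -> ((ent t x).+2 < ent t y)%N.
Proof.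
case: x => -[s a] b; case: y => -[s' a'] b' xl yl /andP[/eqP/= ss /eqP/= dg].
subst s' => xy lt.
have aa : (a < a')%N.
  rewrite ltnNge; apply/negP=> a'a.
  have := Std_le yl xl erefl a'a; rewrite /= eq_sym => h.
  have bb : (b' <= b)%N by lia.
  by have := h bb xy; rewrite ltnNge ltnW.
have bb : (b < b')%N by lia.
have a1n : (a.+1 < n)%N by apply: leq_ltn_trans aa (ltn_ord a').
have b1n : (b.+1 < n)%N by apply: leq_ltn_trans bb (ltn_ord b').
pose c1 : node := (s, Ordinal a1n, b); pose c2 : node := (s, a, Ordinal b1n).
have c1l : c1 \in diagram lam by apply: (diagram_closed hl yl) => //; apply: ltnW.
have c2l : c2 \in diagram lam by apply: (diagram_closed hl yl) => //; apply: ltnW.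
have ne (u v : node) : (u.1.2 != v.1.2 :> nat) || (u.2 != v.2 :> nat) -> u != v.
  by apply: contraTneq => ->; rewrite !eqxx.
have h1 : (ent t (s, a, b) < ent t c1)%N.
  by apply: Std_le => //=; apply: ne; rewrite /= neq_ltn ltnSn.
have h2 : (ent t (s, a, b) < ent t c2)%N.
  by apply: Std_le => //=; apply: ne; rewrite /= (neq_ltn b) ltnSn orbT.
have h3 : (ent t c1 < ent t (s, a', b'))%N.
  by apply: Std_le => //=; [exact: ltnW | apply: ne; rewrite /= (neq_ltn b) bb orbT].
have h4 : (ent t c2 < ent t (s, a', b'))%N.
  by apply: Std_le => //=; [exact: ltnW | apply: ne; rewrite /= neq_ltn aa].
have h5 : ent t c1 != ent t c2 :> nat.
  rewrite val_eqE; apply/eqP=> /(ent_inj pd0 tS c1l c2l) /(congr1 (fun x : node => nat_of_ord x.1.2)) /=.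
  by move/eqP; rewrite eqn_leq ltnn.
lia.
Qed.

Lemma pos_not_diag (i j : 'I_n) : (j < i)%N -> (i <= j.+2)%N ->
  ~~ same_diag (pos t j) (pos t i).
Proof.
move=> ji ij2; apply/negP=> sd.
have ne : pos t j != pos t i.
  by apply/eqP=> /(pos_inj tS) e; rewrite e ltnn in ji.
have := diag_gap (pos_diagram _ _ tS j) (pos_diagram _ _ tS i) sd ne.
rewrite !(ent_pos _ _ tS) => /(_ ji); lia.
Qed.

Lemma pos_next_row (i j : 'I_n) : i = j.+1 :> nat ->
  (pos t j).1 = (pos t i).1 -> (pos t i).2 = (pos t j).2.+1 :> nat.
Proof.
move=> ij; have xl := pos_diagram pd0 n0 tS j; have yl := pos_diagram pd0 n0 tS i.
have ex := ent_pos pd0 n0 tS j; have ey := ent_pos pd0 n0 tS i.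
move: (pos t j) (pos t i) xl yl ex ey => [[s a] b] [[s' a'] b'] xl yl ex ey /=.
case=> ss aa; subst s' a'.
case: (ltngtP b b') => [lt|lt|/val_inj e].
- apply/eqP; rewrite eqn_leq lt andbT leqNgt; apply/negP=> lt2.
  have b1n : (b.+1 < n)%N by apply: ltn_trans lt2 (ltn_ord b').
  have zl : (s, a, Ordinal b1n) \in diagram lam.
    by apply: (diagram_closed hl yl) => //; apply: ltnW.
  have h1 := Std_row n0 tS xl zl erefl (ltnSn b).
  have h2 := Std_row n0 tS zl yl erefl lt2.
  by rewrite ex in h1; rewrite ey ij in h2; lia.
- have := Std_row n0 tS yl xl erefl lt; rewrite ex ey ij; lia.
- by move: ij; rewrite -ey -ex e => /eqP; rewrite eqn_leq ltnn andbF.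
Qed.

Lemma pos_next_col (i j : 'I_n) : i = j.+1 :> nat ->
  (pos t j).1.1 = (pos t i).1.1 -> (pos t j).2 = (pos t i).2 ->
  (pos t i).1.2 = (pos t j).1.2.+1 :> nat.
Proof.
move=> ij; have xl := pos_diagram pd0 n0 tS j; have yl := pos_diagram pd0 n0 tS i.
have ex := ent_pos pd0 n0 tS j; have ey := ent_pos pd0 n0 tS i.
move: (pos t j) (pos t i) xl yl ex ey => [[s a] b] [[s' a'] b'] xl yl ex ey /=.
move=> ss bb; subst s' b'.
case: (ltngtP a a') => [lt|lt|/val_inj e].
- apply/eqP; rewrite eqn_leq lt andbT leqNgt; apply/negP=> lt2.
  have a1n : (a.+1 < n)%N by apply: ltn_trans lt2 (ltn_ord a').
  have zl : (s, Ordinal a1n, b) \in diagram lam.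
    by apply: (diagram_closed hl yl) => //; apply: ltnW.
  have h1 := Std_col n0 tS xl zl erefl erefl (ltnSn a).
  have h2 := Std_col n0 tS zl yl erefl erefl lt2.
  by rewrite ex in h1; rewrite ey ij in h2; lia.
- have := Std_col n0 tS yl xl erefl erefl lt; rewrite ex ey ij; lia.
- by move: ij; rewrite -ey -ex e => /eqP; rewrite eqn_leq ltnn andbF.
Qed.

Lemma swap_Std (i j : 'I_n) : i = j.+1 :> nat ->
  ~~ same_line (pos t j) (pos t i) -> tact t (sref i) \in Std lam.
Proof.
move=> ij nl; apply: (tact_Std (n0 := n0) pd0 tS) => x y xl yl s line lt.
have i0 : (0 < i)%N by rewrite ij.
have ne : ~~ ((ent t x == j) && (ent t y == i)).
  apply: contra nl => /andP[/eqP<- /eqP<-].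
  by rewrite !(pos_ent pd0 n0 tS) // /same_line s eqxx.
by rewrite !val_sref // swapn_mono //; move: ne; rewrite -!val_eqE /= ij.
Qed.

Lemma pos_tact_sref (i k : 'I_n) : pos (tact t (sref i)) k = pos t (sref i k).
Proof.
have -> : k = sref i (sref i k) by rewrite -permM srefK perm1.
by rewrite (pos_tact _ _ _ _ tS) -permM srefK perm1.
Qed.

Lemma before_not_line (i j : 'I_n) : i = j.+1 :> nat ->
  before (pos t i) (pos t j) -> ~~ same_line (pos t j) (pos t i).
Proof.
move=> ij bf; apply/negP=> /andP[/eqP s /orP[/eqP r|/eqP c]].
  have s1 : (pos t j).1 = (pos t i).1.
    by case: ((pos t j).1) ((pos t i).1) s r => [? ?] [? ?] /= -> ->.
  have := pos_next_row ij s1; move: bf; rewrite /before s r !ltnn !eqxx /=; lia.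
have := pos_next_col ij s c; move: bf; rewrite /before s c !ltnn !eqxx /= andbF orbF; lia.
Qed.

End OneTableau.

(** Numbers the rows in reading order, which makes the row stabilizer a block
    stabilizer. *)
Definition row_block lam (k : 'I_n) : nat :=
  let x := pos (tinit lam) k in (x.1.1 * n + x.1.2)%N.

Lemma row_block_eq lam k l :
  (row_block lam k == row_block lam l) =
  ((pos (tinit lam) k).1 == (pos (tinit lam) l).1).
Proof.
rewrite /row_block; case: (pos _ k).1 (pos _ l).1 => [s a] [s' a'] /=.
apply/eqP/eqP=> [e|[-> ->]] //.
have e1 := congr1 (divn^~ n) e; have e2 := congr1 (modn^~ n) e.
rewrite /= !divnMDl // !divn_small // !addn0 in e1.
rewrite /= !modnMDl !modn_small // in e2.
by rewrite (val_inj e1) (val_inj e2).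
Qed.

Lemma pos_tinit_before lam (k l : 'I_n) : is_mpart lam ->
  before (pos (tinit lam) k) (pos (tinit lam) l) = (k < l)%N.
Proof.
move=> hl; have iS := tinit_Std pd0 n0 hl.
rewrite -(rank_ltE pd0 n0 (lam := lam)) ?(pos_diagram _ _ iS) //.
by rewrite -!(ent_tinit n0 hl) ?(pos_diagram _ _ iS) // !(ent_pos _ _ iS).
Qed.

Lemma row_block_mono lam : is_mpart lam ->
  forall i j : 'I_n, (i <= j)%N -> (row_block lam i <= row_block lam j)%N.
Proof.
move=> hl i j; rewrite leq_eqVlt => /orP[/eqP/val_inj-> //|].
rewrite -(pos_tinit_before _ _ hl) /row_block /before.
case: (pos _ i) (pos _ j) => [[s a] b] [[s' a'] b'] /=.
case/or3P=> [lt|/andP[/eqP-> lt]|/and3P[/eqP-> /eqP-> _]] //.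
  rewrite (@leq_trans (s.+1 * n)) // ?leq_mul2r ?lt ?orbT //; last first.
    by rewrite (@leq_trans (s' * n)) ?leq_addr // leq_mul2r lt orbT.
  by rewrite mulSn addnC leq_add2r ltnW.
by rewrite leq_add2l ltnW.
Qed.

Lemma row_stab_block lam : is_mpart lam -> row_stab lam = block_stab (row_block lam).
Proof.
move=> hl; have iS := tinit_Std pd0 n0 hl; apply/setP=> w; rewrite !inE.
apply/forallP/forallP=> [h k|h x].
  rewrite row_block_eq eq_sym.
  have := h (pos (tinit lam) k); rewrite (pos_diagram _ _ iS) /=.
  move/forallP/(_ (pos (tinit lam) (w k))); rewrite (pos_diagram _ _ iS) /=.
  by rewrite !(Std_pos _ _ iS) /= eqxx.
apply/implyP=> xl; apply/forallP=> y; apply/implyP=> yl; apply/implyP.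
rewrite (Std_ent n0 iS xl) (Std_ent n0 iS yl) /= => /eqP[e].
by have := h (ent (tinit lam) x); rewrite row_block_eq e !(pos_ent _ _ iS) // eq_sym.
Qed.

Lemma young_block a : young n a = block_stab (fun i : 'I_n => (a <= i : nat)%N).
Proof.
apply/setP=> w; rewrite !inE; apply: eq_forallb => i; rewrite !ltnNge.
by case: (a <= _)%N; case: (a <= _)%N.
Qed.

Lemma young_mono a (i j : 'I_n) : (i <= j)%N -> ((a <= i : nat) <= (a <= j : nat))%N.
Proof. by move=> ij; case: (leqP a i) => // ai; rewrite (leq_trans ai ij). Qed.

End Swaps.

(** * Residues and Young's seminormal form *)

Section Residues.
Variables (p d n : nat) (K : fieldType) (eps q : K) (Q : d.-tuple K).
Local Notation mpart := (mpart p d n).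
Local Notation node := (node p d n).
Local Notation tableau := (tableau p d n).
Hypothesis pd0 : (0 < p * d)%N.
Hypothesis n0 : (0 < n)%N.
Hypothesis q0 : q != 0.
Local Notation par := (cyc_param eps Q).
Local Notation nres := (@node_res p d n K eps q Q).
Local Notation pos := (pos pd0 n0).
Local Notation ent := (ent n0).
Implicit Types (t u : tableau) (x y : node) (lam : mpart).

Hypothesis par0 : forall s, par s != 0.
Hypothesis par_sep : forall (c c' : 'I_(p * d)) (j : nat),
  c != c' -> (j < n)%N -> par c * q ^+ j != par c'.
Hypothesis q_pow : forall k, (0 < k <= n)%N -> q ^+ k != 1.

Lemma node_resE x : nres x = par x.1.1 * (q ^+ x.2 / q ^+ x.1.2).
Proof. by rewrite /node_res expfzDr // exprnN. Qed.

Lemma node_res_neq0 x : nres x != 0.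
Proof.
by rewrite node_resE mulf_neq0 // mulf_neq0 ?invr_neq0 ?expf_neq0.
Qed.

(** Multiplies out the negative powers of q in an equality of residues. *)
Lemma node_res_cross x y (m : nat) : q ^+ m * nres x = nres y ->
  par x.1.1 * q ^+ (m + (x.2 + y.1.2)) = par y.1.1 * q ^+ (y.2 + x.1.2).
Proof.
rewrite !node_resE => e.
have qx := expf_neq0 x.1.2 q0; have qy := expf_neq0 y.1.2 q0.
rewrite !exprD.
move: (q ^+ m) (q ^+ x.2) (q ^+ x.1.2) (q ^+ y.2) (q ^+ y.1.2) qx qy e.
move=> u v w v' w' w0 w'0 e.
have -> : par x.1.1 * (u * (v * w')) = u * (par x.1.1 * (v / w)) * w * w'.
  by field.
by rewrite e; field.
Qed.

Lemma pow_cancel (c c' : 'I_(p * d)) (u v : nat) : (u < n)%N -> (v < n)%N ->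
  par c * q ^+ u = par c' * q ^+ v -> c = c' /\ u = v.
Proof.
wlog uv : c c' u v / (v <= u)%N => [wl un vn e|un vn e].
  case: (leqP v u) => [|/ltnW] vu; first exact: wl.
  by have [-> ->] := wl _ _ _ _ vu vn un (esym e).
have e' : par c * q ^+ (u - v) = par c'.
  apply: (mulIf (expf_neq0 v q0)).
  by rewrite -mulrA -exprD subnK.
case: (eqVneq c c') => [cc|cc]; last first.
  by have := par_sep cc (leq_ltn_trans (leq_subr v u) un); rewrite e' eqxx.
split=> //; move: e'; rewrite -cc => /eqP; rewrite -[X in _ == X]mulr1.
rewrite (inj_eq (mulfI (par0 c))) => /eqP e'.
case: (ltngtP u v) uv => // vu _.
have := @q_pow (u - v)%N; rewrite subn_gt0 vu (leq_trans (leq_subr _ _) (ltnW un)).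
by rewrite e' eqxx => /(_ isT).
Qed.

Lemma node_res_inj lam x y : is_mpart lam -> x \in diagram lam ->
  y \in diagram lam -> nres x = nres y -> same_diag x y.
Proof.
move=> hl xl yl e; have [xy _] := diagram_corner pd0 n0 hl xl yl.
have [yx _] := diagram_corner pd0 n0 hl yl xl.
have := @node_res_cross x y 0; rewrite mul1r => /(_ e).
by case/(pow_cancel xy yx) => s c; rewrite /same_diag s c !eqxx.
Qed.

Lemma node_res_shift lam x y : is_mpart lam -> x \in diagram lam ->
  y \in diagram lam -> x.1.1 != y.1.1 -> q * nres x != nres y.
Proof.
move=> hl xl yl s; have [_ /(_ s) xy] := diagram_corner pd0 n0 hl xl yl.
have [yx _] := diagram_corner pd0 n0 hl yl xl.
apply/eqP=> e; have := @node_res_cross x y 1; rewrite expr1 => /(_ e).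
by case/(pow_cancel xy yx) => s' _; rewrite s' eqxx in s.
Qed.

Lemma node_res_par lam x (s : 'I_(p * d)) : is_mpart lam -> x \in diagram lam ->
  x.1.1 != s -> nres x != par s.
Proof.
move=> hl xl xs; have [xx _] := diagram_corner pd0 n0 hl xl xl.
apply/eqP; rewrite node_resE => e.
have e' : par x.1.1 * q ^+ x.2 = par s * q ^+ x.1.2.
  by rewrite -e -!mulrA mulVf ?mulr1 // expf_neq0.
have [||s' _] := pow_cancel _ _ e'; [lia|lia|].
by rewrite s' eqxx in xs.
Qed.

Lemma res_Std lam t k : t \in Std lam -> res eps q Q t k = nres (pos t k).
Proof.
move=> tS; rewrite /res; have := Std_pos pd0 n0 tS k; rewrite posE.
by case: pickP => //= no /eqP; rewrite no.
Qed.

Lemma nres_next_row x y : x.1 = y.1 -> y.2 = x.2.+1 :> nat -> nres y = q * nres x.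
Proof. by move=> r c; rewrite !node_resE -r c exprS; ring. Qed.

Lemma nres_next_col x y : x.1.1 = y.1.1 -> x.2 = y.2 -> y.1.2 = x.1.2.+1 :> nat ->
  nres x = q * nres y.
Proof.
move=> s c r; rewrite !node_resE -s c r exprS.
have h := expf_neq0 x.1.2 q0; by field; rewrite q0 h.
Qed.

Lemma res_consecutive lam t (i j : 'I_n) : is_mpart lam -> t \in Std lam ->
  (j < i)%N -> (i <= j.+2)%N -> nres (pos t j) != nres (pos t i).
Proof.
move=> hl tS ji ij2; apply/eqP=> /(node_res_inj hl) sd.
have := pos_not_diag pd0 n0 hl tS ji ij2.
by rewrite sd ?(pos_diagram _ _ tS).
Qed.

(** At the first entry whose positions differ, the two positions lie on the same
    diagonal. The upper one is then filled in the other tableau by a smaller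
    entry, where the positions agree: a contradiction. *)
Lemma res_inj lam t u : is_mpart lam -> t \in Std lam -> u \in Std lam ->
  (forall k, res eps q Q t k = res eps q Q u k) -> t = u.
Proof.
move=> hl tS uS e.
have epos k : pos t k = pos u k.
  have [m] := ubnP (k : nat); elim: m k => // m IHm k km.
  have Al := pos_diagram pd0 n0 tS k; have Bl := pos_diagram pd0 n0 uS k.
  have sd : same_diag (pos t k) (pos u k).
    by apply: (node_res_inj hl); rewrite // -!(res_Std _ tS, res_Std _ uS).
  apply/eqP/negPn/negP=> ne.
  have [le|lt] := leqP (pos t k).1.2 (pos u k).1.2.
    have lt : (ent u (pos t k) < k)%N.
      rewrite -{2}(ent_pos pd0 n0 uS k).
      case/andP: sd => /eqP s /eqP c; apply: (Std_le n0 hl uS) => //; lia.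
    have := IHm _ (leq_trans lt km); rewrite (pos_ent pd0 n0 uS) //.
    by move/(pos_inj tS) => ek; rewrite ek ltnn in lt.
  have lt' : (ent t (pos u k) < k)%N.
    rewrite -{2}(ent_pos pd0 n0 tS k).
    case/andP: sd => /eqP s /eqP c; apply: (Std_le n0 hl tS) => //; try lia.
    by rewrite eq_sym.
  have := IHm _ (leq_trans lt' km); rewrite (pos_ent pd0 n0 tS) //.
  by move/esym/(pos_inj uS) => ek; rewrite ek ltnn in lt'.
apply/ffunP=> x; case xl: (x \in diagram lam).
  rewrite (Std_ent n0 tS xl) -[in RHS](pos_ent pd0 n0 tS xl) epos.
  by rewrite (Std_pos _ _ uS).
have := Std_diagram tS x; have := Std_diagram uS x; rewrite xl.
by case: (t x); case: (u x).
Qed.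

Lemma pos_first lam t (k : 'I_n) : is_mpart lam -> t \in Std lam -> k = 0%N :> nat ->
  (pos t k).1.2 = 0%N :> nat /\ (pos t k).2 = 0%N :> nat.
Proof.
move=> hl tS k0; have xl := pos_diagram pd0 n0 tS k.
have ex := ent_pos pd0 n0 tS k.
case: (pos t k) xl ex => -[s a] b xl ex /=.
pose o := Ordinal n0; case: (eqVneq (s, o, o) (s, a, b)) => [[<- <-] //|ne].
have zl : (s, o, o) \in diagram lam by apply: (diagram_closed hl xl).
by have := Std_le n0 hl tS zl xl erefl (leq0n _) (leq0n _) ne; rewrite ex k0.
Qed.

Section SeminormalModule.
Variable lam : mpart.
Hypothesis hl : is_mpart lam.

Local Notation StdT := {t : tableau | t \in Std lam}.
Definition init_tab : StdT := exist _ (tinit lam) (tinit_Std pd0 n0 hl).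

Let o : 'I_n := Ordinal n0.
Definition node_at (t : StdT) (j : nat) : node := pos (val t) (insubd o j).
(** This is [t] itself if the exchange does not give a standard tableau; the
    coefficient [swap_coef] vanishes there. *)
Definition swap_tab (i : nat) (t : StdT) : StdT :=
  insubd t (tact (val t) (sref (insubd o i))).

(** Young's seminormal form. The off-diagonal coefficient is normalized so that
    [swap_coef x y * swap_coef y x] is the weight g of the pair of residues, for
    boxes not in one line. *)
Definition diag_coef (x y : node) : K := (q - 1) * nres y / (nres y - nres x).
Definition swap_coef (x y : node) : K :=
  if same_line x y then 0 else (q * nres x - nres y) / (nres x - nres y).

Lemma node_atE (t : StdT) j : node_at t j = pos (val t) (insubd o j).
Proof. by []. Qed.

Lemma diag_coefE x y : diag_coef x y = (q - 1) * nres y / (nres y - nres x).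
Proof. by []. Qed.

Lemma swap_coef_on_line x y : same_line x y -> swap_coef x y = 0.
Proof. by rewrite /swap_coef => ->. Qed.

Lemma swap_coef_off_line x y : ~~ same_line x y ->
  swap_coef x y = (q * nres x - nres y) / (nres x - nres y).
Proof. by rewrite /swap_coef => /negPf->. Qed.

Definition seminormal_op := swap_op init_tab node_at swap_tab diag_coef swap_coef.
Definition diag_op (f : StdT -> K) := two_term init_tab f (fun=> 0) id.
Definition JM_op (k : nat) := diag_op (fun t : StdT => nres (node_at t k)).

Let vo j : (j < n)%N -> insubd o j = j :> nat.
Proof. by move=> jn; rewrite val_insubd jn. Qed.

Lemma diag_opE f g (t : StdT) : mxfun (diag_op f) g t = f t * g t.
Proof. by rewrite mxfun_two_term mul0r addr0. Qed.

Lemma node_at_inj (x y : StdT) : (forall j, (j < n)%N -> node_at x j = node_at y j) -> x = y.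
Proof.
move=> e; apply/val_inj; apply: (res_inj hl (valP x) (valP y)) => k.
rewrite (res_Std _ (valP x)) (res_Std _ (valP y)).
by have := e k (ltn_ord k); rewrite /node_at valKd => ->.
Qed.

Lemma same_lineC x y : same_line x y = same_line y x.
Proof. by rewrite /same_line (eq_sym y.1.1) (eq_sym y.1.2) (eq_sym y.2). Qed.

Lemma swap_tab_val i (t : StdT) : (0 < i < n)%N -> ~~ same_line (node_at t i.-1) (node_at t i) ->
  val (swap_tab i t) = tact (val t) (sref (insubd o i)).
Proof.
move=> /andP[i0 ni] nl.
have S : tact (val t) (sref (insubd o i)) \in Std lam.
  apply: (swap_Std (j := insubd o i.-1) (valP t) _ nl).
  have i1n : (i.-1 < n)%N := leq_ltn_trans (leq_pred i) ni.
  by rewrite !vo // prednK.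
by rewrite /swap_tab val_insubd S.
Qed.

Lemma swap_coef_line x y : swap_coef x y != 0 -> ~~ same_line x y.
Proof. by rewrite /swap_coef; case: ifP; rewrite ?eqxx. Qed.

Lemma node_at_swap_tab_nl i (t : StdT) : (0 < i < n)%N -> ~~ same_line (node_at t i.-1) (node_at t i) ->
  forall j, (j < n)%N -> node_at (swap_tab i t) j = node_at t (swapn i j).
Proof.
move=> hi nl j nj; rewrite /node_at swap_tab_val // (pos_tact_sref _ _ (valP t)).
case/andP: hi => i0 ni; congr pos; apply/val_inj; rewrite /= val_sref ?vo //.
by rewrite swapn_lt ?i0.
Qed.

Lemma node_at_swap_tab i (t : StdT) : (0 < i < n)%N -> swap_coef (node_at t i.-1) (node_at t i) != 0 ->
  forall j, (j < n)%N -> node_at (swap_tab i t) j = node_at t (swapn i j).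
Proof. by move=> hi /swap_coef_line; apply: node_at_swap_tab_nl. Qed.

Lemma node_at_res_neq (t : StdT) (i j : nat) : (j < i)%N -> (i <= j.+2)%N -> (i < n)%N ->
  nres (node_at t j) != nres (node_at t i).
Proof.
move=> ji ij2 ni; apply: (res_consecutive hl (valP t)); rewrite !vo //.
  exact: ltn_trans ni.
exact: ltn_trans ni.
Qed.

Lemma node_at_line (t : StdT) i : (0 < i < n)%N -> same_line (node_at t i.-1) (node_at t i) ->
  nres (node_at t i) = q * nres (node_at t i.-1) \/ nres (node_at t i.-1) = q * nres (node_at t i).
Proof.
move=> /andP[i0 ni] /andP[/eqP s line]; set A := node_at t i.-1; set B := node_at t i.
have i1n : (i.-1 < n)%N := leq_ltn_trans (leq_pred i) ni.
have ij : insubd o i = (insubd o i.-1).+1 :> nat by rewrite !vo // prednK.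
case/orP: line => /eqP e; [left|right].
  have AB : A.1 = B.1 by case: (A.1) (B.1) s e => [? ?] [? ?] /= -> ->.
  apply: nres_next_row => //; exact: (pos_next_row (pd0 := pd0) (n0 := n0) hl (valP t) ij AB).
apply: nres_next_col => //; exact: (pos_next_col (pd0 := pd0) (n0 := n0) hl (valP t) ij s e).
Qed.

Lemma seminormal_quad i (t : StdT) : (0 < i < n)%N ->
  let A := node_at t i.-1 in let B := node_at t i in
  diag_coef A B ^+ 2 + swap_coef A B * swap_coef B A = (q - 1) * diag_coef A B + q /\
  swap_coef A B * (diag_coef A B + diag_coef B A - (q - 1)) = 0.
Proof.
move=> hi A B; have AB : nres B - nres A != 0.
  by rewrite subr_eq0 eq_sym node_at_res_neq //; lia.
have BA : nres A - nres B != 0 by rewrite -opprB oppr_eq0.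
rewrite /swap_coef (same_lineC B A); case: ifP => line; last first.
  rewrite /diag_coef; split; first by field; rewrite AB BA.
  by field; rewrite AB BA.
rewrite !mul0r addr0; split=> //.
have A0 := node_res_neq0 A; have B0 := node_res_neq0 B.
have [e|e] := node_at_line hi line; rewrite -/A -/B in e; rewrite /diag_coef.
  have -> : (q - 1) * nres B / (nres B - nres A) = q.
    by apply: (mulIf AB); rewrite divfK // e; ring.
  by ring.
have -> : (q - 1) * nres B / (nres B - nres A) = -1.
  by apply: (mulIf AB); rewrite divfK // e; ring.
by ring.
Qed.

Lemma seminormal_braid i (t : StdT) : (0 < i)%N -> (i.+1 < n)%N ->
  let A := node_at t i.-1 in let B := node_at t i in let C := node_at t i.+1 in
  [/\ swap_coef A B * (diag_coef A B * diag_coef B C + diag_coef A C * diag_coef B A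
        - diag_coef B C * diag_coef A C) = 0,
      swap_coef B C * (diag_coef A B * diag_coef B C + diag_coef A C * diag_coef C B
        - diag_coef A B * diag_coef A C) = 0 &
      diag_coef A B ^+ 2 * diag_coef B C + swap_coef A B * swap_coef B A * diag_coef A C
      = diag_coef B C ^+ 2 * diag_coef A B + swap_coef B C * swap_coef C B * diag_coef A C].
Proof.
move=> i0 ni A B C.
have hi : (0 < i < n)%N by lia.
have [Q1 _] := seminormal_quad t hi; rewrite -/A -/B in Q1.
have [Q2 _] := @seminormal_quad i.+1 t ni; rewrite -/C in Q2.
have AB : nres A != nres B by apply: node_at_res_neq; lia.
have BC : nres B != nres C by apply: node_at_res_neq; lia.
have AC : nres A != nres C by apply: node_at_res_neq; lia.
have E1 : swap_coef A B * swap_coef B A = (q - 1) * diag_coef A B + q - diag_coef A B ^+ 2.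
  by rewrite -Q1; ring.
have E2 : swap_coef B C * swap_coef C B = (q - 1) * diag_coef B C + q - diag_coef B C ^+ 2.
  by rewrite -Q2; ring.
have h1 : nres B - nres A != 0 by rewrite subr_eq0 eq_sym.
have h2 : nres C - nres B != 0 by rewrite subr_eq0 eq_sym.
have h3 : nres C - nres A != 0 by rewrite subr_eq0 eq_sym.
have h4 : nres A - nres B != 0 by rewrite subr_eq0.
have h5 : nres B - nres C != 0 by rewrite subr_eq0.
have h6 : nres A - nres C != 0 by rewrite subr_eq0.
have I1 : diag_coef A B * diag_coef B C + diag_coef A C * diag_coef B A
    - diag_coef B C * diag_coef A C = 0.
  by rewrite /diag_coef; field; rewrite h1 h2 h3 h4.
have I2 : diag_coef A B * diag_coef B C + diag_coef A C * diag_coef C B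
    - diag_coef A B * diag_coef A C = 0.
  by rewrite /diag_coef; field; rewrite h1 h2 h3 h5.
rewrite I1 I2 !mulr0 E1 E2; split=> //.
by rewrite /diag_coef; field; rewrite h1 h2 h3.
Qed.

(** By the recursion for the Jucys-Murphy elements, each of them acts diagonally
    by the residues of one entry. *)
Lemma seminormal_op_JM i : (0 < i < n)%N ->
  seminormal_op i * JM_op i.-1 * seminormal_op i = q *: JM_op i.
Proof.
move=> hi; apply: (@mxfun_inj _ _ init_tab) => g x; rewrite !(mxfunM init_tab) mxfunZ.
rewrite swap_opE.
have jm k h (y : StdT) : mxfun (JM_op k) h y = nres (node_at y k) * h y by apply: diag_opE.
rewrite !jm; set A := node_at x i.-1; set B := node_at x i.
have hi' : (i.-1 < n)%N /\ (i < n)%N by lia.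
have st := swap_step init_tab diag_coef node_at_swap_tab x g 1 hi hi.
have bk := swap_back node_at_inj node_at_swap_tab x g 1 hi.
rewrite swapn_pred swapn_same in st; last by case/andP: hi.
rewrite !mul1r -/A -/B in st bk.
have -> : swap_coef A B * (nres (node_at (swap_tab i x) i.-1) * mxfun (seminormal_op i) g (swap_tab i x))
    = nres B * (swap_coef A B * mxfun (seminormal_op i) g (swap_tab i x)).
  case: (eqVneq (swap_coef A B) 0) => [->|nz]; first by rewrite !mul0r mulr0.
  by rewrite (node_at_swap_tab hi nz) ?swapn_pred -/B; [ring | case: hi'].
rewrite st swap_opE -/A -/B mulrDr (mulrDr (swap_coef A B)) bk.
have [Q1 _] := seminormal_quad x hi; rewrite -/A -/B in Q1.
have AB : nres B - nres A != 0.
  by rewrite subr_eq0 eq_sym node_at_res_neq //; lia.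
have BA : nres A - nres B != 0 by rewrite -opprB oppr_eq0.
have cross : diag_coef A B * nres A + nres B * diag_coef B A = 0.
  by rewrite /diag_coef; field; rewrite AB BA.
have dia : diag_coef A B ^+ 2 * nres A + nres B * (swap_coef A B * swap_coef B A) = q * nres B.
  have -> : swap_coef A B * swap_coef B A = (q - 1) * diag_coef A B + q - diag_coef A B ^+ 2.
    by rewrite -Q1; ring.
  by rewrite /diag_coef; field; rewrite AB.
transitivity ((diag_coef A B ^+ 2 * nres A + nres B * (swap_coef A B * swap_coef B A)) * g x
  + swap_coef A B * (diag_coef A B * nres A + nres B * diag_coef B A) * g (swap_tab i x)).
  by ring.
by rewrite cross dia; ring.
Qed.

End SeminormalModule.
End Residues.

(** * Matrix entries at an eigenvector *)

Section DiagonalMatrices.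
Variables (K : fieldType) (X : finType) (x0 : X).
Local Notation N := #|X|.-1.
Implicit Types (M : 'M[K]_N.+1) (f : X -> K).

Definition acts_diag M f := forall g x, mxfun M g x = f x * g x.

Lemma acts_diag_prod I (r : seq I) (P : pred I) (M : I -> 'M[K]_N.+1) (f : I -> X -> K) :
  (forall i, P i -> acts_diag (M i) (f i)) ->
  acts_diag (\prod_(i <- r | P i) M i) (fun x => \prod_(i <- r | P i) f i x).
Proof.
move=> Mf; elim: r => [|i r IHr] g x; first by rewrite !big_nil (mxfun1 x0) mul1r.
rewrite !big_cons; case: ifP => Pi; last exact: IHr.
by rewrite (mxfunM x0) Mf // IHr mulrA.
Qed.

(** The row and the column of [x] in [M] are both c times a unit vector. *)
Definition eigen_at (x : X) M (c : K) :=
  (forall g, mxfun M g x = c * g x) /\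
  (forall y, mxfun M (fun z => (z == x)%:R) y = c * (y == x)%:R).

Lemma eigen_at1 x : eigen_at x 1 1.
Proof. by split=> [g|y]; rewrite (mxfun1 x0) mul1r. Qed.

Lemma eigen_atM x M M' c c' : eigen_at x M c -> eigen_at x M' c' ->
  eigen_at x (M * M') (c * c').
Proof.
move=> [r l] [r' l']; split=> [g|y]; rewrite (mxfunM x0); first by rewrite r r' mulrA.
by rewrite (mxfun_ext _ l') mxfun_scaler l; ring.
Qed.

Lemma eigen_at_prod x I (s : seq I) (P : pred I) (M : I -> 'M[K]_N.+1) (c : I -> K) :
  (forall i, P i -> eigen_at x (M i) (c i)) ->
  eigen_at x (\prod_(i <- s | P i) M i) (\prod_(i <- s | P i) c i).
Proof.
by move=> e; apply: (big_rec2 (eigen_at x)) => [|i c' M' /e]; [exact: eigen_at1|exact: eigen_atM].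
Qed.

Lemma eigen_at_sum x I (s : seq I) (P : pred I) (M : I -> 'M[K]_N.+1) (c : I -> K) :
  (forall i, P i -> eigen_at x (M i) (c i)) ->
  eigen_at x (\sum_(i <- s | P i) M i) (\sum_(i <- s | P i) c i).
Proof.
move=> e; split=> [g|y]; rewrite mxfun_sum big_distrl; apply: eq_bigr => i /e[r l].
  exact: r.
exact: l.
Qed.

Lemma eigen_at_diag x M f : acts_diag M f -> eigen_at x M (f x).
Proof.
move=> Mf; split=> [g|y]; rewrite Mf //.
by case: (eqVneq y x) => [->|_] //; rewrite !mulr0.
Qed.

(** Instantiated below to f_(tau, v) f_(v, tau) = gamma_v f_(tau, tau), read at
    the entry (tau, tau): x is tau, y is v, F1 and F2 are the projections to x and
    y, and M is the image of m_lambda. *)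
Lemma matrix_unit_relation (F1 F2 M W W' : 'M[K]_N.+1) (x y : X) (c g : K) :
  acts_diag F1 (fun z => (z == x)%:R) -> acts_diag F2 (fun z => (z == y)%:R) ->
  eigen_at x M c -> c != 0 ->
  F1 * M * W * F2 * (F2 * W' * M * F1) = g *: (F1 * M * F1) ->
  g = c * (mxfun W (fun z => (z == y)%:R) x * mxfun W' (fun z => (z == x)%:R) y).
Proof.
move=> F1E F2E [mr mc] c0 /(congr1 (fun h => mxfun h (fun t => (t == x)%:R) x)).
set dx := fun t => (t == x)%:R.
have F1d t : mxfun F1 dx t = dx t.
  by rewrite F1E /dx; case: eqP => _; rewrite ?mulr1 ?mulr0.
have hE t : mxfun W' (mxfun M (mxfun F1 dx)) t = c * mxfun W' dx t.
  rewrite -mxfun_scaler; apply: mxfun_ext => u.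
  by rewrite -mc; apply: mxfun_ext.
have F2d t : mxfun F2 (mxfun (F2 * W' * M * F1) dx) t
    = c * mxfun W' dx y * (t == y)%:R.
  by rewrite F2E !(mxfunM x0) F2E hE; case: (eqVneq t y) => [->|_]; rewrite ?mulr1n ?mulr0n; ring.
rewrite mxfunZ !(mxfunM x0) F1E mr (mxfun_ext _ F2d) mxfun_scaler.
rewrite F1E mr F1d.
have -> : dx x = 1 by rewrite /dx eqxx.
rewrite eqxx !mul1r mulr1 => e.
by apply: (mulIf c0); rewrite -e; ring.
Qed.

End DiagonalMatrices.

(** * Words in the generators and sizes of blocks *)

Section ReducedWords.
Variables (n : nat).

Lemma reduced_rcons (s : seq 'I_n) (i : 'I_n) :
  size (rcons s i) = len (\prod_(k <- rcons s i) sref k)%g ->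
  let w := (\prod_(k <- rcons s i) sref k)%g in
  [/\ exists2 j : 'I_n, i = j.+1 :> nat & (w^-1%g i < w^-1%g j)%N,
      (\prod_(k <- s) sref k)%g = (w * sref i)%g &
      size s = len (\prod_(k <- s) sref k)%g].
Proof.
rewrite size_rcons -cats1 big_cat big_seq1 /=; set v := (\prod_(k <- s) _)%g => ls.
have lv : (len v <= size s)%N := len_prod_le s.
have vE : v = ((v * sref i) * sref i)%g by rewrite -mulgA srefK mulg1.
have i0 : (0 < i)%N.
  by rewrite lt0n; apply/eqP=> i0; move: ls; rewrite sref0 // mulg1; lia.
have [j ij] := pred_ordP i0.
have := len_srefR_le i v; rewrite -ls ltnS => lv'.
split=> //; last by apply/eqP; rewrite eqn_leq lv lv'.
exists j => //; case: (ltngtP ((v * sref i)^-1%g i) ((v * sref i)^-1%g j)) => // [lt|eq].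
  by have := len_srefR ij lt; rewrite -vE -ls; lia.
by have /perm_inj e := val_inj eq; move/eqP: ij; rewrite e eqn_leq ltnn andbF.
Qed.

(** A reduced word of an element of a Young subgroup uses generators of this
    subgroup only, because each of its prefixes stays in the subgroup. *)
Lemma reduced_block (be : 'I_n -> nat) (s : seq 'I_n) :
  (forall i j : 'I_n, (i <= j)%N -> (be i <= be j)%N) ->
  size s = len (\prod_(k <- s) sref k)%g -> (\prod_(k <- s) sref k)%g \in block_stab be ->
  forall i, i \in s -> exists2 j : 'I_n, i = j.+1 :> nat & be i = be j.
Proof.
move=> be_mono; elim/last_ind: s => // s i IHs ls.
have [[j ij lt] sE ls'] := reduced_rcons ls.
set w := (\prod_(k <- rcons s i) _)%g in lt sE *; move=> wG.
have wVG : (w^-1)%g \in block_stab be by rewrite (@groupV _ (block_stab_groupType be)).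
have bij := block_descent be_mono wVG ij lt.
have sG := sref_block ij bij.
move=> k; rewrite mem_rcons inE => /orP[/eqP->|ks]; first by exists j.
by apply: IHs => //; rewrite sE (groupM (G := block_stab_groupType be)).
Qed.

Lemma Tperm_word (K : fieldType) (A : algType K) (T : nat -> A) (w : 'S_n) :
  exists s : seq 'I_n, [/\ size s = len w, (\prod_(k <- s) sref k)%g = w &
    Tperm T w = \prod_(k <- s) T k].
Proof.
rewrite /Tperm; case: pickP => [s /eqP sw|no].
  by exists s; rewrite size_tuple.
have [s [ss sw]] := reduced_word w.
have sz : size s == len w by rewrite ss.
by have := no (Tuple sz); rewrite /= sw eqxx.
Qed.

Lemma star_word (K : fieldType) (A : algType K) (T : nat -> A) (star : A -> A)
    (s : seq 'I_n) : is_star n T star ->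
  star (\prod_(k <- s) T k) = \prod_(k <- rev s) T k.
Proof.
case=> _ _ star1 starM starT; elim: s => [|i s IHs]; first by rewrite !big_nil.
by rewrite big_cons starM IHs starT // rev_cons -cats1 big_cat big_seq1.
Qed.

End ReducedWords.

Section Presize.
Variables (p d n : nat).
Hypothesis n0 : (0 < n)%N.
Variable lam : mpart p d n.
Hypothesis hl : is_mpart lam.

Lemma presizeE s : presize lam s = #|[set x in diagram lam | (x.1.1 < s)%N]|.
Proof.
rewrite -sum1dep_card /presize.
rewrite (eq_bigl (fun x : node p d n => (x.1.1 < s)%N && (x.2 < lam x.1.1 x.1.2)%N));
  last by move=> x; rewrite inE andbC.
rewrite -(pair_big_dep (fun sa : 'I_(p * d) * 'I_n => (sa.1 < s)%N)
  (fun sa (c : 'I_n) => (c < lam sa.1 sa.2)%N) (fun _ _ => 1%N)) /=.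
rewrite (eq_bigl (fun sa : 'I_(p * d) * 'I_n => (sa.1 < s)%N && true));
  last by move=> sa; rewrite andbT.
rewrite -(pair_big_dep (fun j : 'I_(p * d) => (j < s)%N) (fun _ _ => true)
  (fun j a => \sum_(c < n | (c < lam j a)%N) 1)%N) /=.
apply: eq_bigr => j _; apply: eq_bigr => a _.
by rewrite sum1dep_card card_ord_lt // -ltnS.
Qed.

Lemma presize_le s : (presize lam s <= n)%N.
Proof.
rewrite presizeE -[X in (_ <= X)%N](card_diagram hl); apply: subset_leq_card.
by apply/subsetP=> x; rewrite inE => /andP[].
Qed.

Lemma ent_tinit_presize s x : x \in diagram lam ->
  (ent n0 (tinit lam) x < presize lam s)%N = (x.1.1 < s)%N.
Proof.
move=> xl; rewrite ent_tinit // presizeE; apply/idP/idP.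
  apply: contraTT; rewrite -!leqNgt => sx; apply: subset_leq_card.
  apply/subsetP=> y; rewrite !inE => /andP[-> ys] /=.
  by rewrite /before (leq_trans ys sx).
move=> xs; apply: proper_card; apply/properP; split.
  apply/subsetP=> y; rewrite !inE => /andP[-> /=].
  rewrite /before => /or3P[lt|/andP[/eqP-> _]|/and3P[/eqP-> _ _]] //.
  exact: ltn_trans xs.
by exists x; rewrite ?inE ?before_irr ?andbF //= xs andbT; rewrite inE in xl.
Qed.

End Presize.

(** * The seminormal representation and the closed form of gamma *)

Section InversionWeight.
Variables (p d n : nat) (K : fieldType) (eps q : K) (Q : d.-tuple K).
Hypothesis n0 : (0 < n)%N.

Definition swap_weight (x y : node p d n) : K :=
  (q * node_res eps q Q x - node_res eps q Q y)
  * (node_res eps q Q x - q * node_res eps q Q y)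
  / (node_res eps q Q x - node_res eps q Q y) ^+ 2.

Definition inverted (lam : mpart p d n) (t : tableau p d n)
    (xy : node p d n * node p d n) : bool :=
  [&& xy.1 \in diagram lam, xy.2 \in diagram lam, before xy.1 xy.2
    & (ent n0 t xy.2 < ent n0 t xy.1)%N].

(** The product over the inverted pairs of boxes that gives the dependence of
    gamma on the tableau. *)
Definition inv_weight (lam : mpart p d n) (t : tableau p d n) : K :=
  \prod_(xy | inverted lam t xy) swap_weight xy.1 xy.2.

End InversionWeight.

Section GammaFormula.
Variables (p d n : nat) (K : fieldType) (eps q : K) (Q : d.-tuple K).
Variables (H : algType K) (T : nat -> H).
Hypothesis hn : (2 <= n)%N.
Hypothesis hd : (1 <= d)%N.
Hypothesis heps : p.-primitive_root eps.
Hypothesis hQ : forall c : 'I_d, tnth Q c != 0.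
Hypothesis q0 : q != 0.
Hypothesis q1 : q != 1.
Hypothesis hH : is_hecke_algebra p n q Q T.
Hypothesis hss : semisimple H.
Variable star : H -> H.
Hypothesis hstar : is_star n T star.
Variable gam : tableau p d n -> K.
Hypothesis hgam : is_gamma eps q Q T star gam.

Hypothesis pd0 : (0 < p * d)%N.
Hypothesis n0 : (0 < n)%N.

Local Notation mpart := (mpart p d n).
Local Notation node := (node p d n).
Local Notation tableau := (tableau p d n).
Local Notation par := (cyc_param eps Q).
Local Notation nres := (@node_res p d n K eps q Q).
Local Notation pos := (pos pd0 n0).
Local Notation ent := (ent n0).

Let par0 s : par s != 0. Proof. exact: (cyc_param_neq0 heps hQ). Qed.
Let par_sep (c c' : 'I_(p * d)) (j : nat) :
  c != c' -> (j < n)%N -> par c * q ^+ j != par c'.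
Proof. exact: (parameters_separated hn hd heps hQ q0 hH hss). Qed.
Let poincare : \sum_(w : 'S_n) q ^+ len w != 0.
Proof. exact: (poincare_neq0 hn hd heps hQ q0 hH hss). Qed.
Let q_pow k : (0 < k <= n)%N -> q ^+ k != 1.
Proof. exact: (pow_neq1 q1 poincare). Qed.

Variable lam : mpart.
Hypothesis hl : is_mpart lam.

Local Notation StdT := {t : tableau | t \in Std lam}.
Local Notation tau := (init_tab pd0 n0 hl).
Local Notation node_at := (node_at pd0 n0).
Local Notation Top := (seminormal_op eps q Q pd0 n0 hl).
Local Notation JMo := (JM_op eps q Q pd0 n0 hl).
Local Notation diag_coef := (diag_coef eps q Q).
Local Notation swap_coef := (swap_coef eps q Q).
Implicit Types (t v : StdT).

Let o : 'I_n := Ordinal n0.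
Let vo j : (j < n)%N -> insubd o j = j :> nat.
Proof. by move=> jn; rewrite val_insubd jn. Qed.

Let lab_inj := @node_at_inj p d n K eps q Q pd0 n0 q0 par0 par_sep q_pow lam hl.
Let lab_s := @node_at_swap_tab p d n K eps q Q pd0 n0 lam.
Let quad i t (hi : (0 < i < n)%N) := seminormal_quad pd0 n0 q0 par0 par_sep q_pow hl t hi.
Let braid i t (i0 : (0 < i)%N) (ni : (i.+1 < n)%N) :=
  seminormal_braid pd0 n0 q0 par0 par_sep q_pow hl t i0 ni.
Let opJM i (hi : (0 < i < n)%N) := seminormal_op_JM pd0 n0 q0 par0 par_sep q_pow hl hi.

Let JME k : acts_diag (JMo k) (fun t => nres (node_at t k)).
Proof. by move=> g t; apply: diag_opE. Qed.

Let TopE k g t : mxfun (Top k) g t =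
  diag_coef (node_at t k.-1) (node_at t k) * g t
  + swap_coef (node_at t k.-1) (node_at t k) * g (swap_tab n0 k t).
Proof. exact: swap_opE. Qed.

Lemma seminormal_rep : exists phi : {lrmorphism H -> 'M[K]_(#|{: StdT}|.-1.+1)},
  forall i, (i < n)%N -> phi (T i) = if i is 0 then JMo 0 else Top i.
Proof.
pose T' i := if i is 0 then JMo 0 else Top i.
have [_ univ] := hH.
have comm01 : JMo 0 * JMo 1 = JMo 1 * JMo 0.
  by apply: (@mxfun_inj _ _ tau) => g t; rewrite !(mxfunM tau) !JME; ring.
suff rel : hecke_relations p n q Q T'.
  by have [phi [phiT _]] := univ _ T' rel; exists phi => i ni; rewrite phiT.
have T'S i : (0 < i)%N -> T' i = Top i by case: i.
have T'0 : T' 0%N = JMo 0 by [].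
clearbody T'; split.
- rewrite T'0 (cyclotomic_prodE heps hQ _ hd); apply: (@mxfun_inj _ _ tau) => g t.
  have Mf (s : 'I_(p * d)) : xpredT s -> acts_diag (JMo 0 - (par s)%:A)
      (fun t => nres (node_at t 0) - par s).
    by move=> _ h u; rewrite mxfunB (mxfunA tau) JME mulrBl.
  have [r0 c0] := pos_first pd0 n0 hl (valP t) (vo n0 : insubd o 0%N = 0%N :> nat).
  rewrite (acts_diag_prod tau _ Mf) mxfun0 (bigD1 (node_at t 0).1.1) //=.
  by rewrite {1}(node_resE _ _ q0) r0 c0 !expr0 divr1 mulr1 subrr !mul0r.
- rewrite T'0 (T'S 1%N isT).
  have E : Top 1 * JMo 0 * Top 1 = q *: JMo 1 := opJM (hn : (0 < 1 < n)%N).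
  move: (JMo 0) (JMo 1) (Top 1) E comm01 => J0 J1 S E comm01.
  by rewrite -(mulrA J0 S) -(mulrA J0 (S * J0)) E -scalerAr comm01 scalerAl -E.
- move=> i hi; rewrite T'S; last by case/andP: hi.
  exact: (swap_op_quadratic tau lab_inj lab_s quad).
- move=> i k ij; rewrite (T'S k); last by case/andP: ij; case: (k).
  case: i ij => [|i] ij; last first.
    rewrite (T'S i.+1 isT); exact: (swap_op_comm tau diag_coef lab_inj lab_s).
  rewrite T'0; have JE := JME 0; have SE := TopE k.
  move: (JMo 0) (Top k) JE SE => J S JE SE.
  apply: (@mxfun_inj _ _ tau) => g t; rewrite !(mxfunM tau) !(JE, SE).
  have hk : (0 < k < n)%N by case/andP: ij => k1 ->; rewrite andbT; apply: ltnW.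
  rewrite mulrDr; congr (_ + _); first by ring.
  case: (eqVneq (swap_coef (node_at t k.-1) (node_at t k)) 0) => [->|nz]; first by ring.
  rewrite (lab_s hk nz n0) swapn_far; [by ring | by case/andP: ij => ->].
- move=> i i0 ni; rewrite (T'S i i0) (T'S i.+1 isT).
  exact: (swap_op_braid tau lab_inj lab_s braid).
Qed.

Section Representation.
Variable phi : {lrmorphism H -> 'M[K]_(#|{: StdT}|.-1.+1)}.
Hypothesis phiT : forall i, (i < n)%N -> phi (T i) = if i is 0 then JMo 0 else Top i.

Lemma phi_JM k : (k < n)%N -> phi (JM q T k) = JMo k.
Proof.
elim: k => [|k IHk] kn; first by rewrite /= phiT.
have E := opJM (kn : (0 < k.+1 < n)%N); rewrite [k.+1.-1]/= in E.
rewrite [JM _ _ _]/= linearZ /= !rmorphM /= phiT // IHk ?(ltnW kn) // E.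
by rewrite scalerA mulVf // scale1r.
Qed.

Lemma phi_JM_sub k c : (k < n)%N ->
  acts_diag (phi (JM q T k - c%:A)) (fun t => nres (node_at t k) - c).
Proof.
move=> kn g t; rewrite rmorphB /= phi_JM // mxfunB JME mulrBl; congr (_ - _).
have -> : phi c%:A = c%:A by rewrite -[RHS](rmorph_alg phi).
by rewrite (mxfunA tau).
Qed.

(** A tableau other than [v] has a different residue at some entry, where a factor
    of F_v vanishes. *)
Lemma phi_Felt v : acts_diag (phi (Felt eps q Q T (val v))) (fun t => (t == v)%:R).
Proof.
have E : acts_diag (phi (Felt eps q Q T (val v)))
    (fun t => \prod_(k < n) \prod_(c <- res_set p eps q Q k | c != res eps q Q (val v) k)
       ((res eps q Q (val v) k - c)^-1 * (nres (node_at t k) - c))).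
  rewrite /Felt rmorph_prod; apply: (acts_diag_prod tau) => k _.
  rewrite rmorph_prod; apply: (acts_diag_prod tau) => c _ g t /=.
  by rewrite linearZ /= mxfunZ phi_JM_sub // mulrA.
have node_atE t (k : 'I_n) : nres (node_at t k) = res eps q Q (val t) k.
  by rewrite (res_Std _ _ _ pd0 n0 _ (valP t)) node_atE valKd.
move=> g t; rewrite E; congr (_ * _); case: (eqVneq t v) => [->|tv].
  rewrite big1 // => k _; rewrite big1 // => c ck; rewrite node_atE mulVf //.
  by rewrite subr_eq0 eq_sym.
have [k kr] : exists k, res eps q Q (val t) k != res eps q Q (val v) k.
  apply: not_all_not_ex => e; case/eqP: tv; apply/val_inj.
  apply: (res_inj pd0 n0 q0 par0 par_sep q_pow hl (valP t) (valP v)) => k.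
  by apply/eqP/negPn/negP/e.
rewrite (bigD1 k) //= (big_rem (res eps q Q (val t) k)) /=.
  by rewrite kr node_atE subrr mulr0 !mul0r.
rewrite mem_undup; apply/imageP; exists (val t) => //.
by apply/existsP; exists lam; rewrite hl (valP t).
Qed.

(** Adjacent entries in a row have residues x and q x, for which the diagonal
    coefficient is q. *)
Lemma phi_T_tau (i j : 'I_n) : i = j.+1 :> nat ->
  row_block pd0 n0 lam i = row_block pd0 n0 lam j -> eigen_at tau (phi (T i)) q.
Proof.
move=> ij /eqP; rewrite row_block_eq => /eqP row.
have hi : (0 < i < n)%N by rewrite ltn_ord andbT ij.
have -> : phi (T i) = Top i by rewrite phiT //; case: (nat_of_ord i) hi.
have ej : insubd o i.-1 = j by apply/val_inj; rewrite ij val_insubd /= ltn_ord.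
have A1 : node_at tau i.-1 = pos (tinit lam) j by rewrite !node_atE ej.
have B1 : node_at tau i = pos (tinit lam) i by rewrite node_atE valKd.
have line : same_line (node_at tau i.-1) (node_at tau i).
  by rewrite A1 B1 /same_line row !eqxx.
have b0 : swap_coef (node_at tau i.-1) (node_at tau i) = 0 by rewrite swap_coef_on_line.
have aq : diag_coef (node_at tau i.-1) (node_at tau i) = q.
  have : nres (node_at tau i.-1) != nres (node_at tau i).
    by apply: (node_at_res_neq pd0 n0 q0 par0 par_sep q_pow hl); rewrite ?ltn_ord // ij.
  have e : nres (node_at tau i) = q * nres (node_at tau i.-1).
    apply: nres_next_row => //; first by rewrite A1 B1 row.
    by rewrite A1 B1 (pos_next_row hl (tinit_Std pd0 n0 hl) ij (esym row)).
  rewrite eq_sym -subr_eq0 diag_coefE e => ne.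
  by apply: (mulIf ne); rewrite divfK //; ring.
have SE := TopE i; move: (Top i) SE => S SE; split=> [g|y]; rewrite SE.
  by rewrite b0 aq mul0r addr0.
case: (eqVneq y tau) => [->|yt]; first by rewrite b0 aq mul0r addr0.
rewrite mulr0 add0r; case: (eqVneq (swap_tab n0 i y) tau) => [st|]; last by rewrite !mulr0.
case: (eqVneq (swap_coef (node_at y i.-1) (node_at y i)) 0) => [->|nz]; first by rewrite mul0r mulr0.
have := swap_coef_line nz; rewrite same_lineC.
have i0 : (0 < i)%N by rewrite ij.
have il : (i.-1 < n)%N := leq_ltn_trans (leq_pred i) (ltn_ord i).
have := lab_s hi nz il; have := lab_s hi nz (ltn_ord i).
by rewrite swapn_pred swapn_same // st => <- <-; rewrite line.
Qed.

Lemma phi_Tperm_tau w : w \in row_stab lam -> eigen_at tau (phi (Tperm T w)) (q ^+ len w).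
Proof.
rewrite (row_stab_block pd0 n0 hl) => wG.
have [s [ss sw ->]] := Tperm_word T w.
have letters := reduced_block (row_block_mono pd0 n0 hl)
  (etrans ss (congr1 _ (esym sw))) (etrans (congr1 _ sw) wG).
rewrite rmorph_prod -ss -(count_predT s) -iter_mulr_1 -big_const_seq.
rewrite big_seq [X in eigen_at _ _ X]big_seq; apply: (eigen_at_prod tau) => k ks.
by have [j kj bkj] := letters k ks; apply: (phi_T_tau kj bkj).
Qed.

Definition melt_eigenvalue : K :=
  (\prod_(1 <= s < p * d | (1 <= s < p * d)%N)
     \prod_(0 <= k < presize lam s | (0 <= k < presize lam s)%N)
       (nres (node_at tau k) - par s)) * \sum_(w in row_stab lam) q ^+ len w.

(** The initial tableau is an eigenvector of the Jucys-Murphy elements and of the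
    generators of its row stabilizer. *)
Lemma phi_melt : eigen_at tau (phi (melt eps q Q T lam)) melt_eigenvalue.
Proof.
rewrite /melt /melt_eigenvalue rmorphM; apply: (eigen_atM tau).
  rewrite rmorph_prod big_nat; apply: (eigen_at_prod tau) => s _.
  rewrite rmorph_prod big_nat; apply: (eigen_at_prod tau) => k /andP[_ kp].
  have kn : (k < n)%N := leq_trans kp (presize_le hl s).
  exact: (eigen_at_diag tau (phi_JM_sub (par s) kn)).
by rewrite rmorph_sum; apply: eigen_at_sum => w; apply: phi_Tperm_tau.
Qed.

(** No box in the first s components has the parameter of component s as its
    residue, and the sum over the row stabilizer is a Poincare polynomial. *)
Lemma melt_eigenvalue_neq0 : melt_eigenvalue != 0.
Proof.
apply: mulf_neq0; last first.
  rewrite (row_stab_block pd0 n0 hl).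
  exact: (parabolic_poincare (row_block_mono pd0 n0 hl) poincare).
apply: (big_ind (fun x : K => x != 0)) => [|x y|s /andP[_ sp]]; [exact: oner_neq0|exact: mulf_neq0|].
apply: (big_ind (fun x : K => x != 0)) => [|x y|k /andP[_ kp]]; [exact: oner_neq0|exact: mulf_neq0|].
have kn : (k < n)%N by apply: leq_trans kp (presize_le hl s).
have iS := tinit_Std pd0 n0 hl.
rewrite subr_eq0; apply: (node_res_par pd0 n0 q0 par0 par_sep q_pow (s := Ordinal sp) hl).
  exact: (pos_diagram pd0 n0 iS).
have := ent_tinit_presize n0 hl s (pos_diagram pd0 n0 iS (insubd o k)).
rewrite (ent_pos pd0 n0 iS) vo // kp => /esym lt.
by rewrite -val_eqE /= neq_ltn lt.
Qed.

(** The matrix entry at (tau, v) of the product along [s], and the entry at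
    (v, tau) of the product in reverse order. *)
Definition up (s : seq 'I_n) v := mxfun (phi (\prod_(k <- s) T k)) (fun t => (t == v)%:R) tau.
Definition down (s : seq 'I_n) v :=
  mxfun (phi (\prod_(k <- rev s) T k)) (fun t => (t == tau)%:R) v.

Lemma phi_T (i : 'I_n) : (0 < i)%N -> phi (T i) = Top i.
Proof. by move=> i0; rewrite phiT //; case: (nat_of_ord i) i0. Qed.

Lemma phi_T0 (i : 'I_n) : i = 0%N :> nat -> phi (T i) = JMo 0.
Proof. by move=> i0; rewrite phiT // i0. Qed.

Lemma swap_tab_ord (i : 'I_n) v : (0 < i)%N -> ~~ same_line (node_at v i.-1) (node_at v i) ->
  val (swap_tab n0 i v) = tact (val v) (sref i).
Proof.
move=> i0 nl; have hi : (0 < i < n)%N by rewrite i0 ltn_ord.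
by rewrite (swap_tab_val hi nl) valKd.
Qed.

Lemma swap_tabK (i : 'I_n) v : (0 < i)%N -> ~~ same_line (node_at v i.-1) (node_at v i) ->
  swap_tab n0 i (swap_tab n0 i v) = v.
Proof.
move=> i0 nl; have hi : (0 < i < n)%N by rewrite i0 ltn_ord.
have il : (i.-1 < n)%N := leq_ltn_trans (leq_pred i) (ltn_ord i).
have lab1 := node_at_swap_tab_nl hi nl.
have nl' : ~~ same_line (node_at (swap_tab n0 i v) i.-1) (node_at (swap_tab n0 i v) i).
  by rewrite !lab1 // swapn_pred swapn_same // same_lineC.
by apply/val_inj; rewrite swap_tab_ord // swap_tab_ord // -tactM srefK tact1.
Qed.

Lemma node_at_swap_tab_line (i : 'I_n) v : (0 < i)%N ->
  ~~ same_line (node_at v i.-1) (node_at v i) ->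
  node_at (swap_tab n0 i v) i.-1 = node_at v i /\ node_at (swap_tab n0 i v) i = node_at v i.-1.
Proof.
move=> i0 nl; have hi : (0 < i < n)%N by rewrite i0 ltn_ord.
have il : (i.-1 < n)%N := leq_ltn_trans (leq_pred i) (ltn_ord i).
by rewrite !(node_at_swap_tab_nl hi nl) // swapn_pred swapn_same.
Qed.

Lemma Top_delta_line (i : 'I_n) v t : (0 < i)%N -> same_line (node_at v i.-1) (node_at v i) ->
  mxfun (Top i) (fun u => (u == v)%:R) t =
  diag_coef (node_at v i.-1) (node_at v i) * (t == v)%:R.
Proof.
move=> i0 l; rewrite TopE -[RHS]addr0; congr (_ + _).
  by case: (eqVneq t v) => [->|_] //; rewrite !mulr0.
case: (eqVneq (swap_coef (node_at t i.-1) (node_at t i)) 0) => [->|/swap_coef_line nl].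
  by rewrite mul0r.
case: (eqVneq (swap_tab n0 i t) v) => [tv|]; last by rewrite mulr0.
have [e1 e2] := node_at_swap_tab_line i0 nl.
by move: l; rewrite -tv e1 e2 same_lineC (negPf nl).
Qed.

Lemma Top_delta (i : 'I_n) v t : (0 < i)%N -> ~~ same_line (node_at v i.-1) (node_at v i) ->
  mxfun (Top i) (fun u => (u == v)%:R) t =
  diag_coef (node_at v i.-1) (node_at v i) * (t == v)%:R +
  swap_coef (node_at v i) (node_at v i.-1) * (t == swap_tab n0 i v)%:R.
Proof.
move=> i0 nl; rewrite TopE; congr (_ + _).
  by case: (eqVneq t v) => [->|_] //; rewrite !mulr0.
have [e1 e2] := node_at_swap_tab_line i0 nl.
case: (eqVneq t (swap_tab n0 i v)) => [->|tv]; first by rewrite swap_tabK // eqxx e1 e2.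
rewrite mulr0; case: (eqVneq (swap_coef (node_at t i.-1) (node_at t i)) 0) => [->|/swap_coef_line nlt].
  by rewrite mul0r.
case: (eqVneq (swap_tab n0 i t) v) => [tv'|]; last by rewrite mulr0.
by rewrite -tv' swap_tabK // eqxx in tv.
Qed.

Lemma dperm_swap_tab (i : 'I_n) v : (0 < i)%N -> ~~ same_line (node_at v i.-1) (node_at v i) ->
  dperm lam (val (swap_tab n0 i v)) = (dperm lam (val v) * sref i)%g.
Proof.
move=> i0 nl; apply: (dperm_eq pd0 n0 hl (valP _)).
by rewrite tactM (dpermP pd0 n0 hl (valP v)) swap_tab_ord.
Qed.

Lemma dperm_tau : dperm lam (val tau) = 1%g.
Proof. by apply: (dperm_eq pd0 n0 hl (valP _)); rewrite tact1. Qed.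

Lemma dperm_inj t v : dperm lam (val t) = dperm lam (val v) -> t = v.
Proof.
move=> e; apply/val_inj; rewrite -[LHS](dpermP pd0 n0 hl (valP t)) e.
exact: (dpermP pd0 n0 hl (valP v)).
Qed.

Lemma up_rcons s (i : 'I_n) v :
  up (rcons s i) v = mxfun (phi (\prod_(k <- s) T k))
    (mxfun (phi (T i)) (fun t => (t == v)%:R)) tau.
Proof. by rewrite /up -cats1 big_cat big_seq1 rmorphM (mxfunM tau). Qed.

Lemma down_rcons s (i : 'I_n) v :
  down (rcons s i) v = mxfun (phi (T i)) (down s) v.
Proof. by rewrite /down rev_rcons big_cons rmorphM (mxfunM tau). Qed.

Lemma mxfun_lin (M : 'M[K]_(#|{: StdT}|.-1.+1)) (a b : K) (g h : StdT -> K) t :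
  mxfun M (fun x => a * g x + b * h x) t = a * mxfun M g t + b * mxfun M h t.
Proof.
rewrite -!mxfun_scaler /mxfun -big_split; apply: eq_bigr => x _ /=; ring.
Qed.

Lemma up_rcons_nl s (i : 'I_n) v : (0 < i)%N -> ~~ same_line (node_at v i.-1) (node_at v i) ->
  up (rcons s i) v = diag_coef (node_at v i.-1) (node_at v i) * up s v
    + swap_coef (node_at v i) (node_at v i.-1) * up s (swap_tab n0 i v).
Proof.
move=> i0 nl; rewrite up_rcons phi_T // -mxfun_lin.
exact: (mxfun_ext _ (fun t => Top_delta t i0 nl)).
Qed.

Lemma down_rcons_pos s (i : 'I_n) v : (0 < i)%N ->
  down (rcons s i) v = diag_coef (node_at v i.-1) (node_at v i) * down s v
    + swap_coef (node_at v i.-1) (node_at v i) * down s (swap_tab n0 i v).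
Proof. by move=> i0; rewrite down_rcons phi_T // TopE. Qed.

(** A generator changes the length of d(t) by at most one, so that a word shorter
    than d(v) does not connect tau with v. *)
Lemma up_down_short s v : (size s < len (dperm lam (val v)))%N ->
  up s v = 0 /\ down s v = 0.
Proof.
elim/last_ind: s v => [|s i IHs] v.
  move=> lt; have ne : (v == tau) = false.
    by apply: contraTF lt => /eqP->; rewrite dperm_tau len1.
  by rewrite /up /down !big_nil rmorph1 !(mxfun1 tau) eq_sym ne.
rewrite size_rcons => lt; have [u0 d0] := IHs v (ltnW lt).
have [i0|i0] := posnP i.
  rewrite up_rcons down_rcons phi_T0 // JME d0 mulr0; split=> //.
  have E t : mxfun (JMo 0) (fun u => (u == v)%:R) t = nres (node_at v 0) * (t == v)%:R.
    by rewrite JME; case: (eqVneq t v) => [->|] //; rewrite !mulr0.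
  by rewrite (mxfun_ext _ E) mxfun_scaler -/(up s v) u0 mulr0.
rewrite down_rcons_pos // d0 mulr0 add0r.
case: (boolP (same_line (node_at v i.-1) (node_at v i))) => [l|nl].
  rewrite (swap_coef_on_line _ _ _ l) mul0r; split=> //; rewrite up_rcons phi_T //.
  rewrite (mxfun_ext _ (fun t => Top_delta_line t i0 l)).
  by rewrite mxfun_scaler -/(up s v) u0 mulr0.
have [|u1 d1] := IHs (swap_tab n0 i v).
  rewrite dperm_swap_tab // -ltnS (leq_trans lt) //.
  have := len_srefR_le i (dperm lam (val v) * sref i)%g.
  by rewrite -mulgA srefK mulg1.
by rewrite up_rcons_nl // u0 u1 d1 !mulr0 addr0.
Qed.

Lemma inv_weight_tau : inv_weight eps q Q n0 lam (val tau) = 1.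
Proof.
rewrite /inv_weight big_pred0 // => -[x y]; apply/negP=> /and4P[/= xl yl bf].
rewrite !(ent_tinit n0 hl) // (rank_ltE pd0 n0) // => yx. by have := before_asym pd0 n0 yx; rewrite bf.
Qed.

(** If the larger of two consecutive entries comes first in reading order,
    exchanging them removes the inversion of their boxes and changes no other. *)
Lemma inv_weight_swap_tab (i j : 'I_n) v : i = j.+1 :> nat ->
  before (pos (val v) i) (pos (val v) j) ->
  inv_weight eps q Q n0 lam (val v) =
  swap_coef (node_at v i.-1) (node_at v i) * swap_coef (node_at v i) (node_at v i.-1)
  * inv_weight eps q Q n0 lam (val (swap_tab n0 i v)).
Proof.
move=> ij bf; have i0 : (0 < i)%N by rewrite ij.
have vS := valP v.
have ej : insubd o i.-1 = j by apply/val_inj; rewrite ij val_insubd /= ltn_ord.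
have A1 : node_at v i.-1 = pos (val v) j by rewrite !node_atE ej.
have B1 : node_at v i = pos (val v) i by rewrite node_atE valKd.
have nl : ~~ same_line (node_at v i.-1) (node_at v i).
  by rewrite A1 B1; apply: (before_not_line hl vS ij bf).
have ne : nres (node_at v i.-1) != nres (node_at v i).
  by apply: (node_at_res_neq pd0 n0 q0 par0 par_sep q_pow hl); rewrite ?ltn_ord // ij.
have inv0 : inverted n0 lam (val v) (node_at v i, node_at v i.-1).
  rewrite /inverted /= A1 B1 !(pos_diagram pd0 n0 vS) bf !(ent_pos pd0 n0 vS) ij ltnSn //.
have si : sref i i = j by apply/val_inj; rewrite /= val_sref // swapn_same // ij.
have sj : sref i j = i.
  by apply/val_inj; rewrite /= val_sref // (_ : (j : nat) = i.-1) ?swapn_pred // ij.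
rewrite /inv_weight (bigD1 (node_at v i, node_at v i.-1)) //=; congr (_ * _).
  rewrite /swap_weight !swap_coef_off_line // 1?same_lineC //.
  have h1 : nres (node_at v i.-1) - nres (node_at v i) != 0 by rewrite subr_eq0.
  have h2 : nres (node_at v i) - nres (node_at v i.-1) != 0 by rewrite subr_eq0 eq_sym.
  by field; rewrite h1 h2.
apply: eq_bigl => -[x y]; rewrite /inverted /= swap_tab_ord //.
case xl: (x \in diagram lam); case yl: (y \in diagram lam) => //=.
rewrite !(ent_tact n0 _ vS) //.
case bxy: (before x y) => //=.
have ent_ij k : k = ent (val v) (pos (val v) k) by rewrite (ent_pos pd0 n0 vS).
have pe x' k : x' \in diagram lam -> (ent (val v) x' == k) = (x' == pos (val v) k).
  move=> x'l; apply/eqP/eqP=> [<-|->]; first by rewrite (pos_ent pd0 n0 vS).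
  by rewrite (ent_pos pd0 n0 vS).
rewrite xpair_eqE A1 B1 -!pe //.
have nij : ~~ ((ent (val v) x == j) && (ent (val v) y == i)).
  rewrite !pe //; apply/negP=> /andP[/eqP ex /eqP ey].
  by have := before_asym pd0 n0 bf; rewrite -ex -ey bxy.
have nxy : ent (val v) x != ent (val v) y.
  apply/eqP=> /(ent_inj pd0 vS xl yl) exy.
  by rewrite exy before_irr in bxy.
move: nij nxy; move: (ent (val v) x) (ent (val v) y) => a b nij nab.
apply/andP/idP=> [[lt nji]|lt].
  rewrite !val_sref // swapn_mono //; move: nji; rewrite -!val_eqE /= ij andbC //.
case: (boolP ((a == i) && (b == j))) => [/andP[/eqP ai /eqP bj]|nji].
  by move: lt; rewrite ai bj si sj ij ltnNge leqnSn.
split=> //; case: (ltngtP b a) => [//|lt'|/val_inj e]; last by rewrite e eqxx in nab.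
have := swapn_mono i0 lt' _; rewrite -!val_sref // => h.
by move: lt; rewrite ltnNge ltnW // h //; move: nij; rewrite -!val_eqE /= ij.
Qed.

(** Along a reduced word, the diagonal term of the last generator contributes
    nothing by [up_down_short]; what remains is the pair of off-diagonal
    coefficients for one exchange, whose product is the weight of the inverted
    pair that the exchange creates. *)
Lemma up_down_reduced s v : (\prod_(k <- s) sref k)%g = dperm lam (val v) ->
  size s = len (dperm lam (val v)) -> up s v * down s v = inv_weight eps q Q n0 lam (val v).
Proof.
elim/last_ind: s v => [|s i IHs] v sv ss.
  have -> : v = tau by apply: dperm_inj; rewrite -sv big_nil dperm_tau.
  by rewrite inv_weight_tau /up /down !big_nil rmorph1 !(mxfun1 tau) eqxx mulr1.
rewrite -sv in ss; have [[j ij lt] sE ls] := reduced_rcons ss.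
rewrite sv in lt sE ss.
have i0 : (0 < i)%N by rewrite ij.
have ei k : pos (val v) k = pos (tinit lam) ((dperm lam (val v))^-1%g k).
  rewrite -{1}(dpermP pd0 n0 hl (valP v)) -{1}(permKV (dperm lam (val v)) k).
  by rewrite (pos_tact pd0 n0 _ _ (tinit_Std pd0 n0 hl)).
have bf : before (pos (val v) i) (pos (val v) j).
  by rewrite !ei (pos_tinit_before pd0 n0 _ _ hl).
have ej : insubd o i.-1 = j by apply/val_inj; rewrite ij val_insubd /= ltn_ord.
have nl : ~~ same_line (node_at v i.-1) (node_at v i).
  by rewrite !node_atE ej valKd; apply: (before_not_line hl (valP v) ij bf).
have short : (size s < len (dperm lam (val v)))%N by rewrite -ss size_rcons.
have [u0 d0] := up_down_short short.
rewrite up_rcons_nl // down_rcons_pos // u0 d0 !mulr0 !add0r.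
rewrite (inv_weight_swap_tab ij bf) -(IHs (swap_tab n0 i v)) ?dperm_swap_tab //; first by ring.
by rewrite ls sE.
Qed.

Lemma Tperm1 : Tperm T (1%g : 'S_n) = 1.
Proof.
by have [[|i s] [ss _ ->]] := Tperm_word T (1%g : 'S_n); [rewrite big_nil|rewrite len1 in ss].
Qed.

Lemma gamma_rep v : gam (val v) = melt_eigenvalue * inv_weight eps q Q n0 lam (val v).
Proof.
have [_ /(_ lam lam hl hl (val tau) (val v) (val v) (val tau))] := hgam.
rewrite !(valP tau) !(valP v) eqxx => /(_ isT isT isT isT) E.
have [s [ss sw Ts]] := Tperm_word T (dperm lam (val v)).
have [_ _ star1 _ _] := hstar.
rewrite /felt dperm_tau Tperm1 star1 !mulr1 Ts (star_word s hstar) in E.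
rewrite -(up_down_reduced sw ss) /up /down.
apply: (matrix_unit_relation tau (phi_Felt tau) (phi_Felt v) phi_melt melt_eigenvalue_neq0).
have phiM (a b : H) : phi (a * b) = phi a * phi b by rewrite rmorphM.
have phiZ c (a : H) : phi (c *: a) = c *: phi a by rewrite linearZ.
by rewrite -!phiM -phiZ E.
Qed.

End Representation.

(** The factor is the eigenvalue of m_lambda at the initial tableau. *)
Proposition gamma_formula : exists2 c : K, c != 0 &
  forall t : tableau, t \in Std lam -> gam t = c * inv_weight eps q Q n0 lam t.
Proof.
have [phi phiT] := seminormal_rep.
exists melt_eigenvalue; first exact: melt_eigenvalue_neq0.
by move=> t tS; have := gamma_rep phiT (exist _ t tS).
Qed.

End GammaFormula.

(** * Middle tableaux and rotations of the blocks *)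

(** A coset has an element of minimal length, so that the choice in [young_part]
    succeeds. *)
Lemma young_partP n a (w : 'S_n) :
  let x := young_part a w in
  x \in young n a /\ block_minimal (fun i : 'I_n => (a <= i : nat)%N) (x^-1 * w)%g.
Proof.
set be := fun i : 'I_n => _; have yE : young n a = block_stab be := young_block n a.
rewrite /young_part; case: pickP => [x /andP[xY /forallP xmin]|no].
  split=> // y yY; have := xmin y; rewrite yE yY => /implyP; exact.
have y1 : (1%g : 'S_n) \in young n a.
  by rewrite yE (group1 (block_stab_groupType be)).
pose y := [arg min_(y < 1%g in young n a) len (y * w)%g].
have [yY ymin] : y \in young n a /\ forall z, z \in young n a ->
    (len (y * w)%g <= len (z * w)%g)%N.
  by rewrite /y; case: arg_minnP => // z zY zmin; split.
have yV : (y^-1)%g \in young n a by move: yY; rewrite yE (@groupV _ (block_stab_groupType be)).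
have := no (y^-1)%g; rewrite yV /= => /negP[]; apply/forallP=> z; apply/implyP=> zY.
rewrite invgK mulgA ymin //; rewrite yE in zY yY *.
exact: (groupM (G := block_stab_groupType be) zY yY).
Qed.

(** The cofactor of the Young part is increasing on both blocks. *)
Lemma young_part_order n a (w : 'S_n) (i j : 'I_n) :
  (a <= i)%N = (a <= j)%N ->
  (young_part a w i < young_part a w j)%N = (w i < w j)%N.
Proof.
have [xY xmin] := young_partP a w; set x := young_part a w in xY xmin *.
rewrite young_block in xY; have bx := elimT (block_stabP _ _) xY => ij.
have mono (u v : 'I_n) : (a <= u)%N = (a <= v)%N -> (x u < x v)%N -> (w u < w v)%N.
  move=> uv lt; have := block_minimal_mono (@young_mono n a) xmin _ lt.
  by rewrite !permM !permK; apply; rewrite !bx uv.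
apply/idP/idP; first exact: mono.
case: (ltngtP (x i) (x j)) => // [lt|/val_inj/perm_inj->]; last by rewrite ltnn.
by have := mono j i (esym ij) lt; rewrite ltnNge => /negP h /ltnW.
Qed.

Lemma young_part_block n a (w : 'S_n) (i : 'I_n) :
  (young_part a w i < a)%N = (i < a)%N.
Proof.
have [] := young_partP a w; rewrite inE => /forallP/(_ i)/eqP //.
Qed.

Section Shift.
Variables (p d n : nat).
Local Notation mpart := (mpart p d n).
Local Notation node := (node p d n).
Local Notation tableau := (tableau p d n).
Implicit Types (lam : mpart) (x y : node) (t : tableau).
Hypothesis p0 : (0 < p)%N.
Hypothesis d0 : (0 < d)%N.
Hypothesis n0 : (0 < n)%N.

Let pd0 : (0 < p * d)%N. Proof. by rewrite muln_gt0 p0. Qed.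

(** The action on nodes that is dual to the rotation of shapes and tableaux:
    [tshift z t x = t (nshift z x)]. *)
Definition nshift (z : nat) x : node := (shift_comp z x.1.1, x.1.2, x.2).

Lemma shift_compD z z' (s : 'I_(p * d)) :
  shift_comp z (shift_comp z' s) = shift_comp (z' + z) s.
Proof. by apply/val_inj; rewrite /= modnDml mulnDl addnA. Qed.

Lemma shift_comp_p (s : 'I_(p * d)) : shift_comp p s = s.
Proof. by apply/val_inj; rewrite /= modnDr modn_small. Qed.

Lemma nshiftD z z' x : nshift z (nshift z' x) = nshift (z' + z) x.
Proof. by rewrite /nshift /= shift_compD. Qed.

Lemma nshift_p x : nshift p x = x.
Proof. by case: x => -[s a] b; rewrite /nshift /= shift_comp_p. Qed.

Lemma nshiftK z : (z <= p)%N -> cancel (nshift z) (nshift (p - z)).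
Proof. by move=> zp x; rewrite nshiftD subnKC // nshift_p. Qed.

Lemma nshiftVK z : (z <= p)%N -> cancel (nshift (p - z)) (nshift z).
Proof. by move=> zp x; rewrite nshiftD subnK // nshift_p. Qed.

Lemma mshiftD z z' lam : mshift z (mshift z' lam) = mshift (z + z') lam.
Proof. by apply/ffunP=> s; rewrite !ffunE shift_compD. Qed.

Lemma mshift_p lam : mshift p lam = lam.
Proof. by apply/ffunP=> s; rewrite ffunE shift_comp_p. Qed.

Lemma mshift0 lam : mshift 0 lam = lam.
Proof.
apply/ffunP=> s; rewrite ffunE; congr (lam _); apply/val_inj => /=.
by rewrite mul0n addn0 modn_small.
Qed.

Lemma operiodP lam : (0 < operiod lam)%N /\ mshift (operiod lam) lam = lam.
Proof.
rewrite /operiod; case: arg_minnP => /= [|k /andP[k0 /eqP]]; last by [].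
by rewrite p0 mshift_p eqxx.
Qed.

Lemma mshift_mul_operiod lam m : mshift (m * operiod lam) lam = lam.
Proof.
elim: m => [|m IHm]; first by rewrite mul0n mshift0.
by rewrite mulSn -mshiftD IHm; case: (operiodP lam).
Qed.

Lemma mshift_sub lam z : (p <= z)%N -> mshift z lam = lam -> mshift (z - p) lam = lam.
Proof. by move=> pz e; rewrite -[in RHS]e -{2}(subnK pz) -mshiftD mshift_p. Qed.

Lemma diagram_nshift z lam x : mshift z lam = lam ->
  (nshift z x \in diagram lam) = (x \in diagram lam).
Proof. by move=> e; rewrite !inE /= -[in RHS]e ffunE. Qed.

Lemma tshiftE z t x : tshift z t x = t (nshift z x).
Proof. by rewrite ffunE. Qed.

Lemma ent_tshift z t x : ent n0 (tshift z t) x = ent n0 t (nshift z x).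
Proof. by rewrite /ent tshiftE. Qed.

Lemma tshift_Std z lam t : (z <= p)%N -> mshift z lam = lam -> t \in Std lam ->
  tshift z t \in Std lam.
Proof.
move=> zp e tS; apply: (StdP (n0 := n0)).
- by move=> x; rewrite tshiftE (Std_diagram tS) diagram_nshift.
- exists (fun k => nshift (p - z) (pos pd0 n0 t k)) => x k; rewrite tshiftE.
  split=> [/(Std_posE pd0 n0 tS) <-|->]; first by rewrite nshiftK.
  by rewrite nshiftVK // (Std_pos pd0 n0 tS).
- move=> x y xl yl xy lt; rewrite !ent_tshift.
  by apply: (Std_row n0 tS); rewrite ?diagram_nshift // /nshift /= xy.
- move=> x y xl yl s c r; rewrite !ent_tshift.
  by apply: (Std_col n0 tS); rewrite ?diagram_nshift // /nshift /= s.
Qed.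

Section Weights.
Variables (K : fieldType) (eps q : K) (Q : d.-tuple K).
Local Notation nres := (@node_res p d n K eps q Q).
Local Notation par := (cyc_param eps Q).
Hypothesis heps : p.-primitive_root eps.

Lemma cyc_param_shift z (s : 'I_(p * d)) : par (shift_comp z s) = eps ^+ z * par s.
Proof.
rewrite /cyc_param /= -modn_divl modn_dvdm ?dvdn_mull // [(s + _)%N]addnC modnMDl.
by rewrite divnMDl // !exprS (prim_expr_mod heps) exprD; ring.
Qed.

Lemma node_res_nshift z x : nres (nshift z x) = eps ^+ z * nres x.
Proof. by rewrite /node_res /= cyc_param_shift mulrA. Qed.

(** A rotation multiplies all residues by a common power of [eps], and the weight
    is homogeneous of degree 0. *)
Lemma swap_weight_nshift z x y :
  swap_weight eps q Q (nshift z x) (nshift z y) = swap_weight eps q Q x y.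
Proof.
have e0 : eps ^+ z != 0 by rewrite expf_neq0 // (eps_neq0 heps).
rewrite /swap_weight !node_res_nshift; move: (nres x) (nres y) (eps ^+ z) e0 => u v e e0.
have -> : e * u - e * v = e * (u - v) by ring.
case: (eqVneq (u - v) 0) => [->|uv]; first by rewrite mulr0 expr0n /= invr0 !mulr0.
by field; rewrite e0 uv.
Qed.

Lemma swap_weightC x y : swap_weight eps q Q x y = swap_weight eps q Q y x.
Proof.
rewrite /swap_weight -[(nres y - nres x) ^+ 2]sqrrN opprB; congr (_ / _); ring.
Qed.

End Weights.
End Shift.

(** * Products over crossing pairs *)

Section MidTableau.
Variables (p d n : nat).
Hypothesis pd0 : (0 < p * d)%N.
Hypothesis n0 : (0 < n)%N.
Variables (lam : mpart p d n) (t : tableau p d n) (z : nat).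
Hypothesis hl : is_mpart lam.
Hypothesis tS : t \in Std lam.
Hypothesis z0 : (z %% p)%N != 0%N.
Local Notation cut := (z %% p * d)%N.
Local Notation ent := (ent n0).
Local Notation m := (mid lam t z).

Let w := dperm lam t.
Let x := young_part (presize lam cut) w.

Lemma mid_tact : m = tact t (w^-1 * x)%g.
Proof.
have e : tact (tact (tinit lam) w) w^-1 = tinit lam.
  by rewrite -tactM mulgV tact1.
rewrite (dpermP pd0 n0 hl tS) in e.
by rewrite tactM e /mid (negPf z0).
Qed.

Lemma ent_mid A : A \in diagram lam -> ent m A = x (ent (tinit lam) A).
Proof.
by move=> Al; rewrite /mid (negPf z0) (ent_tact n0 _ (tinit_Std pd0 n0 hl)).
Qed.

Lemma ent_dperm A : A \in diagram lam -> ent t A = w (ent (tinit lam) A).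
Proof.
move=> Al; rewrite -[in LHS](dpermP pd0 n0 hl tS).
by rewrite (ent_tact n0 _ (tinit_Std pd0 n0 hl)).
Qed.

(** Together with [mid_cross], this says that the middle tableau lists all the
    entries of the first blocks before the others, without changing the order
    inside either part. *)
Lemma mid_same A B : A \in diagram lam -> B \in diagram lam ->
  (A.1.1 < cut)%N = (B.1.1 < cut)%N ->
  (ent m A < ent m B)%N = (ent t A < ent t B)%N.
Proof.
move=> Al Bl e; rewrite !ent_mid // !ent_dperm //; apply: young_part_order.
rewrite (leqNgt _ (ent (tinit lam) A)) (leqNgt _ (ent (tinit lam) B)).
by rewrite !(ent_tinit_presize n0 hl) // e.
Qed.

Lemma mid_cross A B : A \in diagram lam -> B \in diagram lam ->
  (A.1.1 < cut)%N -> ~~ (B.1.1 < cut)%N -> (ent m A < ent m B)%N.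
Proof.
move=> Al Bl ca cb; rewrite !ent_mid //.
rewrite -(ent_tinit_presize n0 hl) // -(young_part_block _ w) in ca.
rewrite -(ent_tinit_presize n0 hl) // -(young_part_block _ w) -leqNgt in cb.
exact: leq_trans ca cb.
Qed.

Lemma mid_Std : m \in Std lam.
Proof.
rewrite mid_tact; apply: (tact_Std (n0 := n0) pd0 tS) => A B Al Bl s _ lt.
rewrite -!(ent_tact n0 _ tS) // -mid_tact mid_same // s //.
Qed.

End MidTableau.

Section Crossings.
Variables (K : fieldType) (p d n : nat).
Local Notation node := (node p d n).
Implicit Types (f : node -> node -> K) (X Y : nat -> bool).

Definition pairs_prod f : K := \prod_x \prod_y f x y.

(** The product over the pairs with first member in a component of [X] and second
    member in a component of [Y]. *)
Definition cross f X Y : K :=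
  pairs_prod (fun x y => if X x.1.1 && Y y.1.1 then f x y else 1).

Lemma pairs_prodM f g : pairs_prod f * pairs_prod g = pairs_prod (fun x y => f x y * g x y).
Proof.
rewrite /pairs_prod -big_split; apply: eq_bigr => x _.
by rewrite -big_split.
Qed.

Lemma eq_pairs_prod f g : (forall x y, f x y = g x y) -> pairs_prod f = pairs_prod g.
Proof. by move=> e; apply: eq_bigr => x _; apply: eq_bigr => y _. Qed.

Lemma pairs_prodC f : pairs_prod f = pairs_prod (fun x y => f y x).
Proof. exact: exchange_big. Qed.

Lemma pairs_prod_bij f (s s' : node -> node) : cancel s s' -> cancel s' s ->
  pairs_prod f = pairs_prod (fun x y => f (s x) (s y)).
Proof.
move=> k k'; rewrite /pairs_prod (reindex s); last by exists s' => x _.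
by apply: eq_bigr => x _; rewrite (reindex s) //; exists s' => y _.
Qed.

Lemma eq_cross f X Y X' Y' : (forall s, (s < p * d)%N -> X s = X' s) ->
  (forall s, (s < p * d)%N -> Y s = Y' s) -> cross f X Y = cross f X' Y'.
Proof.
by move=> eX eY; apply: eq_pairs_prod => x y; rewrite eX ?eY.
Qed.

(** A pair from X to its complement ends either outside both sets or in Y. *)
Lemma cross_disjoint_union f X Y :
  (forall s, (s < p * d)%N -> ~~ (X s && Y s)) ->
  cross f X (predC X) * cross f Y (predC Y) =
  cross f (predU X Y) (predC (predU X Y)) * (cross f X Y * cross f Y X).
Proof.
move=> dis; rewrite /cross !pairs_prodM; apply: eq_pairs_prod => x y.
have := dis _ (ltn_ord x.1.1); have := dis _ (ltn_ord y.1.1).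
rewrite /=.
by case: (X x.1.1); case: (X y.1.1); case: (Y x.1.1); case: (Y y.1.1) => //= _ _; ring.
Qed.

(** The same argument as for disjoint sets: a pair from X to its complement starts
    either in both sets or outside Y. *)
Lemma cross_covering f X Y :
  (forall s, (s < p * d)%N -> X s || Y s) ->
  cross f X (predC X) * cross f Y (predC Y) =
  cross f (predI X Y) (predC (predI X Y))
  * (cross f (predC Y) (predC X) * cross f (predC X) (predC Y)).
Proof.
move=> cov; rewrite /cross !pairs_prodM; apply: eq_pairs_prod => x y.
have := cov _ (ltn_ord x.1.1); have := cov _ (ltn_ord y.1.1).
rewrite /=.
by case: (X x.1.1); case: (X y.1.1); case: (Y x.1.1); case: (Y y.1.1) => //= _ _; ring.
Qed.

End Crossings.

Section CrossWeights.
Variables (p d n : nat) (K : fieldType) (eps q : K) (Q : d.-tuple K).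
Hypothesis p0 : (0 < p)%N.
Hypothesis d0 : (0 < d)%N.
Hypothesis n0 : (0 < n)%N.
Hypothesis heps : p.-primitive_root eps.
Variable lam : mpart p d n.
Hypothesis hl : is_mpart lam.
Local Notation tableau := (tableau p d n).
Local Notation node := (node p d n).
Local Notation ent := (ent n0).
Local Notation sw := (@swap_weight p d n K eps q Q).
Implicit Types (t : tableau) (X Y : nat -> bool).

Let pd0 : (0 < p * d)%N. Proof. by rewrite muln_gt0 p0. Qed.

Definition pair_weight (x y : node) : K :=
  if (x \in diagram lam) && (y \in diagram lam) then sw x y else 1.

Definition inv_pair_weight t (x y : node) : K :=
  if (ent t y < ent t x)%N then pair_weight x y else 1.

Lemma pair_weightC x y : pair_weight x y = pair_weight y x.
Proof. by rewrite /pair_weight andbC swap_weightC. Qed.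

Lemma pair_weight_nshift z x y : mshift z lam = lam ->
  pair_weight (nshift z x) (nshift z y) = pair_weight x y.
Proof.
by move=> e; rewrite /pair_weight !diagram_nshift // (swap_weight_nshift d0 q Q heps).
Qed.

(** Of the two orders of a pair of boxes, exactly one is inverted; as the weight is
    symmetric, the inversions in both directions account for every pair once. *)
Lemma cross_inversions t X Y : t \in Std lam ->
  (forall s, (s < p * d)%N -> ~~ (X s && Y s)) ->
  cross (inv_pair_weight t) X Y * cross (inv_pair_weight t) Y X = cross pair_weight X Y.
Proof.
move=> tS dis; rewrite /cross [X in _ * X]pairs_prodC pairs_prodM.
apply: eq_pairs_prod => x y; rewrite [Y y.1.1 && X _]andbC.
case: ifP => // XY; last by rewrite mulr1.
rewrite /inv_pair_weight (pair_weightC y x) /pair_weight.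
case xl: (x \in diagram lam) => /=; last by rewrite !if_same mulr1.
case yl: (y \in diagram lam) => /=; last by rewrite !if_same mulr1.
case: ltngtP => [_|_|/val_inj/(ent_inj pd0 tS yl xl) e]; rewrite ?mulr1 ?mul1r //.
by have := dis _ (ltn_ord x.1.1); rewrite -{2}e XY.
Qed.

Lemma inv_weight_pairs t : inv_weight eps q Q n0 lam t =
  pairs_prod (fun x y => if before x y then inv_pair_weight t x y else 1).
Proof.
rewrite /inv_weight /pairs_prod pair_big big_mkcond /=; apply: eq_bigr => -[x y] _ /=.
rewrite /inverted /inv_pair_weight /pair_weight /=.
by case: (x \in _); case: (y \in _); case: (before x y); case: (_ < _)%N.
Qed.

(** Inverted pairs on one side of the cut are the same for t and mid_z(t); across
    the cut, mid_z(t) has none, and reading order is decided by the side. *)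
Lemma inv_weight_mid t z : t \in Std lam -> (z %% p)%N != 0%N ->
  inv_weight eps q Q n0 lam t = inv_weight eps q Q n0 lam (mid lam t z)
    * cross (inv_pair_weight t) (fun s => s < z %% p * d)%N (fun s => ~~ (s < z %% p * d)%N).
Proof.
move=> tS z0; rewrite !inv_weight_pairs pairs_prodM; apply: eq_pairs_prod => x y.
rewrite /inv_pair_weight /pair_weight.
case xl: (x \in diagram lam) => /=; last by rewrite !if_same mulr1.
case yl: (y \in diagram lam) => /=; last by rewrite !if_same mulr1.
case cx: (x.1.1 < z %% p * d)%N; case cy: (y.1.1 < z %% p * d)%N => /=.
- by rewrite mulr1 (mid_same pd0 n0 hl tS z0 yl xl) ?cx ?cy.
- have bxy : before x y.
    by rewrite /before (leq_trans cx) // leqNgt cy.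
  have := mid_cross pd0 n0 t hl z0 xl yl cx (negbT cy) => lt.
  have -> : (ent (mid lam t z) y < ent (mid lam t z) x)%N = false.
    by rewrite ltnNge (ltnW lt).
  by rewrite bxy mul1r.
- have -> : before x y = false.
    apply/negbTE/(before_asym pd0 n0).
    by rewrite /before (leq_trans cy) // leqNgt cx.
  by rewrite mulr1.
- by rewrite mulr1 (mid_same pd0 n0 hl tS z0 yl xl) ?cx ?cy.
Qed.

Definition block_crossing t z : K :=
  cross (inv_pair_weight t) (fun s => s < z * d)%N (fun s => ~~ (s < z * d)%N).

Lemma rcoef_crossing (gam : tableau -> K) (c : K) t z :
  (forall u, u \in Std lam -> gam u != 0) ->
  (forall u, u \in Std lam -> gam u = c * inv_weight eps q Q n0 lam u) ->
  t \in Std lam -> (z <= p)%N -> rcoef gam lam t z = block_crossing t z.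
Proof.
move=> gam0 gamE tS zp; rewrite /rcoef; case: (eqVneq (z %% p)%N 0%N) => [z0|z0].
  (* For z = 0 and for z = p there is nothing on one side of the cut. *)
  rewrite /mid z0 eqxx divff ?gam0 //; apply/esym; rewrite /block_crossing /cross.
  have [zE|zE] : z = 0%N \/ z = p.
    by move: zp; rewrite leq_eqVlt => /orP[/eqP->|zp]; [right|left; rewrite -z0 modn_small].
    by rewrite /pairs_prod big1 // => x _; rewrite big1 // => y _; rewrite zE mul0n ltn0.
  rewrite /pairs_prod big1 // => x _; rewrite big1 // => y _.
  by rewrite zE (ltn_ord y.1.1) andbF.
have mS := mid_Std pd0 n0 hl tS z0.
have zlt : (z < p)%N.
  by move: zp; rewrite leq_eqVlt => /orP[/eqP e|//]; rewrite e modnn in z0.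
have := gam0 _ mS; rewrite (gamE _ mS) (gamE _ tS) (inv_weight_mid tS z0).
rewrite modn_small // mulf_eq0 negb_or => /andP[c0 m0].
by rewrite /block_crossing; field; rewrite c0 m0.
Qed.

(** Rotating the tableau and its nodes simultaneously leaves the weights unchanged,
    so that only the set of components is rotated. *)
Lemma block_crossing_tshift t z z' : mshift z lam = lam -> (z <= p)%N ->
  block_crossing (tshift z t) z' = cross (inv_pair_weight t)
    (fun s => ((s + (p - z) * d) %% (p * d) < z' * d)%N)
    (fun s => ~~ ((s + (p - z) * d) %% (p * d) < z' * d)%N).
Proof.
move=> e zp; rewrite /block_crossing /cross.
rewrite [RHS](pairs_prod_bij _ (nshiftK zp) (nshiftVK zp)).
apply: eq_pairs_prod => x y; rewrite /inv_pair_weight !ent_tshift pair_weight_nshift //.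
have back (s : 'I_(p * d)) : ((shift_comp z s + (p - z) * d) %% (p * d))%N = s.
  by rewrite -[LHS]/(nat_of_ord (shift_comp (p - z) (shift_comp z s))) shift_compD subnKC // shift_comp_p.
by rewrite !back.
Qed.

(** The components of the blocks from a up to b - 1. *)
Definition interval a b (s : nat) : bool := (a * d <= s)%N && (s < b * d)%N.

(** The full weight of the blocks from a up to b - 1: all the pairs of boxes in
    different components, each counted once. *)
Definition ordered_weight a b : K := pairs_prod (fun x y : node =>
  if [&& (a * d <= x.1.1)%N, (x.1.1 < y.1.1)%N & (y.1.1 < b * d)%N]
  then pair_weight x y else 1).

Lemma ordered_weight_split a b c : (a <= b)%N -> (b <= c)%N ->
  ordered_weight a c = ordered_weight a b * ordered_weight b c
    * cross pair_weight (interval a b) (interval b c).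
Proof.
move=> ab bc; rewrite /ordered_weight /cross !pairs_prodM; apply: eq_pairs_prod => x y.
have abd : (a * d <= b * d)%N by rewrite leq_mul2r ab orbT.
have bcd : (b * d <= c * d)%N by rewrite leq_mul2r bc orbT.
rewrite /interval; move: (nat_of_ord x.1.1) (nat_of_ord y.1.1) abd bcd.
move: (a * d)%N (b * d)%N (c * d)%N (pair_weight x y) => A B C g u v AB BC.
case: (boolP [&& (A <= u)%N, (u < v)%N & (v < C)%N]) => h1;
case: (boolP [&& (A <= u)%N, (u < v)%N & (v < B)%N]) => h2;
case: (boolP [&& (B <= u)%N, (u < v)%N & (v < C)%N]) => h3;
case: (boolP [&& (A <= u)%N && (u < B)%N, (B <= v)%N & (v < C)%N]) => h4;
  rewrite ?mulr1 ?mul1r //; exfalso; lia.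
Qed.

Lemma ordered_weight_shift a b : mshift a lam = lam -> (a <= b)%N -> (b <= p)%N ->
  ordered_weight a b = ordered_weight 0 (b - a).
Proof.
move=> e ab bp; have ap := leq_trans ab bp; rewrite /ordered_weight.
rewrite [LHS](pairs_prod_bij _ (nshiftK ap) (nshiftVK ap)).
apply: eq_pairs_prod => x y; rewrite pair_weight_nshift //.
have val_shift (s : 'I_(p * d)) : nat_of_ord (shift_comp a s) =
    (if (s < (p - a) * d)%N then s + a * d else s + a * d - p * d)%N.
  have pad : ((p - a) * d + a * d)%N = (p * d)%N by rewrite -mulnDl subnK.
  have apd : (a * d <= p * d)%N by rewrite leq_mul2r ap orbT.
  have sp := ltn_ord s; rewrite /=; case: ltnP => h; first by rewrite modn_small //; lia.
  by rewrite -{1}(subnK (_ : p * d <= s + a * d)%N) ?modnDr ?modn_small //; lia.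
congr (if _ then _ else _).
rewrite -[(nshift a x).1.1]/(shift_comp a x.1.1) -[(nshift a y).1.1]/(shift_comp a y.1.1).
rewrite !val_shift mul0n leq0n /=.
have abd : ((b - a) * d + a * d)%N = (b * d)%N by rewrite -mulnDl subnK.
have pad : ((p - a) * d + a * d)%N = (p * d)%N by rewrite -mulnDl subnK.
have bpd : (b * d <= p * d)%N by rewrite leq_mul2r bp orbT.
move: (ltn_ord x.1.1) (ltn_ord y.1.1) abd pad bpd.
move: (nat_of_ord x.1.1) (nat_of_ord y.1.1) => u v.
move: ((b - a) * d)%N ((p - a) * d)%N (a * d)%N (b * d)%N (p * d)%N => ba pa A B P.
move=> up vp abd pad bpd.
by case: (ltnP v pa) => h1; case: (ltnP u pa) => h2; apply/idP/idP; lia.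
Qed.

Hypothesis sw_neq0 : forall x y : node, x \in diagram lam -> y \in diagram lam ->
  x.1.1 != y.1.1 -> sw x y != 0.

Lemma ordered_weight_neq0 a b : ordered_weight a b != 0.
Proof.
rewrite /ordered_weight /pairs_prod.
apply/prodf_neq0=> x _; apply/prodf_neq0=> y _.
case: ifP => [/and3P[_ lt _]|_]; last exact: oner_neq0.
rewrite /pair_weight; case: ifP => [/andP[xl yl]|_]; last exact: oner_neq0.
by apply: sw_neq0 => //; rewrite -val_eqE /= neq_ltn lt.
Qed.

(** By [ordered_weight_split] both sides are a quotient of the full weight of the
    union by those of the two parts, and a full weight depends on the number of
    blocks only by [ordered_weight_shift]. *)
Lemma cross_interval_swap a b b' c :
  mshift a lam = lam -> mshift b lam = lam -> mshift b' lam = lam ->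
  (a <= b)%N -> (b <= c)%N -> (c <= p)%N -> (b' = a + (c - b))%N ->
  cross pair_weight (interval a b) (interval b c)
  = cross pair_weight (interval a b') (interval b' c).
Proof.
move=> ea eb eb' ab bc cp b'E.
have ab' : (a <= b')%N by lia. have b'c : (b' <= c)%N by lia.
have bp := leq_trans bc cp; have b'p := leq_trans b'c cp.
have := ordered_weight_split ab bc.
rewrite (ordered_weight_split ab' b'c) !(ordered_weight_shift ea) //.
rewrite (ordered_weight_shift eb) // (ordered_weight_shift eb') //.
have -> : (b' - a = c - b)%N by lia.
have -> : (c - b' = b - a)%N by lia.
move=> h; apply/esym.
apply: (mulfI (mulf_neq0 (ordered_weight_neq0 0 (c - b)) (ordered_weight_neq0 0 (b - a)))).
by rewrite h; ring.
Qed.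

(** For L + M <= p, the two factors on the left are the crossings of the disjoint
    intervals [0, L) and [L, L + M). For L + M > p they are those of two sets that
    cover everything and meet in [0, L + M - p). In both cases the product is
    symmetric in L and M up to the weight between two adjacent intervals. *)
Proposition block_crossing_commute t L M : t \in Std lam ->
  mshift L lam = lam -> mshift M lam = lam -> (L <= p)%N -> (M <= p)%N ->
  block_crossing t L * block_crossing (tshift L t) M
  = block_crossing t M * block_crossing (tshift M t) L.
Proof.
move=> tS eL eM Lp Mp; rewrite !block_crossing_tshift //.
set f := inv_pair_weight t.
have Ld : ((p - L) * d + L * d)%N = (p * d)%N by rewrite -mulnDl subnK.
have Md : ((p - M) * d + M * d)%N = (p * d)%N by rewrite -mulnDl subnK.
have LMd : ((L + M) * d)%N = (L * d + M * d)%N by rewrite mulnDl.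
pose shifted z z' (s : nat) := ((s + (p - z) * d) %% (p * d) < z' * d)%N.
have modE z (s : nat) : (z <= p)%N -> (s < p * d)%N ->
    ((s + (p - z) * d) %% (p * d) = if s < z * d then s + (p - z) * d else s - z * d)%N.
  move=> zp sp; have zd : ((p - z) * d + z * d)%N = (p * d)%N by rewrite -mulnDl subnK.
  case: ltnP => h; first by rewrite modn_small //; lia.
  have -> : (s + (p - z) * d = (s - z * d) + p * d)%N by lia.
  by rewrite modnDr modn_small //; lia.
case: (leqP (L + M) p) => [LM|LM].
  have half z z' : mshift z lam = lam -> mshift z' lam = lam -> (z + z' <= p)%N ->
      cross f (fun s => s < z * d)%N (fun s => ~~ (s < z * d)%N)
      * cross f (shifted z z') (fun s => ~~ shifted z z' s)
      = cross f (fun s => s < (z + z') * d)%N (fun s => ~~ (s < (z + z') * d)%N)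
        * cross pair_weight (interval 0 z) (interval z (z + z')).
    move=> ez ez' zz; have zp : (z <= p)%N by lia.
    have zzd : ((z + z') * d)%N = (z * d + z' * d)%N by rewrite mulnDl.
    have zd : ((p - z) * d + z * d)%N = (p * d)%N by rewrite -mulnDl subnK.
    have zzp : ((z + z') * d <= p * d)%N by rewrite leq_mul2r zz orbT.
    have sE s : (s < p * d)%N -> shifted z z' s = interval z (z + z') s.
      move=> sp; rewrite /shifted /interval modE //; move: sp zd zzd zzp.
      move: (z * d)%N (z' * d)%N ((z + z') * d)%N ((p - z) * d)%N (p * d)%N.
      move=> Z Z' S R P sp zd zzd zzp; case: (ltnP s Z) => h /=; apply/idP/idP; lia.
    rewrite (@eq_cross _ _ _ _ f (shifted z z') _ (interval z (z + z')) (predC (interval z (z + z')))) //;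
      last by move=> s sp /=; rewrite sE.
    rewrite (@eq_cross _ _ _ _ f (fun s => s < z * d)%N _ (interval 0 z) (predC (interval 0 z))) //.
    rewrite cross_disjoint_union; last by move=> s _; rewrite /interval; lia.
    rewrite cross_inversions //; last by move=> s _; rewrite /interval; lia.
    congr (_ * _); apply: eq_cross => s sp /=; rewrite /interval; lia.
  rewrite (half L M) // (half M L) 1?addnC // (addnC M L); congr (_ * _).
  by apply: cross_interval_swap; rewrite ?mshift0 //; lia.
(* Now the two sets are the complements of the interval from z to p and of the
   interval from z + z' - p to z. *)
have half z z' : mshift z lam = lam -> mshift z' lam = lam -> (z <= p)%N -> (z' <= p)%N ->
    (p < z + z')%N ->
    cross f (fun s => s < z * d)%N (fun s => ~~ (s < z * d)%N)
    * cross f (shifted z z') (fun s => ~~ shifted z z' s)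
    = cross f (fun s => s < (z + z' - p) * d)%N (fun s => ~~ (s < (z + z' - p) * d)%N)
      * cross pair_weight (interval (z + z' - p) z) (interval z p).
  move=> ez ez' zp z'p zz.
  have zzd : ((z + z' - p) * d + p * d)%N = (z * d + z' * d)%N.
    by rewrite -!mulnDl subnK // ltnW.
  have zd : ((p - z) * d + z * d)%N = (p * d)%N by rewrite -mulnDl subnK.
  have z'd : (z' * d <= p * d)%N by rewrite leq_mul2r z'p orbT.
  have sE s : (s < p * d)%N -> shifted z z' s = ~~ interval (z + z' - p) z s.
    move=> sp; rewrite /shifted /interval modE //; move: sp zd zzd z'd.
    move: (z * d)%N (z' * d)%N ((z + z' - p) * d)%N ((p - z) * d)%N (p * d)%N.
    by move=> Z Z' S R P sp zd zzd z'd; case: (ltnP s Z) => h /=; apply/idP/idP; lia.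
  rewrite (@eq_cross _ _ _ _ f (shifted z z') _ (predC (interval (z + z' - p) z))
    (predC (predC (interval (z + z' - p) z)))) //;
    last by move=> s sp /=; rewrite sE.
  rewrite (@eq_cross _ _ _ _ f (fun s => s < z * d)%N _ (predC (interval z p))
    (predC (predC (interval z p)))); try (by move=> s sp /=; rewrite /interval sp; lia).
  rewrite cross_covering; last by move=> s sp /=; rewrite /interval sp; lia.
  congr (_ * _); first by apply: eq_cross => s sp /=; rewrite /interval sp; lia.
  rewrite -(cross_inversions tS) //; last by move=> s sp; rewrite /interval; lia.
  by congr (_ * _); apply: eq_cross => s sp /=; rewrite !negbK.
rewrite (half L M) // (half M L) 1?addnC // (addnC M L); congr (_ * _).
apply: cross_interval_swap; rewrite ?(ltnW LM) //; try lia.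
by apply: mshift_sub; [exact: ltnW | rewrite -mshiftD eM].
Qed.

End CrossWeights.

(** * Commutation of the ratios *)

Theorem theorem1p2 (p d n : nat) (hp : (1 <= p)%N) (hd : (1 <= d)%N)
    (hn : (2 <= n)%N)
    (K : fieldType) (eps q : K) (Q : d.-tuple K)
    (heps : p.-primitive_root eps) (hq0 : q != 0) (hq1 : q != 1)
    (hQ : forall c : 'I_d, tnth Q c != 0)
    (H : algType K) (T : nat -> H)
    (hH : is_hecke_algebra p n q Q T)
    (hss : semisimple H)
    (star : H -> H) (hstar : is_star n T star)
    (gam : tableau p d n -> K) (hgam : is_gamma eps q Q T star gam)
    (lam : mpart p d n) (hlam : is_mpart lam)
    (t : tableau p d n) (ht : t \in Std lam)
    (k l : nat) (hk : (k <= pquot lam)%N) (hl : (l <= pquot lam)%N) :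
  let o := operiod lam in
  rcoef gam lam t (l * o)
    * rcoef gam (mshift (l * o) lam) (tshift (l * o) t) (k * o)
  = rcoef gam lam t (k * o)
    * rcoef gam (mshift (k * o) lam) (tshift (k * o) t) (l * o).
Proof.
move=> o; have n0 : (0 < n)%N by apply: ltn_trans hn.
have pd0 : (0 < p * d)%N by rewrite muln_gt0 hp.
have par0 s : cyc_param eps Q s != 0 by apply: (cyc_param_neq0 heps hQ).
have par_sep := parameters_separated hn hd heps hQ hq0 hH hss.
have q_pow := pow_neq1 hq1 (poincare_neq0 hn hd heps hQ hq0 hH hss).
have [c c0 gamE] := gamma_formula hn hd heps hQ hq0 hq1 hH hss hstar hgam pd0 n0 hlam.
have [/(_ lam hlam) gam0 _] := hgam.
have sw0 (x y : node p d n) : x \in diagram lam -> y \in diagram lam ->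
    x.1.1 != y.1.1 -> swap_weight eps q Q x y != 0.
  move=> xl yl xy.
  have h1 := node_res_shift pd0 n0 hq0 par0 par_sep q_pow hlam xl yl xy.
  have h2 : q * node_res eps q Q y != node_res eps q Q x.
    by apply: (node_res_shift pd0 n0 hq0 par0 par_sep q_pow hlam yl xl); rewrite eq_sym.
  have h3 : node_res eps q Q x != node_res eps q Q y.
    apply/eqP=> /(node_res_inj pd0 n0 hq0 par0 par_sep q_pow hlam xl yl).
    by rewrite /same_diag (negPf xy).
  by rewrite /swap_weight !mulf_neq0 ?invr_neq0 ?expf_neq0 // subr_eq0 // eq_sym.
have le_p m : (m <= pquot lam)%N -> (m * o <= p)%N.
  move=> hm; apply: leq_trans (leq_trunc_div p o); exact: leq_mul.
have sh m : mshift (m * o) lam = lam := mshift_mul_operiod hp lam m.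
have rE u z := rcoef_crossing hp hd hlam gam0 gamE (t := u) (z := z).
rewrite !sh !rE //; try exact: le_p; try exact: (tshift_Std hp hd n0 (le_p _ _) (sh _) ht).
exact: (block_crossing_commute hp hd n0 heps hlam sw0 ht (sh l) (sh k) (le_p l hl) (le_p k hk)).
Qed.
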